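(* Let $n\ge 1$ be an integer, let $0<s<1$, and let $u\in C^2(\mathbb R^n)$ be bounded. Let $x_0\in\mathbb R^n$ and $y_0>0$. Let $Z=(X,Y)$ be the stochastic process started from $(x_0,y_0)$, where $X=\{X_t\}_{t\ge0}$ is a standard $n$-dimensional Brownian motion starting from $x_0$ and $Y=\{Y_t\}_{t\ge0}$ is a Bessel process (with parameter $s$) starting from $y_0$ and independent of $X$. Let $\tau=\tau_{\mathbb R^{n+1}_+}$ be the first exit time of $Z$ from $\mathbb R^{n+1}_+:=\mathbb R^n\times(0,+\infty)$, and define $$w(x_0,y_0):=\mathbb E^{(x_0,y_0)}\left[u(Z_\tau)\right].$$ Then $$w(x_0,y_0)=(K_{y_0}*u)(x_0)=\int_{\mathbb R^n}K_{y_0}(x_0-x)\,u(x)\,dx,$$ where for $y>0$ and $x\in\mathbb R^n$ $$K_y(x)=\frac{1}{\pi^{\frac n2}}\,\frac{\Gamma\left(s+\frac n2\right)}{\Gamma(s)}\cdot\frac{y^{2s}}{(|x|^2+y^2)^{\frac n2+s}}.$$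
   Context: The Bessel process with parameter $s\in(0,1)$ started at $y_0>0$ is the continuous real-valued diffusion $Y$ with $Y_0=y_0$ satisfying the stochastic differential equation $$dY_t=\frac{1-2s}{2Y_t}\,dt+dB_t,$$ where $B$ is a standard one-dimensional Brownian motion (independent of $X$); only its behaviour up to its first hitting time of $0$, where the equation is non-singular, matters here. This hitting time is almost surely finite. The first exit time is $\tau_{\mathbb R^{n+1}_+}(\omega)=\inf\{t>0: Z_t(\omega)\notin\mathbb R^{n+1}_+\}$, and $Z_\tau(\omega)=Z_{\tau(\omega)}(\omega)$ if $\tau(\omega)<+\infty$, and $Z_\tau(\omega)=0$ otherwise. The boundary $\partial\mathbb R^{n+1}_+=\mathbb R^n\times\{0\}$ is identified with $\mathbb R^n$, so that $u(Z_\tau)$ means $u(X_\tau)$ (almost surely $Y_\tau=0$). $\mathbb E^{(x_0,y_0)}$ denotes expectation for the process started from $(x_0,y_0)$, and $\Gamma$ is Euler's Gamma function. *)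

(* Defs.v *)
From HB Require Import structures.
From mathcomp Require Import all_boot all_order all_algebra.
From mathcomp Require Import all_classical all_reals all_analysis.

Set Implicit Arguments.
Unset Strict Implicit.
Unset Printing Implicit Defensive.

Import Order.TTheory GRing.Theory Num.Theory.
Import numFieldNormedType.Exports.

Local Open Scope classical_set_scope.
Local Open Scope ring_scope.

(* R^n is 'rV[R]_n, equipped with the sigma-algebra generated by the
   coordinates, i.e. the product of n copies of the Borel sigma-algebra of R. *)
Definition rV_display (R : realType) (n : nat) : measure_display.
Proof. exact: default_measure_display. Qed.

Section measurable_rV.
Variables (R : realType) (n : nat).

Let coors : 'I_n -> 'rV[R]_n -> R := fun i v => v ord0 i.

Let rV_set0 : g_sigma_preimage coors set0.
Proof. exact: sigma_algebra0. Qed.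

Let rV_setC A : g_sigma_preimage coors A -> g_sigma_preimage coors (~` A).
Proof. exact: sigma_algebraC. Qed.

Let rV_bigcup (F : (set 'rV[R]_n)^nat) :
  (forall i, g_sigma_preimage coors (F i)) ->
  g_sigma_preimage coors (\bigcup_i (F i)).
Proof. exact: sigma_algebra_bigcup. Qed.

HB.instance Definition _ := @isMeasurable.Build (rV_display R n)
  'rV[R]_n (g_sigma_preimage coors) rV_set0 rV_setC rV_bigcup.

End measurable_rV.

Lemma measurable_rV_coor (R : realType) (n : nat) (i : 'I_n) :
  measurable_fun [set: 'rV[R]_n] (fun v : 'rV[R]_n => v ord0 i).
Proof.
move=> _ Y mY; rewrite setTI; apply: sub_sigma_algebra => /=.
rewrite -bigcup_seq/=; exists i => /=; first by rewrite mem_index_enum.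
by exists Y => //; rewrite setTI.
Qed.

Lemma measurable_rVP (R : realType) (n : nat) (d : measure_display)
    (T : measurableType d) (f : T -> 'rV[R]_n) :
  (forall i, measurable_fun [set: T] (fun w => f w ord0 i)) ->
  measurable_fun [set: T] f.
Proof.
move=> mf; pose coors (i : 'I_n) (v : 'rV[R]_n) : R := v ord0 i.
suff : preimage_set_system [set: T] f (g_sigma_preimage coors) `<=` measurable.
  by move=> sub _ A mA; apply: sub; exists A.
rewrite -g_sigma_preimage_comp; apply: smallest_sub.
  exact: sigma_algebra_measurable.
rewrite -bigcup_seq => A [i _] [B mB <-]; exact: mf.
Qed.

Definition rV_cons (R : realType) (n : nat) (p : R * 'rV[R]_n) : 'rV[R]_n.+1 :=
  \row_i (if unlift ord0 i is Some j then p.2 ord0 j else p.1).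

Definition rV_uncons (R : realType) (n : nat) (v : 'rV[R]_n.+1) :
  R * 'rV[R]_n := (v ord0 ord0, \row_j v ord0 (lift ord0 j)).

Lemma rV_consK (R : realType) (n : nat) : cancel (@rV_cons R n) (@rV_uncons R n).
Proof.
move=> [x v]; rewrite /rV_uncons /rV_cons mxE unlift_none /=; congr (_, _).
by apply/rowP => j; rewrite !mxE liftK.
Qed.

Lemma measurable_rV_cons (R : realType) (n : nat) :
  measurable_fun [set: R * 'rV[R]_n] (@rV_cons R n).
Proof.
apply: measurable_rVP => i; under eq_fun do rewrite mxE.
case: (unlift ord0 i) => [j|]; last exact: measurable_fst.
exact: (measurableT_comp (measurable_rV_coor j) measurable_snd).
Qed.

Lemma measurable_rV_uncons (R : realType) (n : nat) :
  measurable_fun [set: 'rV[R]_n.+1] (@rV_uncons R n).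
Proof.
apply: measurable_fun_pair; first exact: measurable_rV_coor.
apply: measurable_rVP => i; under eq_fun do rewrite mxE.
exact: measurable_rV_coor.
Qed.

Section lebesgue_rV_step.
Variables (R : realType) (n : nat).
Variable m : {sigma_finite_measure set 'rV[R]_n -> \bar R}.

Definition lebesgue_rV_step : set 'rV[R]_n.+1 -> \bar R :=
  pushforward (lebesgue_measure \x m)%E (@rV_cons R n).

Let mu : {measure set (measurableTypeR R * 'rV[R]_n)%type -> \bar R} :=
  product_measure1 (@lebesgue_measure R) m.

HB.instance Definition _ := Measure.copy lebesgue_rV_step
  (measure_function_pushforward__canonical__measure_function_Measure
    mu (@measurable_rV_cons R n)).

Let step_sigma_finite : sigma_finite [set: 'rV[R]_n.+1] lebesgue_rV_step.
Proof.
have /sigma_finiteP[F [TF ndF Foo]] := sigma_finiteT (@lebesgue_measure R).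
have /sigma_finiteP[G [TG ndG Goo]] := sigma_finiteT m.
exists (fun k => @rV_uncons R n @^-1` (F k `*` G k)).
  rewrite -preimage_bigcup [X in _ @^-1` X](_ : _ = setT) ?preimage_setT//.
  apply/seteqP; split => // -[x v] _.
  have : (\bigcup_k F k) x by rewrite -TF.
  have : (\bigcup_k G k) v by rewrite -TG.
  move=> [j _ Gv] [i _ Fx]; exists (maxn i j) => //; split => /=.
    by move: x Fx; exact/subsetPset/ndF/leq_maxl.
  by move: v Gv; exact/subsetPset/ndG/leq_maxr.
move=> k; have [mF Fk] := Foo k; have [mG Gk] := Goo k.
have mFG : measurable (F k `*` G k : set (R * 'rV[R]_n)) by exact: measurableX.
split.
  by rewrite -[X in measurable X]setTI; exact: measurable_rV_uncons.
rewrite /lebesgue_rV_step /pushforward -comp_preimage.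
rewrite [X in X @^-1` _](_ : _ = id); last by apply/funext => p; exact: rV_consK.
by rewrite preimage_id product_measure1E// lte_mul_pinfty// ge0_fin_numE.
Qed.

HB.instance Definition _ := Measure_isSigmaFinite.Build _ _ _
  lebesgue_rV_step step_sigma_finite.

End lebesgue_rV_step.

(* Lebesgue measure on R^n, as the n-fold product of the Lebesgue measure on R;
   on R^0, which is a point, it is the Dirac mass. *)
Fixpoint lebesgue_rV (R : realType) (n : nat) :
    {sigma_finite_measure set 'rV[R]_n -> \bar R} :=
  if n is n'.+1 then lebesgue_rV_step (lebesgue_rV R n')
  else \d_(0 : 'rV[R]_0).

(* The norm of the library on 'rV[R]_n is the sup norm. *)
Definition sqnorm2 (R : realType) (n : nat) (x : 'rV[R]_n) : R :=
  \sum_(i < n) x ord0 i ^+ 2.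

Definition C2 (R : realType) (n : nat) (u : 'rV[R]_n -> R) : Prop :=
  let e i : 'rV[R]_n := delta_mx ord0 i in
  [/\ continuous u,
      forall i, (forall x, derivable u x (e i)) /\ continuous ('D_(e i) u)
    & forall i j, (forall x, derivable ('D_(e i) u) x (e j)) /\
                  continuous ('D_(e j) ('D_(e i) u))].

Definition Gamma (R : realType) (a : R) : R :=
  \int[lebesgue_measure]_(t in `]0, +oo[) (t `^ (a - 1) * expR (- t)).

Definition poisson_kernel (R : realType) (n : nat) (s y : R) (x : 'rV[R]_n) : R :=
  (pi `^ (n%:R / 2))^-1 * (Gamma (s + n%:R / 2) / Gamma s) *
  (y `^ (2 * s) / (sqnorm2 x + y ^+ 2) `^ (n%:R / 2 + s)).

Section processes.
Context (R : realType) (d : measure_display) (T : measurableType d).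
Variable P : probability T R.

Definition mutually_independent (I : finType) (G : I -> set (set T)) : Prop :=
  forall (J : {set I}) (A : I -> set T), (forall i, i \in J -> G i (A i)) ->
    P (\bigcap_(i in [set` J]) A i) = (\prod_(i in J) P (A i))%E.

Definition independent2 (G H : set (set T)) : Prop :=
  forall A B, G A -> H B -> P (A `&` B) = (P A * P B)%E.

(* A process has time set [0, +oo[; its values at negative times are junk, and
   no definition below depends on them. *)
Definition sigma_process (d' : measure_display) (S : measurableType d')
    (X : R -> T -> S) : set (set T) :=
  <<s \bigcup_(t in [set t : R | 0 <= t])
        preimage_set_system setT (X t) measurable >>.

(* In brownian_normal, a < b is strict because normal_prob m 0 is by convention
   the uniform law on [0, 1] and not the Dirac mass at m. *)
Record brownian (b0 : R) (B : R -> T -> R) : Prop := Brownian {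
  brownian_measurable : forall t, 0 <= t -> measurable_fun setT (B t) ;
  brownian_start : {ae P, forall w, B 0 w = b0} ;
  brownian_continuous :
    {ae P, forall w, {within `[0, +oo[, continuous (B ^~ w)}} ;
  brownian_increments : forall (k : nat) (t : nat -> R), 0 <= t 0%N ->
    (forall i, t i <= t i.+1) ->
    mutually_independent (fun i : 'I_k =>
      preimage_set_system setT (fun w => B (t i.+1) w - B (t i) w) measurable) ;
  brownian_normal : forall a b : R, 0 <= a -> a < b ->
    forall A : set R, measurable A ->
    P ((fun w => B b w - B a w) @^-1` A) = normal_prob 0 (Num.sqrt (b - a)) A }.

Definition brownian_rV (n : nat) (x0 : 'rV[R]_n) (X : R -> T -> 'rV[R]_n) : Prop :=
  (forall i, brownian (x0 ord0 i) (fun t w => X t w ord0 i)) /\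
  mutually_independent (fun i : 'I_n =>
    sigma_process (fun t w => X t w ord0 i)).

Definition hitting_time (V : Type) (A : set V) (z : R -> V) : \bar R :=
  ereal_inf [set t%:E | t in [set t : R | 0 < t /\ A (z t)]].

Definition exit_time (V : Type) (D : set V) (z : R -> V) : \bar R :=
  hitting_time (~` D) z.

Definition value_at (V : zmodType) (tau : \bar R) (z : R -> V) : V :=
  if tau is t%:E then z t else 0.

(* bessel_sde is dY = (1 - 2s) / (2Y) dt + dB before the first hitting time of 0.
   The noise being additive, its integral form has no stochastic integral. The
   behaviour of Y after that time is left unspecified. *)
Record bessel (s y0 : R) (B Y : R -> T -> R) : Prop := Bessel {
  bessel_measurable : forall t, 0 <= t -> measurable_fun setT (Y t) ;
  bessel_start : {ae P, forall w, Y 0 w = y0} ;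
  bessel_continuous :
    {ae P, forall w, {within `[0, +oo[, continuous (Y ^~ w)}} ;
  bessel_driver : brownian 0 B ;
  bessel_sde : {ae P, forall w, forall t : R, 0 <= t ->
    (t%:E < hitting_time [set 0%R] (Y ^~ w))%E ->
    Y t w = (y0 + \int[lebesgue_measure]_(r in `[0, t])
                    ((1 - 2 * s) / (2 * Y r w)) + B t w)%R} }.

End processes.

Definition upper_half_space (R : realType) (n : nat) : set ('rV[R]_n * R) :=
  [set z | 0 < z.2].

(* Main.v *)
From HB Require Import structures.
Require Import Defs.
From mathcomp Require Import all_boot all_order all_algebra.
From mathcomp Require Import all_classical all_reals all_analysis measurable_realfun.
From mathcomp Require Import ring lra.

Set Implicit Arguments.
Unset Strict Implicit.
Unset Printing Implicit Defensive.

Import Order.TTheory GRing.Theory Num.Theory.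
Import numFieldNormedType.Exports.

Local Open Scope classical_set_scope.
Local Open Scope ring_scope.

(** As [X] and [Y] are independent, the expectation of [u (X tau)] is the average
    of [E (u (X t))] over the law of the hitting time [tau], and [E (u (X t))] is
    the integral of [u] against the Gaussian density of variance [t] centred at
    [x0]. The theorem is then the conjunction of two facts. The first is that
    [tau] has the law of [y0 ^ 2 / (2 V)] where [V] has the Gamma law of
    parameter [s]; in other words [P (tau > t)] is [survival s t y0], the value at
    [y0 ^ 2 / (2 t)] of the distribution function of [V] (lemma
    [alive_at_prob]). The second is that the mixture by this law of the Gaussian
    densities of variance [y0 ^ 2 / (2 v)] is the Poisson kernel (lemma
    [heat_mixture]).

    The law of [tau] is obtained without stochastic calculus. The noise is
    additive, so the path can be compared with its Euler scheme driven by the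
    increments of the same Brownian motion and stopped at the level [eps]: by a
    Gronwall argument on each path, the scheme survives if the path stays above
    [2 eps] and dies if the path reaches 0, as soon as the step [dl] is small
    (lemmas [euler_survives] and [euler_dies]). On the other hand [survival]
    solves the backward equation of the diffusion, so that a Taylor expansion and
    the moments of the normal law show that it is a martingale along the scheme,
    up to [O (dl ^ (3 / 2))] at each step (lemma [survival_step]). Summing over
    the [T / dl] steps gives the probability that the scheme survives (lemma
    [euler_alive_prob]), then [dl] and [eps] go to 0.

    For the expectation (lemma [exit_mean]), [tau] is replaced by the next point of
    a grid. Each of the finitely many events on the position of [tau] in the grid
    belongs to the sigma-algebra of [Y], so independence applies to it, and the
    mean over the grid is, on the one hand, the mean of a function which tends to
    [u (X tau)] by continuity of the paths and, on the other hand, an integral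
    against the Gamma law which converges by continuity of [t |-> E (u (X t))].
    Fubini's theorem then exchanges the Gamma law and the integral over the
    space. *)

(** * Measures with a density *)

Section density.
Local Open Scope ereal_scope.
Context d (T : measurableType d) (R : realType).
Variables (mu nu : {measure set T -> \bar R}) (f : T -> R).
Hypothesis mf : measurable_fun [set: T] f.
Hypothesis f0 : forall x, (0 <= f x)%R.
Hypothesis nuE : forall A, measurable A -> nu A = \int[mu]_(x in A) (f x)%:E.

Import HBNNSimple.

(** True for indicators, hence for simple functions by linearity and for all
    nonnegative functions by monotone convergence. *)
Lemma ge0_integral_density (g : T -> \bar R) :
  measurable_fun [set: T] g -> (forall x, 0 <= g x) ->
  \int[nu]_x g x = \int[mu]_x (g x * (f x)%:E).
Proof.
move=> mg g0; pose h := nnsfun_approx measurableT mg.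
have hg x : (h n x)%:E @[n --> \oo] --> g x.
  by apply: cvg_nnsfun_approx.
have ndh x : {homo (fun n => (h n x)%:E) : n m / (n <= m)%N >-> n <= m}.
  by move=> m n mn; rewrite lee_fin; exact/lefP/nd_nnsfun_approx.
have mh n : measurable_fun [set: T] (fun x => (h n x)%:E).
  exact/measurable_EFinP/measurable_funP.
have mfe : measurable_fun [set: T] (EFin \o f) by exact/measurable_EFinP.
transitivity (limn (fun n => \int[nu]_x (h n x)%:E)).
  rewrite -monotone_convergence//.
  - by apply: eq_integral => x _; apply/esym/cvg_lim.
  - by move=> n x _; rewrite lee_fin.
transitivity (limn (fun n => \int[mu]_x ((h n x)%:E * (f x)%:E))); last first.
  rewrite -monotone_convergence//.
  - apply: eq_integral => x _; apply/cvg_lim => //.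
    by apply: cvgeZr.
  - by move=> n; exact: emeasurable_funM.
  - by move=> n x _; rewrite mule_ge0// lee_fin.
  - by move=> x _ m n mn; rewrite lee_wpmul2r ?lee_fin//; exact: ndh.
congr (limn _); apply/funext => n.
under eq_integral do rewrite fimfunE -fsumEFin//.
rewrite ge0_integral_fsum//; last 2 first.
  - by move=> r; exact/measurable_EFinP/measurable_funM.
  - by move=> r t _; rewrite nnfun_muleindic_ge0.
under [RHS]eq_integral => x _.
  rewrite fimfunE -fsumEFin// ge0_mule_fsuml; last first.
    by move=> r; rewrite nnfun_muleindic_ge0.
  over.
rewrite ge0_integral_fsum//; last 2 first.
  - move=> r; apply: emeasurable_funM => //.
    exact/measurable_EFinP/measurable_funM.
  - by move=> r t _; rewrite mule_ge0 ?lee_fin// -lee_fin nnfun_muleindic_ge0.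
apply: eq_fsbigr => r _.
have [r0|r0] := ltP r 0%R.
  rewrite !integral0_eq// => x _; rewrite preimage_nnfun0// indicE in_set0 mulr0//.
  by rewrite mul0e.
under eq_integral do rewrite EFinM.
rewrite ge0_integralZl_EFin//; last first.
  exact/measurable_EFinP.
under [RHS]eq_integral do rewrite EFinM -muleA.
rewrite ge0_integralZl_EFin//; last 2 first.
  by move=> x _; rewrite mule_ge0 ?lee_fin.
  by apply: emeasurable_funM => //; exact/measurable_EFinP.
congr *%E.
rewrite integral_indic// setIT nuE// [LHS]integral_mkcond.
apply: eq_integral => x _; rewrite patchE indicE.
by case: ifPn => _; rewrite ?mul1e ?mul0e.
Qed.

Lemma integral_density (g : T -> \bar R) : measurable_fun [set: T] g ->
  \int[nu]_x g x = \int[mu]_x (g x * (f x)%:E).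
Proof.
move=> mg; rewrite [LHS]integralE [RHS]integralE.
rewrite !ge0_integral_density//; last 2 first.
- exact: measurable_funeneg.
- exact: measurable_funepos.
congr (_ - _); apply: eq_integral => x _.
- by rewrite !funeposE maxe_pMl ?lee_fin// mul0e.
- by rewrite !funenegE maxe_pMl ?lee_fin// mul0e mulNe.
Qed.

End density.

(** * Derivatives *)

Section calculus.
Context {R : realType}.
Implicit Types (f g : R -> R) (x a b : R).

Lemma der_cst c x : is_derive x 1 (fun=> c : R) 0.
Proof. exact: is_derive_cst. Qed.
Lemma der_id x : is_derive x 1 (fun y : R => y) 1.
Proof. exact: is_derive_id. Qed.
Lemma der_D f g x a b : is_derive x 1 f a -> is_derive x 1 g b ->
  is_derive x 1 (fun y => f y + g y) (a + b).
Proof. exact: is_deriveD. Qed.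
Lemma der_N f x a : is_derive x 1 f a -> is_derive x 1 (fun y => - f y) (- a).
Proof. exact: is_deriveN. Qed.
Lemma der_M f g x a b : is_derive x 1 f a -> is_derive x 1 g b ->
  is_derive x 1 (fun y => f y * g y) (f x * b + g x * a).
Proof. exact: is_deriveM. Qed.
Lemma der_X f n x a : is_derive x 1 f a ->
  is_derive x 1 (fun y => f y ^+ n) (n%:R * f x ^+ n.-1 * a).
Proof.
move=> df; rewrite (_ : (fun y => f y ^+ n) = f ^+ n); last by rewrite exprfctE.
exact: is_deriveX.
Qed.
Lemma der_V f x a : f x != 0 -> is_derive x 1 f a ->
  is_derive x 1 (fun y => (f y)^-1) (- (f x ^- 2) * a).
Proof.
move=> fx0 df; have dV := @derivableV R _ f x 1 fx0 (@ex_derive _ _ _ _ _ _ _ df).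
apply: DeriveDef; first exact: dV.
by have := @deriveV R _ f x 1 fx0 (@ex_derive _ _ _ _ _ _ _ df);
  rewrite (@derive_val _ _ _ _ _ _ _ df).
Qed.
Lemma der_expR f x a : is_derive x 1 f a ->
  is_derive x 1 (fun y => expR (f y)) (expR (f x) * a).
Proof. move=> df; have := @is_derive1_comp R expR f x (expR (f x)) a (is_derive_expR _) df. exact. Qed.
Lemma der_powR f c x a : 0 < f x -> is_derive x 1 f a ->
  is_derive x 1 (fun y => f y `^ c) (c * f x `^ (c - 1) * a).
Proof.
move=> fx0 df.
by have := @is_derive1_comp R (fun y : R => y `^ c) f x _ a (@is_derive1_powR R c (f x) fx0) df; exact.
Qed.

Lemma der_comp f g x a b : is_derive (g x) 1 f a -> is_derive x 1 g b ->
  is_derive x 1 (fun y => f (g y)) (a * b).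
Proof. by move=> df dg; have := @is_derive1_comp R f g x a b df dg; exact. Qed.
Lemma der_derivable f x a : is_derive x 1 f a -> derivable f x 1.
Proof. by move=> [? _]. Qed.
Lemma der_intro f x a : derivable f x 1 -> (f^`())%classic x = a -> is_derive x 1 f a.
Proof. by move=> df fa; apply: DeriveDef => //; rewrite -derive1E. Qed.
Lemma der_cts f x a : is_derive x 1 f a -> {for x, continuous f}.
Proof. move=> df; apply: differentiable_continuous; apply/derivable1_diffP; exact: (der_derivable df). Qed.
Lemma der_val f x a : is_derive x 1 f a -> (f^`())%classic x = a.
Proof. by move=> df; rewrite derive1E derive_val. Qed.
End calculus.

(** Synthesises the derivative of an expression; the side conditions of [der_V]
    and [der_powR] and the equation with the expected derivative are left. *)
Ltac der_step := first [ eassumption | eapply der_cst | eapply der_id | eapply der_D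
  | eapply der_N | eapply der_V | eapply der_X | eapply der_M | eapply der_expR | eapply der_powR].
Ltac der := eapply is_derive_eq; [repeat der_step | cbv beta].

(** * Moments of the normal law *)

Section gauss.
Context {R : realType}.
Notation mu := (@lebesgue_measure R).

(** The exponential series dominates its term of order [k]. *)
Lemma expR_pow_le (k : nat) (x : R) : 0 <= x -> x ^+ k * expR (- x) <= k`!%:R.
Proof.
move=> x0; rewrite expRN ler_pdivrMr ?expR_gt0//.
case: k => [|k]; first by rewrite expr0 fact0 mul1r -expR0 ler_expR.
have := expR_ge1Dxn k x0; rewrite -(ler_pM2l (_ : 0 < k.+1`!%:R)); last first.
  by rewrite ltr0n fact_gt0.
apply: le_trans; rewrite mulrDr mulr1 mulrCA divff ?mulr1 ?lerDr ?ler0n//.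
Qed.

Lemma ge0_integral_oppr (f : R -> \bar R) : measurable_fun [set: R] f ->
  (forall x, 0 <= f x)%E -> (\int[mu]_x f x = \int[mu]_x f (- x)%R)%E.
Proof.
move=> mf f0.
transitivity (\int[pushforward mu (-%R : _ -> measurableTypeR R)]_x f x)%E.
  by apply: eq_measure_integral => //= A mA AS; exact/esym/lebesgue_measureN.
by rewrite ge0_integral_pushforward.
Qed.

Variable sg : R.
Hypothesis sg0 : 0 < sg.

Let e (w : R) := expR (- (w ^+ 2 / (sg ^+ 2 *+ 2))).

Let eE w : normal_pdf 0 sg w = normal_peak sg * e w.
Proof.
by rewrite normal_pdfE ?gt_eqF// /normal_fun /e subr0 mulNr.
Qed.

Let is_derive_e (w : R) : is_derive w 1 e (- (w / sg ^+ 2) * e w).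
Proof.
rewrite /e; der; rewrite /=; field.
by rewrite gt_eqF.
Qed.

Let poly_e_bound (a b c x : R) : 1 <= x ->
  `|(a * x ^+ 2 + b * x + c) * e x| <= (`|a| + `|b| + `|c|) * (8 * sg ^+ 4) * x^-1.
Proof.
move=> x1; have x0 : 0 < x by exact: lt_le_trans x1.
rewrite normrM [X in _ * X]ger0_norm ?expR_ge0//.
have h1 : `|a * x ^+ 2 + b * x + c| <= (`|a| + `|b| + `|c|) * x ^+ 2.
  rewrite !mulrDl; apply: le_trans (ler_normD _ _) _; apply: lerD; last first.
    by rewrite ler_peMr// exprn_ege1.
  apply: le_trans (ler_normD _ _) _; rewrite !normrM (gtr0_norm x0) lerD2l.
  by rewrite ler_wpM2l// expr2 ler_peMr// ltW.
have h2 : e x * x ^+ 4 <= 8 * sg ^+ 4.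
  have := @expR_pow_le 2 (x ^+ 2 / (sg ^+ 2 *+ 2)).
  have /[swap]/[apply] : 0 <= x ^+ 2 / (sg ^+ 2 *+ 2).
    by rewrite divr_ge0// ?mulrn_wge0// sqr_ge0.
  rewrite -/(e x) factE/= => h.
  have -> : x ^+ 4 = 4 * sg ^+ 4 * (x ^+ 2 / (sg ^+ 2 *+ 2)) ^+ 2.
    by field; rewrite gt_eqF.
  rewrite mulrCA (_ : 8 = 4 * 2); last by ring.
  have -> : 4 * 2 * sg ^+ 4 = (4 * sg ^+ 4) * 2 by ring.
  by rewrite ler_pM2l ?mulr_gt0 ?exprn_gt0// mulrC.
apply: le_trans (ler_wpM2r (expR_ge0 _) h1) _; rewrite -[leLHS]mulrA -[leRHS]mulrA.
rewrite ler_wpM2l ?addr_ge0// -/(e x) ler_pdivlMr//; apply: le_trans h2.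
rewrite mulrAC -exprSr mulrC ler_wpM2l ?expR_ge0// ler_weXn2l//.
Qed.

Let cvg_poly_e (a b c : R) : (a * x ^+ 2 + b * x + c) * e x @[x --> +oo] --> (0 : R).
Proof.
pose K := (`|a| + `|b| + `|c|) * (8 * sg ^+ 4).
have cK : K * x^-1 @[x --> +oo] --> (0 : R).
  rewrite -[X in _ --> X](mulr0 K); apply: cvgMr.
  apply/gtr0_cvgV0.
  - exact: nbhs_pinfty_gt.
  - exact: cvg_id.
have cK' : - (K * x^-1) @[x --> +oo] --> (0 : R) by rewrite -oppr0; exact: cvgN.
apply: (squeeze_cvgr _ cK' cK); near=> x.
rewrite -ler_norml poly_e_bound//; near: x; exact: nbhs_pinfty_ge.
Unshelve. all: by end_near. Qed.

Let q (w : R) : R := normal_peak sg * e w.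

Let cts_poly_e (F : R -> R) : continuous F -> continuous (fun w => F w * q w).
Proof.
move=> cF w; apply: cvgM; first exact: cF.
apply: cvgMr; exact: (der_cts (is_derive_e w)).
Qed.

(** The hypothesis on [F] says that [(a w ^ 2 + b w + c) e w] is a primitive of
    [F w * e w]. *)
Let int_prim (a b c : R) (F : R -> R) : continuous F -> (forall w : R, 0 <= w -> 0 <= F w) ->
  (forall w, F w * sg ^+ 2 = - (a * w ^+ 2 + b * w + c) * w + sg ^+ 2 * (2 * a * w + b)) ->
  (\int[mu]_(w in `[0%R, +oo[) (F w * q w)%:E = (- (normal_peak sg * c))%:E)%E.
Proof.
move=> cF F0 FE.
have dF (w : R) : is_derive w 1 (fun w : R => normal_peak sg * ((a * w ^+ 2 + b * w + c) * e w)) (F w * q w).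
  have := is_derive_e w => de.
  der; rewrite /= /q.
  have -> : F w = (F w * sg ^+ 2) / sg ^+ 2 by field; rewrite gt_eqF.
  by rewrite FE; field; rewrite gt_eqF.
rewrite (@ge0_continuous_FTC2y _ _ (fun w : R => normal_peak sg * ((a * w ^+ 2 + b * w + c) * e w)) 0 0).
- rewrite expr0n/= !mulr0 !add0r /e expr0n mul0r oppr0 expR0 mulr1.
  by [].
- by move=> x x0; rewrite mulr_ge0 ?F0// mulr_ge0 ?expR_ge0 ?normal_peak_ge0.
- by apply: continuous_subspaceT; exact: cts_poly_e.
- rewrite -[X in _ --> X](mulr0 (normal_peak sg)); apply: cvgMr; exact: cvg_poly_e.
- by move=> x _; exact: der_derivable (dF x).
- by apply: cvg_at_right_filter; exact: der_cts (dF 0).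
- by move=> x _; exact: der_val (dF x).
Qed.

Notation N := (normal_prob 0 sg).

Let integral_even (a b c : R) (F : R -> R) : continuous F ->
  (forall w : R, 0 <= w -> 0 <= F w) ->
  (forall w, F w * sg ^+ 2 = - (a * w ^+ 2 + b * w + c) * w + sg ^+ 2 * (2 * a * w + b)) ->
  (\int[N]_w (F `|w|)%:E = (- (2 * normal_peak sg * c))%:E)%E.
Proof.
move=> cF F0 FE.
have cFn : continuous (fun w : R => F `|w|).
  by move=> w; apply: continuous_comp; [exact: norm_continuous|exact: cF].
rewrite (@ge0_integral_density _ _ _ mu _ (normal_pdf 0 sg))//; last 4 first.
- exact: measurable_normal_pdf.
- exact: normal_pdf_ge0.
- by apply/measurable_EFinP; exact: continuous_measurable_fun.
- by move=> x; rewrite lee_fin F0.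
under eq_integral do rewrite -EFinM eE.
rewrite (@ge0_symfun_integralT _ (fun w => F `|w| * q w)); last 3 first.
- by move=> x; rewrite mulr_ge0 ?F0// mulr_ge0 ?expR_ge0 ?normal_peak_ge0.
- exact: cts_poly_e.
- by move=> x; rewrite /= normrN /q /e sqrrN.
rewrite -set_itvcy; under eq_integral.
  move=> x; rewrite inE/= in_itv/= andbT => x0; rewrite ger0_norm//; over.
by rewrite (int_prim (a := a) (b := b) (c := c))// -EFinM mulrN mulrA.
Qed.

Let RintegralN_cst (r : R) : \int[N]_w r = r.
Proof.
rewrite Rintegral_cst//; have := @probability_setT _ _ _ N.
by move=> /= ->; rewrite mulr1.
Qed.

Let iN1 : N.-integrable setT (EFin \o cst (1 : R)).
Proof. exact: finite_measure_integrable_cst. Qed.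

Let fin3 : (\int[N]_w (`|w| ^+ 3)%:E = (4 * normal_peak sg * sg ^+ 4)%:E)%E.
Proof.
rewrite (@integral_even (- sg ^+ 2) 0 (- (2 * sg ^+ 4)) (fun w : R => w ^+ 3)).
- by congr EFin; ring.
- exact: exprn_continuous.
- by move=> w; exact: exprn_ge0.
- by move=> w; ring.
Qed.

Let i3 : N.-integrable setT (EFin \o (fun w : R => `|w| ^+ 3)).
Proof.
apply/integrableP; split.
  by apply/measurable_EFinP/measurable_funX; exact: normr_measurable.
under eq_integral do rewrite /= ger0_norm ?exprn_ge0//.
by rewrite fin3 ltry.
Qed.

Lemma integrable_gauss_pow k : (k <= 3)%N -> N.-integrable setT (EFin \o (fun w : R => w ^+ k)).
Proof.
move=> k3; have := @le_integrable _ _ R N setT measurableT (EFin \o (fun w : R => w ^+ k)) (EFin \o (fun w : R => 1 + `|w| ^+ 3)); apply.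
- by apply/measurable_EFinP/measurable_funX.
- move=> w _ /=; rewrite lee_fin normrX [leRHS]ger0_norm ?addr_ge0//.
  have [w1|w1] := leP `|w| 1.
    by rewrite ler_wpDr// exprn_ile1.
  by rewrite ler_wpDl// ler_weXn2l// ltW.
- exact: (integrableD _ iN1 i3).
Qed.

Let i1 : N.-integrable setT (EFin \o (fun w : R => `|w|)).
Proof. exact: (integrable_norm (integrable_gauss_pow (isT : (1 <= 3)%N))). Qed.

(** The density is even. *)
Lemma gauss_mean : \int[N]_w w = 0.
Proof.
have i := integrable_gauss_pow (isT : (1 <= 3)%N).
pose f (w : R) : \bar R := (w * normal_pdf 0 sg w)%:E.
have mf : measurable_fun setT f.
  by apply/measurable_EFinP/measurable_funM => //; exact: measurable_normal_pdf.
have fE : (\int[N]_w w%:E = \int[mu]_w f w)%E.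
  rewrite (@integral_density _ _ _ mu _ (normal_pdf 0 sg))//.
  - exact: measurable_normal_pdf.
  - exact: normal_pdf_ge0.
have fN (w : R) : (f^\- w = f^\+ (- w)%R)%E.
  by rewrite funeposE funenegE /f !eE /e sqrrN mulNr.
have : (\int[mu]_w f w \is a fin_num)%E.
  by rewrite -fE; apply: integrable_fin_num => //.
rewrite /Rintegral fE integralE.
have -> : (\int[mu]_w f^\- w = \int[mu]_w f^\+ w)%E.
  under eq_integral do rewrite fN.
  by rewrite -(ge0_integral_oppr (f := f^\+%E))//; exact: measurable_funepos.
case: (integral mu setT f^\+%E) => //= r _.
by rewrite subrr.
Qed.

(** The function [w ^ 2 e w] has no elementary primitive, but
    [(sg ^ 2 - w ^ 2) e w] is a multiple of the derivative of [w e w]: the variance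
    is read off the polynomial [w ^ 3 - sg w ^ 2 + sg ^ 2 w + sg ^ 3],
    which is nonnegative for [w >= 0] and whose
    product with [e w] has an elementary primitive. *)
Lemma gauss_var : \int[N]_w (w ^+ 2) = sg ^+ 2.
Proof.
have i2 := integrable_gauss_pow (isT : (2 <= 3)%N).
have e3 : \int[N]_w (`|w| ^+ 3) = 4 * normal_peak sg * sg ^+ 4.
  by rewrite /Rintegral fin3.
have e1 : \int[N]_w (`|w|) = 2 * normal_peak sg * sg ^+ 2.
  rewrite /Rintegral (@integral_even 0 0 (- sg ^+ 2) id)/=.
  - by ring.
  - by move=> ?; exact: cvg_id.
  - by [].
  - by move=> w; ring.
have eF : \int[N]_w (`|w| ^+ 3 + (- sg) * w ^+ 2 + sg ^+ 2 * `|w| + sg ^+ 3) =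
    6 * normal_peak sg * sg ^+ 4.
  rewrite /Rintegral; under eq_integral do rewrite -real_normK ?num_real//.
  rewrite (@integral_even (- sg ^+ 2) (sg ^+ 3) (- (3 * sg ^+ 4))
    (fun w : R => w ^+ 3 + (- sg) * w ^+ 2 + sg ^+ 2 * w + sg ^+ 3))/=.
  - by ring.
  - move=> w; apply: cvgD; last exact: cvg_cst.
    apply: cvgD; last by apply: cvgMr; exact: cvg_id.
    by apply: cvgD; [|apply: cvgMr]; exact: exprn_continuous.
  - move=> w w0; rewrite (_ : _ + _ = w * ((w - sg / 2) ^+ 2 + 3 / 4 * sg ^+ 2) + sg ^+ 3); last by field.
    rewrite addr_ge0 ?exprn_ge0 ?(ltW sg0)// mulr_ge0// addr_ge0 ?sqr_ge0//.
    by rewrite mulr_ge0 ?sqr_ge0// divr_ge0.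
  - by move=> w; ring.
have is2 := integrableZl measurableT (- sg) i2.
have is1 := integrableZl measurableT (sg ^+ 2) i1.
have ic : N.-integrable setT (EFin \o cst (sg ^+ 3)) by exact: finite_measure_integrable_cst.
have eF' : \int[N]_w (`|w| ^+ 3 + (- sg) * w ^+ 2 + sg ^+ 2 * `|w| + sg ^+ 3) =
   4 * normal_peak sg * sg ^+ 4 - sg * (\int[N]_w (w ^+ 2)) + sg ^+ 2 * (2 * normal_peak sg * sg ^+ 2) + sg ^+ 3.
  rewrite RintegralD//=; [|exact: (integrableD _ (integrableD _ i3 is2) is1)].
  rewrite RintegralD//=; [|exact: (integrableD _ i3 is2)].
  rewrite RintegralD//=.
  have z1 : \int[N]_w (sg ^+ 2 * `|w|) = sg ^+ 2 * \int[N]_w `|w| by rewrite RintegralZl.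
  have z2 : \int[N]_w (- sg * w ^+ 2) = - sg * \int[N]_w (w ^+ 2) by rewrite RintegralZl.
  rewrite z1 z2 e3 e1 RintegralN_cst.
  by rewrite mulNr.
apply: (@mulfI _ sg); first by rewrite gt_eqF.
have : 4 * normal_peak sg * sg ^+ 4 - sg * (\int[N]_w (w ^+ 2)) + sg ^+ 2 * (2 * normal_peak sg * sg ^+ 2) + sg ^+ 3 = 6 * normal_peak sg * sg ^+ 4.
  by rewrite -eF'.
by move=> h; rewrite -exprS; lra.
Qed.

Lemma gauss_abs3 : \int[N]_w (`|w| ^+ 3) <= 2 * sg ^+ 3.
Proof.
rewrite /Rintegral fin3/= (_ : 4 * normal_peak sg * sg ^+ 4 = (2 * sg ^+ 3) * (2 * (sg * normal_peak sg))); last by ring.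
have c0 : 0 <= 2 * sg ^+ 3 by rewrite mulr_ge0// exprn_ge0// ltW.
rewrite ler_piMr//.
rewrite /normal_peak -mulrnAr -[pi *+ 2]mulr_natr sqrtrM ?sqr_ge0// sqrtr_sqr gtr0_norm//.
have p0 : 0 < Num.sqrt (pi * 2 : R) by rewrite sqrtr_gt0 mulr_gt0 ?pi_gt0.
rewrite invfM [sg * _]mulrA mulfV ?gt_eqF// mul1r ler_pdivrMr// mul1r.
rewrite -[leLHS](@ger0_norm _ 2)// -sqrtr_sqr ler_sqrt ?mulr_ge0 ?pi_ge0//.
by rewrite expr2 ler_wpM2r// pi_ge2.
Qed.

(** The first moment vanishes, the second is [sg ^ 2], and the third absolute moment
    controls the error. *)
Lemma gauss_expansion (g : R -> R) (a b c M M' : R) :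
  measurable_fun setT g ->
  (forall w, `|g w - (a + b * w + c * w ^+ 2)| <= M * `|w| ^+ 3 + M') ->
  0 <= M ->
  `|\int[N]_w g w - (a + c * sg ^+ 2)| <= 2 * M * sg ^+ 3 + M'.
Proof.
move=> mg gle M0.
have i1' := integrable_gauss_pow (isT : (1 <= 3)%N).
have i2 := integrable_gauss_pow (isT : (2 <= 3)%N).
have ia : N.-integrable setT (EFin \o cst a) by exact: finite_measure_integrable_cst.
have iM' : N.-integrable setT (EFin \o cst M') by exact: finite_measure_integrable_cst.
have ib := integrableZl measurableT b i1'.
have ic := integrableZl measurableT c i2.
have iM := integrableZl measurableT M i3.
have ip := integrableD measurableT (integrableD measurableT ia ib) ic.
have ie := integrableD measurableT iM iM'.
have id : N.-integrable setT (EFin \o (fun w => g w - (a + b * w + c * w ^+ 2))).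
  have := @le_integrable _ _ R N setT measurableT (EFin \o (fun w => g w - (a + b * w + c * w ^+ 2))) (EFin \o (fun w : R => M * `|w| ^+ 3 + M')).
  apply => //.
  - apply/measurable_EFinP/measurable_funB => //.
    by have /measurable_int/measurable_EFinP := ip.
  - by move=> w _ /=; rewrite lee_fin (le_trans (gle w))// ler_norm.
have ig : N.-integrable setT (EFin \o g).
  have := integrableD measurableT id ip; apply: eq_integrable => // w _ /=.
  by rewrite -!EFinM -!EFinD; congr EFin; rewrite expr1; ring.
have -> : a + c * sg ^+ 2 = \int[N]_w (a + b * w + c * w ^+ 2).
  rewrite RintegralD//=; [|exact: (integrableD _ ia ib)].
  rewrite RintegralD//= !RintegralZl//= gauss_mean gauss_var mulr0 addr0.
  by rewrite RintegralN_cst.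
rewrite -RintegralB//.
apply: le_trans (le_normr_Rintegral _ _) _ => //.
have le1 : \int[N]_t `|g t - (a + b * t + c * t ^+ 2)| <= \int[N]_w (M * `|w| ^+ 3 + M').
  apply: le_Rintegral => //; exact: integrable_norm.
apply: le_trans le1 _.
have -> : \int[N]_w (M * `|w| ^+ 3 + M') = M * \int[N]_w (`|w| ^+ 3) + M'.
  by rewrite RintegralD//= RintegralZl//= RintegralN_cst.
by rewrite lerD2r [2 * M]mulrC -mulrA ler_wpM2l// gauss_abs3.
Qed.

End gauss.

(** * The Gamma distribution function *)

Section gamma.
Context {R : realType}.
Notation mu := (@lebesgue_measure R).

Definition gamma_fun (a v : R) : R := v `^ (a - 1) * expR (- v).

Lemma gamma_fun_ge0 a v : 0 <= gamma_fun a v.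
Proof. by rewrite mulr_ge0 ?powR_ge0 ?expR_ge0. Qed.

Lemma measurable_gamma_fun a : measurable_fun setT (gamma_fun a).
Proof.
apply: measurable_funM; first exact: measurable_powR.
by apply: measurableT_comp => //; exact: measurableT_comp.
Qed.

Lemma der_gamma_fun a (v : R) : 0 < v ->
  is_derive v 1 (gamma_fun a) (((a - 1) / v - 1) * gamma_fun a v).
Proof.
move=> v0; rewrite /gamma_fun; der => //=.
rewrite [v `^ (a - 1 - 1)]powRB; last by apply/implyP => _; rewrite gt_eqF.
by rewrite powRr1 ?ltW//; field; rewrite gt_eqF.
Qed.

Variable a : R.
Hypothesis a0 : 0 < a.

(** Exhausting [0 < v <= b] by segments avoids the singularity at 0. *)
Let seg (b : R) (k : nat) : set R := [set` `[b / k.+2%:R, b]].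

Let seg_bigcup b : 0 < b -> \bigcup_k seg b k = [set` `]0, b]].
Proof.
move=> b0; apply/seteqP; split => [x [k _]|x]; rewrite /seg /= !in_itv/=.
  by move=> /andP[kx ->]; rewrite andbT (lt_le_trans _ kx)// divr_gt0.
move=> /andP[x0 xb]; exists (Num.truncn (b / x)) => //=.
rewrite /seg/= in_itv/= xb andbT ler_pdivrMr// mulrC -ler_pdivrMr//.
by apply: ltW; apply: lt_le_trans (truncnS_gt _) _; rewrite ler_nat.
Qed.

Lemma le_int_powR (b : R) : 0 < b ->
  (\int[mu]_(v in `]0%R, b]) (v `^ (a - 1))%:E <= (b `^ a / a)%:E)%E.
Proof.
move=> b0; rewrite -seg_bigcup//.
have cv : (\int[mu]_(v in seg b k) (v `^ (a - 1))%:E @[k --> \oo] -->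
    \int[mu]_(v in \bigcup_k seg b k) (v `^ (a - 1))%:E)%E.
  apply: ge0_nondecreasing_set_cvg_integral.
  - apply/nondecreasing_seqP => k; rewrite subsetEset => x.
    rewrite /seg/= !in_itv/= => /andP[kx ->]; rewrite andbT (le_trans _ kx)//.
    by rewrite ler_pM2l// lef_pV2 ?posrE// ler_nat.
  - by move=> k; exact: measurable_itv.
  - by move=> k; apply/measurable_EFinP; apply: measurable_funTS; exact: measurable_powR.
  - by move=> k x _; rewrite lee_fin powR_ge0.
apply: (cvge_le _ cv); apply: nearW => k.
have bk : b / k.+2%:R < b by rewrite ltr_pdivrMr// ltr_pMr// ltr1n.
have bk0 : 0 < b / k.+2%:R by rewrite divr_gt0.
have dp (x : R) : 0 < x -> is_derive x 1 (fun v : R => a^-1 * v `^ a) (x `^ (a - 1)).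
  by move=> x0; der => //=; field; rewrite gt_eqF.
rewrite /seg (continuous_FTC2 (F := fun v : R => a^-1 * v `^ a) bk).
- rewrite -EFinB lee_fin mulrC lerBlDr lerDl mulr_ge0 ?powR_ge0// invr_ge0 ltW//.
- apply: continuous_in_subspaceT => x; rewrite inE/= in_itv/= => /andP[kx _].
  have x0 := lt_le_trans bk0 kx.
  apply: (@der_cts _ _ _ ((a - 1) * x `^ (a - 1 - 1) * 1)).
  exact: (der_powR _ x0 (der_id x)).
- split.
  + by move=> x; rewrite in_itv/= => /andP[kx _]; apply: der_derivable (dp x _); exact: lt_trans kx.
  + by apply: cvg_at_right_filter; apply: der_cts (dp _ bk0).
  + by apply: cvg_at_left_filter; apply: der_cts (dp _ b0).
- move=> x; rewrite in_itv/= => /andP[kx _]; apply: der_val; apply: dp; exact: lt_trans kx.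
Qed.

Lemma measurable_EFin_gamma_fun D : measurable_fun D (fun v => (gamma_fun a v)%:E).
Proof. by apply/measurable_EFinP; apply: measurable_funTS; exact: measurable_gamma_fun. Qed.

Lemma le_int_gamma (b : R) : 0 < b ->
  (\int[mu]_(v in `]0%R, b]) (gamma_fun a v)%:E <= (b `^ a / a)%:E)%E.
Proof.
move=> b0; apply: le_trans (le_int_powR b0).
apply: ge0_le_integral => //.
- by move=> x _; rewrite lee_fin gamma_fun_ge0.
- exact: measurable_EFin_gamma_fun.
- by apply/measurable_EFinP; apply: measurable_funTS; exact: measurable_powR.
move=> x /=; rewrite in_itv/= => /andP[x0 _].
rewrite lee_fin /gamma_fun ler_piMr ?powR_ge0//.
by rewrite -[leRHS]expR0 ler_expR oppr_le0 ltW.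
Qed.

Let gamma_fun_tail : exists2 C : R, 0 <= C & forall v : R, 1 <= v -> gamma_fun a v <= C * v ^- 2.
Proof.
pose k := Num.truncn a; exists (k.+2`!%:R) => // v v1.
have v0 : 0 < v by exact: lt_le_trans v1.
rewrite ler_pdivlMr ?exprn_gt0//; apply: le_trans (expR_pow_le k.+2 (ltW v0)).
rewrite /gamma_fun mulrAC ler_wpM2r ?expR_ge0// -[leLHS]/(_ * _).
rewrite -(powR_mulrn 2 (ltW v0)) -(powR_mulrn k.+2 (ltW v0)) -powRD; last first.
  by apply/implyP => _; rewrite gt_eqF.
apply: ler_powR => //; rewrite -[k.+2]addn1 natrD.
have /ltW := truncnS_gt a; rewrite -/k => h.
lra.
Qed.

Let cts_inv2 : {within `[(1 : R), +oo[, continuous (fun v : R => v ^- 2)}.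
Proof.
apply: continuous_in_subspaceT => x; rewrite inE/= in_itv/= andbT => x1.
have x0 : x != 0 by rewrite gt_eqF// (lt_le_trans _ x1).
by apply: cvgV; [rewrite expf_neq0|exact: exprn_continuous].
Qed.

Let int_inv2 : (\int[mu]_(v in `[1%R, +oo[) (v ^- 2)%:E = 1)%E.
Proof.
have dI (x : R) : 1 <= x -> is_derive x 1 (fun v : R => - v^-1) (x ^- 2).
  move=> x1; have x0 : x != 0 by rewrite gt_eqF// (lt_le_trans _ x1).
  by der => //=; rewrite mulr1 opprK.
rewrite (@ge0_continuous_FTC2y _ _ (fun v : R => - v^-1) 1 0).
- by rewrite invr1 sub0e -EFinN opprK.
- by move=> x _; rewrite invr_ge0 sqr_ge0.
- exact: cts_inv2.
- rewrite -oppr0; apply: cvgN; apply/gtr0_cvgV0.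
  + exact: nbhs_pinfty_gt.
  + exact: cvg_id.
- by move=> x x1; apply: der_derivable (dI x _); exact: ltW.
- by apply: cvg_at_right_filter; apply: der_cts (dI 1 _).
- by move=> x; rewrite in_itv/= andbT => x1; apply: der_val; apply: dI; exact: ltW.
Qed.

(** Near 0 the density is at most [v ^ (a - 1)], whose primitive is [v ^ a / a];
    at infinity it is [O (v ^ -2)]. *)
Lemma integrable_gamma_fun : mu.-integrable `]0%R, +oo[ (fun v => (gamma_fun a v)%:E).
Proof.
apply/integrableP; split; first exact: measurable_EFin_gamma_fun.
under eq_integral do rewrite gee0_abs ?lee_fin ?gamma_fun_ge0//.
have -> : `]0%R, +oo[%classic = `]0%R, 1] `|` `]1%R, +oo[ :> set R.
  by rewrite -itv_bndbnd_setU// bnd_simp.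
rewrite ge0_integral_setU//=; last 3 first.
- exact: measurable_EFin_gamma_fun.
- by move=> x _; rewrite lee_fin gamma_fun_ge0.
- apply/disj_setPS => x [] /=; rewrite !in_itv/= andbT => /andP[_ x1].
  by rewrite ltNge x1.
apply: lte_add_pinfty; first by apply: le_lt_trans (le_int_gamma ltr01) _; rewrite ltry.
have [C C0 hC] := gamma_fun_tail.
apply: (@le_lt_trans _ _ (\int[mu]_(v in `[1%R, +oo[) (C%:E * (v ^- 2)%:E))%E).
  rewrite integral_itv_obnd_cbnd; last exact: measurable_EFin_gamma_fun.
  apply: ge0_le_integral => //.
  - by move=> x _; rewrite lee_fin gamma_fun_ge0.
  - exact: measurable_EFin_gamma_fun.
  - by apply/measurable_EFinP/measurable_funM => //; exact: subspace_continuous_measurable_fun cts_inv2.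
  - by move=> x; rewrite /= in_itv/= andbT => x1; rewrite -EFinM lee_fin hC.
rewrite ge0_integralZl//; last 2 first.
- by apply/measurable_EFinP; exact: subspace_continuous_measurable_fun cts_inv2.
- by move=> x _; rewrite lee_fin invr_ge0 sqr_ge0.
by rewrite int_inv2 mule1 ltry.
Qed.

Lemma integrable_gamma_funS (D : set R) : measurable D -> D `<=` `]0, +oo[%classic ->
  mu.-integrable D (EFin \o gamma_fun a).
Proof. by move=> mD DS; apply: integrableS integrable_gamma_fun. Qed.

Lemma Gamma_EFin : (\int[mu]_(v in `]0%R, +oo[) (gamma_fun a v)%:E = (Gamma a)%:E)%E.
Proof. by rewrite /Gamma /Rintegral fineK//; apply: integrable_fin_num integrable_gamma_fun. Qed.

Lemma Gamma_gt0 : 0 < Gamma a.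
Proof.
rewrite -lte_fin -Gamma_EFin.
apply: (@lt_le_trans _ _ (\int[mu]_(v in `[1%R, 2%R]) (2^-1 * expR (-2))%:E)%E).
  rewrite integral_cst//= lebesgue_measure_itv/= lte_fin ltr1n -EFinB.
  by rewrite mule_gt0 ?lte_fin ?mulr_gt0 ?expR_gt0// subr_gt0 ltr1n.
apply: (@le_trans _ _ (\int[mu]_(v in `[1%R, 2%R]) (gamma_fun a v)%:E)%E).
  apply: ge0_le_integral => //.
  - exact: measurable_EFin_gamma_fun.
  - move=> x /=; rewrite in_itv/= => /andP[x1 x2]; rewrite lee_fin.
    have x0 : 0 < x by exact: lt_le_trans x1.
    rewrite ler_pM ?expR_ge0 ?ler_expR ?lerN2//.
    apply: (@le_trans _ _ (x `^ (-1))); last by rewrite ler_powR// lerBrDl addrC addNr ltW.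
    by rewrite powR_inv1 ?(ltW x0)// lef_pV2 ?posrE.
apply: ge0_subset_integral => //.
- exact: measurable_EFin_gamma_fun.
- by move=> x _; rewrite lee_fin gamma_fun_ge0.
- by move=> x /=; rewrite !in_itv/= andbT => /andP[x1 _]; rewrite (lt_le_trans _ x1).
Qed.

Definition gamma_cdf (v : R) : R := (\int[mu]_(r in `]0, v]) gamma_fun a r) / Gamma a.

Let itv0S (v : R) : (`]0, v]%classic : set R) `<=` `]0, +oo[%classic.
Proof. by move=> x /=; rewrite !in_itv/= andbT => /andP[]. Qed.

Let gammaE (v : R) : ((\int[mu]_(r in `]0, v]) gamma_fun a r)%:E =
  \int[mu]_(r in `]0%R, v]) (gamma_fun a r)%:E)%E.
Proof. by rewrite /Rintegral fineK//; apply: integrable_fin_num (integrable_gamma_funS _ (@itv0S v)). Qed.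

Lemma gamma_cdf_ge0 v : 0 <= gamma_cdf v.
Proof.
by rewrite divr_ge0 ?(ltW Gamma_gt0)// Rintegral_ge0// => x _; exact: gamma_fun_ge0.
Qed.

Lemma gamma_cdf_le1 v : gamma_cdf v <= 1.
Proof.
rewrite ler_pdivrMr ?Gamma_gt0// mul1r -lee_fin gammaE -Gamma_EFin.
apply: ge0_subset_integral => //.
- exact: measurable_EFin_gamma_fun.
- by move=> x _; rewrite lee_fin gamma_fun_ge0.
Qed.

Lemma gamma_cdf_homo : {homo gamma_cdf : u v / u <= v}.
Proof.
move=> u v uv; rewrite ler_pM2r ?invr_gt0 ?Gamma_gt0// -lee_fin !gammaE.
apply: ge0_subset_integral => //.
- exact: measurable_EFin_gamma_fun.
- by move=> x _; rewrite lee_fin gamma_fun_ge0.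
- by move=> x /=; rewrite !in_itv/= => /andP[-> /= xu]; exact: le_trans uv.
Qed.

Lemma gamma_cdf_diff u v : 0 <= u -> u <= v ->
  ((gamma_cdf v - gamma_cdf u)%:E = \int[mu]_(r in `]u, v]) (gamma_fun a r / Gamma a)%:E)%E.
Proof.
move=> u0 uv; rewrite -mulrBl EFinM EFinB !gammaE.
have -> : `]0%R, v]%classic = `]0%R, u] `|` `]u, v] :> set R.
  by rewrite -itv_bndbnd_setU// bnd_simp.
rewrite ge0_integral_setU//=; last 3 first.
- exact: measurable_EFin_gamma_fun.
- by move=> x _; rewrite lee_fin gamma_fun_ge0.
- apply/disj_setPS => x [] /=; rewrite !in_itv/= => /andP[_ x1] /andP[].
  by rewrite ltNge x1.
rewrite addeAC subee ?add0e; last by rewrite -gammaE.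
under [RHS]eq_integral do rewrite EFinM.
rewrite ge0_integralZr ?lee_fin ?invr_ge0 ?(ltW Gamma_gt0)//.
- exact: measurable_EFin_gamma_fun.
- by move=> x _; rewrite lee_fin gamma_fun_ge0.
Qed.

Lemma gamma_cdf_le v : 0 < v -> gamma_cdf v <= v `^ a / a / Gamma a.
Proof.
move=> v0; rewrite ler_pM2r ?invr_gt0 ?Gamma_gt0// -lee_fin gammaE.
exact: le_int_gamma.
Qed.

(** Fundamental theorem of calculus: the density is continuous away from 0. *)
Lemma der_gamma_cdf (v : R) : 0 < v -> is_derive v 1 gamma_cdf (gamma_fun a v / Gamma a).
Proof.
move=> v0.
have [] := @continuous_FTC1 R (gamma_fun a) (BRight 0) v (v + 1) _ _ _ _.
- by rewrite ltrDl.
- exact: integrable_gamma_funS.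
- exact: v0.
- exact: der_cts (der_gamma_fun _ v0).
move=> dF F'; have dF' : is_derive v 1 (fun x => \int[mu]_(t in `]0, x]) gamma_fun a t) (gamma_fun a v).
  exact: der_intro dF F'.
by rewrite /gamma_cdf; der => //=; rewrite mulr0 add0r mulrC.
Qed.

Lemma gamma_cdf_cvg1 : gamma_cdf (k%:R) @[k --> \oo] --> (1 : R).
Proof.
rewrite [X in _ --> X](_ : _ = Gamma a / Gamma a); last first.
  by rewrite divff// gt_eqF// Gamma_gt0.
apply: cvgMl.
have cv : (\int[mu]_(v in `]0%R, k%:R]) (gamma_fun a v)%:E @[k --> \oo] -->
    \int[mu]_(v in \bigcup_k [set` `]0%R, k%:R]]) (gamma_fun a v)%:E)%E.
  apply: ge0_nondecreasing_set_cvg_integral.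
  - apply/nondecreasing_seqP => k; rewrite subsetEset => x /=.
    by rewrite !in_itv/= => /andP[-> /= xk]; rewrite (le_trans xk)// ler_nat.
  - by move=> k; exact: measurable_itv.
  - by move=> k; exact: measurable_EFin_gamma_fun.
  - by move=> k x _; rewrite lee_fin gamma_fun_ge0.
rewrite [X in _ --> integral _ X _](_ : _ = `]0, +oo[%classic) in cv; last first.
  apply/seteqP; split => [x [k _]|x]; rewrite /= !in_itv/= ?andbT; first by case/andP.
  move=> x0; exists (Num.truncn x).+1 => //=; rewrite in_itv/= x0 /=.
  by apply: ltW; exact: truncnS_gt.
rewrite Gamma_EFin in cv.
exact: (fine_cvg cv).
Qed.

Lemma measurable_gamma_cdf : measurable_fun setT gamma_cdf.
Proof. by apply: nondecreasing_measurable => // x y; exact: gamma_cdf_homo. Qed.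

End gamma.

(** * The backward equation *)

Section taylor.
Context {R : realType}.
Implicit Types (lo a b M : R).

Lemma mvt_le lo (k k' : R -> R) a b M :
  (forall z : R, lo <= z -> is_derive z 1 k (k' z)) -> lo <= a -> lo <= b ->
  (forall z, lo <= z -> `|z - a| <= `|b - a| -> `|k' z| <= M) ->
  `|k b - k a| <= M * `|b - a|.
Proof.
move=> dk la lb kM.
have cts (u v : R) : lo <= u -> {within `[u, v], continuous k}.
  move=> lu; apply: continuous_in_subspaceT => x; rewrite inE/= in_itv/= => /andP[ux _].
  exact: der_cts (dk x (le_trans lu ux)).
have [ab|ba] := leP a b.
  have [||c cI ->] := @MVT_segment _ k k' a b ab.
  - by move=> x; rewrite in_itv/= => /andP[ax _]; apply: dk; rewrite (le_trans la)// ltW.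
  - exact: cts.
  move: cI; rewrite in_itv/= => /andP[ac cb].
  rewrite normrM ler_wpM2r// kM//; first exact: le_trans ac.
  by rewrite !ger0_norm ?subr_ge0// lerB.
rewrite distrC [`|b - a|]distrC.
have [||c cI ->] := @MVT_segment _ k k' b a (ltW ba).
- by move=> x; rewrite in_itv/= => /andP[ax _]; apply: dk; rewrite (le_trans lb)// ltW.
- exact: cts.
move: cI; rewrite in_itv/= => /andP[bc ca].
rewrite normrM ler_wpM2r// kM//; first exact: le_trans bc.
by rewrite distrC [leRHS]distrC !ger0_norm ?subr_ge0 ?(ltW ba)// lerB.
Qed.

Lemma taylor1 lo (k k1 k2 : R -> R) a b M :
  (forall z : R, lo <= z -> is_derive z 1 k (k1 z)) ->
  (forall z : R, lo <= z -> is_derive z 1 k1 (k2 z)) ->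
  (forall z : R, lo <= z -> `|z - a| <= `|b - a| -> `|k2 z| <= M) -> lo <= a -> lo <= b ->
  `|k b - k a - k1 a * (b - a)| <= M * `|b - a| ^+ 2.
Proof.
move=> d0 d1 kM la lb.
have M0 : 0 <= M by apply: le_trans (kM a la _); rewrite ?subrr ?normr0.
have := @mvt_le lo (fun z => k z - k1 a * (z - a)) (fun z => k1 z - k1 a) a b (M * `|b - a|) _ la lb.
rewrite subrr mulr0 subr0 addrAC expr2 mulrA; apply.
  move=> z lz; have := d0 z lz => d0z.
  by der; ring.
move=> z lz zb; apply: le_trans (mvt_le d1 la lz _) _; first by move=> t lt tz; apply: kM => //; exact: le_trans zb.
by rewrite ler_wpM2l.
Qed.

(** The constant [M] instead of [M / 6] is enough below, and comes from iterating
    the mean value inequality. *)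
Lemma taylor2 lo (k k1 k2 k3 : R -> R) a b M :
  (forall z : R, lo <= z -> is_derive z 1 k (k1 z)) ->
  (forall z : R, lo <= z -> is_derive z 1 k1 (k2 z)) ->
  (forall z : R, lo <= z -> is_derive z 1 k2 (k3 z)) ->
  (forall z : R, lo <= z -> `|k3 z| <= M) -> lo <= a -> lo <= b ->
  `|k b - (k a + k1 a * (b - a) + k2 a / 2 * (b - a) ^+ 2)| <= M * `|b - a| ^+ 3.
Proof.
move=> d0 d1 d2 kM la lb.
have M0 : 0 <= M by apply: le_trans (kM a la).
have := @mvt_le lo (fun z => k z - k1 a * (z - a) - k2 a / 2 * (z - a) ^+ 2)
  (fun z => k1 z - k1 a - k2 a * (z - a)) a b (M * `|b - a| ^+ 2) _ la lb.
have -> : k b - (k a + k1 a * (b - a) + k2 a / 2 * (b - a) ^+ 2) =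
  k b - k1 a * (b - a) - k2 a / 2 * (b - a) ^+ 2 -
     (k a - k1 a * (a - a) - k2 a / 2 * (a - a) ^+ 2) by ring.
have -> : M * `|b - a| ^+ 3 = M * `|b - a| ^+ 2 * `|b - a| by ring.
apply.
- move=> z lz; have := d0 z lz => d0z.
  by der; field.
move=> z lz zb; apply: le_trans (taylor1 d1 d2 (fun z lz _ => kM z lz) la lz) _.
by rewrite ler_wpM2l// lerXn2r// nnegrE.
Qed.
End taylor.

Section hitting_law.
Context {R : realType}.
Variable s : R.
Hypotheses (s0 : 0 < s) (s1 : s < 1).

(** The probability that the diffusion started at [y] has not reached 0 at time [t]:
    if [V] has the Gamma law of parameter [s] then [y ^ 2 / (2 V)] has the law of the
    hitting time. For [y <= 0] the value is 0, as the process is absorbed. *)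
Definition survival (t y : R) : R := gamma_cdf s (Num.max y 0 ^+ 2 / (2 * t)).

Let f (t y : R) := gamma_fun s (y ^+ 2 / (2 * t)) / Gamma s.

Lemma survival_ge0 t y : 0 <= survival t y.
Proof. exact: gamma_cdf_ge0. Qed.

Lemma survival_le1 t y : survival t y <= 1.
Proof. exact: gamma_cdf_le1. Qed.

Lemma survival_pos t y : 0 < y -> survival t y = gamma_cdf s (y ^+ 2 / (2 * t)).
Proof. by move=> y0; rewrite /survival max_l// ltW. Qed.

Lemma measurable_survival t : measurable_fun setT (survival t).
Proof.
apply: (measurableT_comp (measurable_gamma_cdf s0)).
apply: measurable_funM => //; apply: measurable_funX; exact: measurable_maxr.
Qed.

Lemma survival_homo t u y y' : 0 < u -> u <= t -> y <= y' -> survival t y <= survival u y'.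
Proof.
move=> u0 ut yy; apply: gamma_cdf_homo => //.
have t0 := lt_le_trans u0 ut.
apply: ler_pM; rewrite ?exprn_ge0 ?le_max ?lexx ?orbT ?invr_ge0 ?mulr_ge0 ?(ltW t0)//.
  have m0 (z : R) : 0 <= Num.max z 0 by rewrite le_max lexx orbT.
  by rewrite lerXn2r ?nnegrE ?m0// ge_max !le_max yy lexx orbT.
by rewrite lef_pV2 ?posrE ?mulr_gt0// ler_wpM2l.
Qed.

Let arg_gt0 (t y : R) : 0 < t -> 0 < y -> 0 < y ^+ 2 / (2 * t).
Proof. by move=> t0 y0; rewrite divr_gt0 ?exprn_gt0 ?mulr_gt0. Qed.

Let der_fy (t y : R) : 0 < t -> 0 < y ->
  is_derive y 1 (f t) (f t y * (2 * (s - 1) / y - y / t)).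
Proof.
move=> t0 y0; have := der_gamma_fun s (arg_gt0 t0 y0) => df.
have G0 := Gamma_gt0 s0.
have da : is_derive y 1 (fun y : R => y ^+ 2 / (2 * t)) (y / t).
  by der => /=; field; rewrite gt_eqF.
have := der_comp (g := fun y : R => y ^+ 2 / (2 * t)) df da => dc.
by rewrite /f; der; rewrite /=; field; rewrite !gt_eqF.
Qed.

(** [h1], [h2], [h3] are the derivatives of [survival] in [y]; [ht], [htt] are its
    derivatives in [t]. *)
Let h1 (t y : R) := f t y * (y / t).
Let h2 (t y : R) := f t y * ((2 * s - 1) / t - y ^+ 2 / t ^+ 2).
Let h3 (t y : R) := f t y *
  ((2 * (s - 1) / y - y / t) * ((2 * s - 1) / t - y ^+ 2 / t ^+ 2) - 2 * y / t ^+ 2).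
Let ht (t y : R) := - (f t y * (y ^+ 2 / (2 * t ^+ 2))).
Let htt (t y : R) := f t y * (y ^+ 2 / (2 * t) * (1 + s - y ^+ 2 / (2 * t)) / t ^+ 2).

Let der_survival_y (t y : R) : 0 < t -> 0 < y -> is_derive y 1 (survival t) (h1 t y).
Proof.
move=> t0 y0; have dF := der_gamma_cdf s0 (arg_gt0 t0 y0).
have da : is_derive y 1 (fun y : R => y ^+ 2 / (2 * t)) (y / t).
  by der => /=; field; rewrite gt_eqF.
have dc : is_derive y 1 (fun y : R => gamma_cdf s (y ^+ 2 / (2 * t))) (h1 t y).
  exact: (der_comp (g := fun y : R => y ^+ 2 / (2 * t)) dF da).
apply: near_eq_is_derive dc.
near=> z; rewrite survival_pos//; near: z; exact: lt_nbhsr.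
Unshelve. all: by end_near. Qed.

Let der_h1 (t y : R) : 0 < t -> 0 < y -> is_derive y 1 (h1 t) (h2 t y).
Proof.
move=> t0 y0; have df := der_fy t0 y0.
by rewrite /h1 /h2; der; field; rewrite !gt_eqF.
Qed.

Let der_h2 (t y : R) : 0 < t -> 0 < y -> is_derive y 1 (h2 t) (h3 t y).
Proof.
move=> t0 y0; have df := der_fy t0 y0.
by rewrite /h2 /h3; der; rewrite /=; field; rewrite !gt_eqF.
Qed.

Let der_arg_t (t y : R) : 0 < t ->
  is_derive t 1 (fun t : R => y ^+ 2 / (2 * t)) (- (y ^+ 2 / (2 * t ^+ 2))).
Proof.
move=> t0; have t20 : 2 * t != 0 by rewrite mulf_neq0// gt_eqF.
by der; field; rewrite gt_eqF.
Qed.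

Let der_survival_t (t y : R) : 0 < t -> 0 < y ->
  is_derive t 1 (survival ^~ y) (ht t y).
Proof.
move=> t0 y0; have dF := der_gamma_cdf s0 (arg_gt0 t0 y0).
have := der_comp (g := fun t : R => y ^+ 2 / (2 * t)) dF (der_arg_t y t0); rewrite mulrN.
congr is_derive; apply/funext => u /=; exact/esym/survival_pos.
Qed.

Let der_ht (t y : R) : 0 < t -> 0 < y -> is_derive t 1 (ht ^~ y) (htt t y).
Proof.
move=> t0 y0; have df := der_gamma_fun s (arg_gt0 t0 y0).
have G0 := Gamma_gt0 s0.
have := der_comp (g := fun t : R => y ^+ 2 / (2 * t)) df (der_arg_t y t0) => dc.
have t20 : 2 * t ^+ 2 != 0 by rewrite mulf_neq0// expf_neq0// gt_eqF.
rewrite /ht /htt /f; der.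
by rewrite /=; field; rewrite !gt_eqF.
Qed.

(** The Kolmogorov backward equation of [dY = (1 - 2 s) / (2 Y) dt + dB]. *)
Let pde (t y : R) : 0 < t -> 0 < y ->
  ht t y = (1 - 2 * s) / (2 * y) * h1 t y + h2 t y / 2.
Proof. by move=> t0 y0; rewrite /ht /h1 /h2; field; rewrite !gt_eqF. Qed.

Section bounds.
Variables e eta Th : R.
Hypotheses (e0 : 0 < e) (eta0 : 0 < eta) (etaTh : eta <= Th).

Let f_ge0 t y : 0 <= f t y.
Proof. by rewrite mulr_ge0 ?gamma_fun_ge0// invr_ge0 ltW// Gamma_gt0. Qed.

(** With [v = y ^ 2 / (2 t)], the factor [exp (- v)] absorbs [y ^ 4], while
    [v ^ (s - 1)] is bounded because [v] stays away from 0 and [s < 1]. *)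
Let f_bound : exists2 K, 0 <= K & forall t y, eta <= t -> t <= Th -> e <= y ->
  f t y * (1 + y ^+ 2) ^+ 2 <= K.
Proof.
pose v0 := e ^+ 2 / (2 * Th).
have Th0 : 0 < Th by exact: lt_le_trans etaTh.
have v00 : 0 < v0 by exact: arg_gt0.
exists (v0 `^ (s - 1) / Gamma s * (2 + (2 * Th) ^+ 2 * 4)).
  by rewrite !mulr_ge0 ?powR_ge0 ?invr_ge0 ?(ltW (Gamma_gt0 s0))// addr_ge0// mulr_ge0// exprn_ge0// mulr_ge0// ltW.
move=> t y et tT ey.
have t0 : 0 < t by exact: lt_le_trans et.
have y0 : 0 < y by exact: lt_le_trans ey.
set v := y ^+ 2 / (2 * t).
have v_ge : v0 <= v.
  rewrite /v0 /v; apply: ler_pM; rewrite ?exprn_ge0 ?invr_ge0 ?mulr_ge0 ?(ltW e0) ?(ltW Th0)//.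
    by rewrite lerXn2r// nnegrE ltW.
  by rewrite lef_pV2 ?posrE ?mulr_gt0// ler_wpM2l.
have v1 : 0 < v by exact: lt_le_trans v_ge.
have -> : f t y * (1 + y ^+ 2) ^+ 2 =
    (v `^ (s - 1) / Gamma s) * (expR (- v) * (1 + y ^+ 2) ^+ 2).
  by rewrite /f -/v /gamma_fun; ring.
apply: ler_pM.
- by rewrite divr_ge0 ?powR_ge0 ?ltW ?Gamma_gt0.
- by rewrite mulr_ge0 ?expR_ge0 ?sqr_ge0.
- rewrite ler_pM2r ?invr_gt0 ?Gamma_gt0//.
  rewrite -(opprB 1 s) !powRN lef_pV2 ?posrE ?powR_gt0//.
  by apply: ge0_ler_powR; rewrite ?nnegrE ?subr_ge0 ?(ltW s1) ?(ltW v1) ?(ltW v00).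
have y2 : y ^+ 2 <= 2 * Th * v.
  rewrite /v mulrCA ler_peMr ?sqr_ge0//.
  by rewrite ler_pdivlMr ?mulr_gt0// mul1r ler_wpM2l.
have e2 : v ^+ 2 * expR (- v) <= 2 := @expR_pow_le _ 2 v (ltW v1).
have e1 : expR (- v) <= 1 by rewrite -expR0 ler_expR oppr_le0 ltW.
have ev0 := expR_ge0 (- v).
have sq : (1 + y ^+ 2) ^+ 2 <= 2 * (1 + (2 * Th) ^+ 2 * v ^+ 2).
  have : (1 + y ^+ 2) ^+ 2 <= (1 + 2 * Th * v) ^+ 2.
    have Tv : 0 <= 2 * Th * v by exact: le_trans (sqr_ge0 y) y2.
    by rewrite lerXn2r ?nnegrE ?lerD2l// addr_ge0// sqr_ge0.
  move=> /le_trans; apply; rewrite -exprMn.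
  by have := sqr_ge0 (1 - 2 * Th * v); nra.
apply: le_trans (ler_wpM2l ev0 sq) _.
have Th2 : 0 <= (2 * Th) ^+ 2 by rewrite sqr_ge0.
have -> : expR (- v) * (2 * (1 + (2 * Th) ^+ 2 * v ^+ 2)) =
  2 * expR (- v) + (2 * Th) ^+ 2 * (2 * (v ^+ 2 * expR (- v))) by ring.
apply: lerD; first by rewrite ler_piMr.
by rewrite ler_wpM2l//; lra.
Qed.

(** Each derivative is [f t y] times a polynomial in [y], [1 / y] and [1 / t] of
    degree at most 4 in [y]. *)
Let h_bound : exists2 M, 0 <= M & forall t y, eta <= t -> t <= Th -> e <= y ->
  [/\ `|h1 t y| <= M, `|h2 t y| <= M, `|h3 t y| <= M & `|htt t y| <= M].
Proof.
have s0' := s0; have s1' := s1; have e0' := e0.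
have l1 : -1 <= 2 * s - 1 by lra.
have u1 : 2 * s - 1 <= 1 by lra.
have l2 : - 2 <= 2 * (s - 1) * (2 * s - 1) by nra.
have u2 : 2 * (s - 1) * (2 * s - 1) <= 2 by nra.
have l3 : - 3 <= 1 - 4 * s by lra.
have u3 : 1 - 4 * s <= 3 by lra.
have l4 : -1 <= (1 + s) / 2 by lra.
have u4 : (1 + s) / 2 <= 1 by lra.
have l5 : -1 <= 1 / 4 :> R by lra.
have u5 : 1 / 4 <= 1 :> R by lra.
have [K K0 fK] := f_bound.
pose E := e^-1; pose H := eta^-1.
have E0 : 0 < E by rewrite invr_gt0.
have H0 : 0 < H by rewrite invr_gt0.
pose A := 2 * E * H + 5 * H ^+ 2 + H ^+ 3 + H + H ^+ 4.
have E0' := ltW E0; have H0' := ltW H0.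
have A0 : 0 <= A by rewrite /A !addr_ge0 ?mulr_ge0 ?exprn_ge0.
exists (A * K) => [|t y et tT ey]; first by rewrite mulr_ge0.
have t0 : 0 < t by exact: lt_le_trans et.
have y0 : 0 < y by exact: lt_le_trans ey.
pose r := t^-1; pose z := y^-1.
have r0 : 0 < r by rewrite invr_gt0.
have z0 : 0 < z by rewrite invr_gt0.
have rH : r <= H by rewrite lef_pV2 ?posrE.
have zE : z <= E by rewrite lef_pV2 ?posrE.
have r2H : r ^+ 2 <= H ^+ 2 by rewrite lerXn2r// nnegrE ltW.
have r3H : r ^+ 3 <= H ^+ 3 by rewrite lerXn2r// nnegrE ltW.
have r4H : r ^+ 4 <= H ^+ 4 by rewrite lerXn2r// nnegrE ltW.
have zrEH : z * r <= E * H by rewrite ler_pM// ltW.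
pose W := (1 + y ^+ 2) ^+ 2.
have W1 : 1 <= W by rewrite /W; have := sqr_ge0 y; nra.
have Wy : y <= W by rewrite /W; have := sqr_ge0 y; nra.
have Wy2 : y ^+ 2 <= W by rewrite /W; have := sqr_ge0 y; nra.
have Wy4 : y ^+ 4 <= W by rewrite /W; have := sqr_ge0 y; nra.
have Wy3 : y ^+ 3 <= W.
  have -> : W = y ^+ 3 + (1 + y ^+ 2 + y ^+ 2 * (1 - y + y ^+ 2)) by rewrite /W; ring.
  by rewrite lerDl addr_ge0 ?addr_ge0 ?sqr_ge0// mulr_ge0 ?sqr_ge0//; have := sqr_ge0 (1 - y); nra.
have key c : `|c| <= A * W -> `|f t y * c| <= A * K.
  move=> cA; rewrite normrM ger0_norm//.
  apply: le_trans (ler_wpM2l (f_ge0 t y) cA) _.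
  by rewrite mulrCA ler_wpM2l ?fK.
have W0 : 0 <= W by apply: le_trans W1.
clearbody W E H.
have AE : A * W = 2 * (E * H * W) + 5 * (H ^+ 2 * W) + H ^+ 3 * W + H * W + H ^+ 4 * W.
  by rewrite /A; ring.
have t1 : 0 <= E * H * W by rewrite ?(mulr_ge0, exprn_ge0).
have t2 : 0 <= H ^+ 2 * W by rewrite ?(mulr_ge0, exprn_ge0).
have t3 : 0 <= H ^+ 3 * W by rewrite ?(mulr_ge0, exprn_ge0).
have t4 : 0 <= H * W by rewrite ?(mulr_ge0, exprn_ge0).
have t5 : 0 <= H ^+ 4 * W by rewrite ?(mulr_ge0, exprn_ge0).
(* one bound for all the monomials [y ^ i r ^ j], whose coefficients depend on [s]
   but lie in a fixed interval *)
have mono (c B p P w : R) : - B <= c -> c <= B -> 0 <= p -> p <= P -> 0 <= w -> w <= W ->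
    - (B * (P * W)) <= c * (p * w) /\ c * (p * w) <= B * (P * W).
  move=> Bc cB p0 pP w0 wW.
  have B0 : 0 <= B by lra.
  have pwPW : p * w <= P * W by rewrite ler_pM.
  have pw0 : 0 <= p * w by rewrite mulr_ge0.
  have bpw : B * (p * w) <= B * (P * W) by rewrite ler_wpM2l.
  have v1 : c * (p * w) <= B * (p * w) by rewrite ler_wpM2r.
  have v2 : - B * (p * w) <= c * (p * w) by rewrite ler_wpM2r.
  by split; lra.
have r0' := ltW r0; have y0' := ltW y0; have z0' := ltW z0.
have zy : z * y = 1 by rewrite /z mulVf// gt_eqF.
have zr0 : 0 <= z * r by rewrite mulr_ge0.
have c11 : - 1 <= 1 :> R by lra.
have ex k := exprn_ge0 k r0'; have ey' k := exprn_ge0 k y0'.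
have [p1 q1] := mono 1 1 r H y c11 (lexx _) r0' rH y0' Wy.
have [p2 q2] := mono (2 * s - 1) 1 r H 1 l1 u1 r0' rH ler01 W1.
have [p3 q3] := mono 1 1 (r ^+ 2) (H ^+ 2) (y ^+ 2) c11 (lexx _) (ex _) r2H (ey' _) Wy2.
have [p4 q4] := mono (2 * (s - 1) * (2 * s - 1)) 2 (z * r) (E * H) 1 l2 u2 zr0 zrEH ler01 W1.
have [p5 q5] := mono (1 - 4 * s) 3 (r ^+ 2) (H ^+ 2) y l3 u3 (ex _) r2H y0' Wy.
have [p6 q6] := mono 1 1 (r ^+ 3) (H ^+ 3) (y ^+ 3) c11 (lexx _) (ex _) r3H (ey' _) Wy3.
have [p7 q7] := mono ((1 + s) / 2) 1 (r ^+ 3) (H ^+ 3) (y ^+ 2) l4 u4 (ex _) r3H (ey' _) Wy2.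
have [p8 q8] := mono (1 / 4) 1 (r ^+ 4) (H ^+ 4) (y ^+ 4) l5 u5 (ex _) r4H (ey' _) Wy4.
clear mono l1 u1 l2 u2 l3 u3 l4 u4 l5 u5 ex ey' Wy Wy2 Wy3 Wy4 W1 r2H r3H r4H rH zE zrEH.
split; apply: key; rewrite AE ler_norml; apply/andP.
- by rewrite (_ : y / t = 1 * (r * y)); [split; lra|rewrite /r; ring].
- rewrite (_ : (2 * s - 1) / t - y ^+ 2 / t ^+ 2 = (2 * s - 1) * (r * 1) - 1 * (r ^+ 2 * y ^+ 2)).
    by split; lra.
  by rewrite /r; field; rewrite gt_eqF.
- rewrite (_ : _ - 2 * y / t ^+ 2 = (2 * (s - 1) * (2 * s - 1)) * (z * r * 1) +
      (1 - 4 * s) * (r ^+ 2 * y) + 1 * (r ^+ 3 * y ^+ 3)).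
    by split; lra.
  by rewrite /r /z; field; rewrite !gt_eqF.
- rewrite (_ : y ^+ 2 / (2 * t) * (1 + s - y ^+ 2 / (2 * t)) / t ^+ 2 =
     (1 + s) / 2 * (r ^+ 3 * y ^+ 2) - 1 / 4 * (r ^+ 4 * y ^+ 4)).
    by split; lra.
  by rewrite /r; field; rewrite gt_eqF.
Qed.

(** One Euler step of length [sg ^ 2]. A Taylor expansion of order 2 in [y] and of
    order 1 in [t] leaves, by the moments of the normal law, the backward equation
    times [sg ^ 2]; the remainders are [O (sg ^ 3)]. The expansion in [y] is valid
    even when the step goes below the level [e], where the derivatives are not
    controlled: then the step is larger than [e], and [survival] is bounded. *)
Lemma survival_step : exists2 C, 0 <= C & forall t y sg,
  0 < sg -> sg <= 1 -> eta <= t -> t + sg ^+ 2 <= Th -> 2 * e <= y ->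
  `|\int[normal_prob 0 sg]_w survival t (y + (1 - 2 * s) / (2 * y) * sg ^+ 2 + w)
    - survival (t + sg ^+ 2) y| <= C * sg ^+ 3.
Proof.
have s0' := s0; have s1' := s1; have e0' := e0.
have [M M0 hM] := h_bound.
pose M1 := M + (e ^-1) ^+ 3 + M * (e^-1) ^+ 2 + M * e^-1.
pose B := e^-1.
have B0 : 0 <= B by rewrite invr_ge0 ltW.
have M10 : 0 <= M1 by rewrite /M1 !addr_ge0 ?mulr_ge0 ?exprn_ge0.
exists (8 * M1 + 4 * M1 * B ^+ 3 + M * B ^+ 2 + M).
  by rewrite !addr_ge0 ?mulr_ge0 ?exprn_ge0.
move=> t y sg sg0 sg1 et tT ey.
have sg20 : 0 < sg ^+ 2 by rewrite exprn_gt0.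
have ey' : e <= y by lra.
have t0 : 0 < t by exact: lt_le_trans et.
have y0 : 0 < y by lra.
have tT' : t <= Th by lra.
have [m1 m2 _ _] := hM t y et tT' ey'.
pose b := (1 - 2 * s) / (2 * y); pose dl := sg ^+ 2.
have bB : `|b| <= B.
  rewrite /b normrM [X in _ * X]ger0_norm ?invr_ge0; last by lra.
  rewrite ler_pdivrMr; last by lra.
  have : 1 <= B * (2 * y).
    by rewrite /B mulrC ler_pdivlMr// mul1r; lra.
  by move=> /(le_trans _); apply; rewrite ler_norml; apply/andP; split; lra.
(* beyond the level [e] the bound holds because [e^-1 * `|x|] is at least 1 *)
have tay x : `|survival t (y + x) - (survival t y + h1 t y * x + h2 t y / 2 * x ^+ 2)| <= M1 * `|x| ^+ 3.
  have [xe|xe] := leP e (y + x).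
    have := @taylor2 R e (survival t) (h1 t) (h2 t) (h3 t) y (y + x) M.
    rewrite (_ : y + x - y = x); last by ring.
    move=> h; apply: le_trans (h _ _ _ _ _ _) _ => //.
    - by move=> z ez; apply: der_survival_y => //; exact: lt_le_trans ez.
    - by move=> z ez; apply: der_h1 => //; exact: lt_le_trans ez.
    - by move=> z ez; apply: der_h2 => //; exact: lt_le_trans ez.
    - by move=> z ez; have [] := hM t z et tT' ez.
    by rewrite ler_wpM2r ?exprn_ge0// /M1 -!addrA lerDl !addr_ge0 ?mulr_ge0 ?exprn_ge0.
  have xe1 : 1 <= e^-1 * `|x|.
    rewrite mulrC ler_pdivlMr// mul1r ler_normr; apply/orP; right; lra.
  have nx0 := normr_ge0 x.
  have xe3 : 1 <= (e^-1 * `|x|) ^+ 3 by rewrite exprn_ege1.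
  have xe2 : 1 <= (e^-1 * `|x|) ^+ 2 by rewrite exprn_ege1.
  have s01 : `|survival t (y + x) - survival t y| <= 1.
    rewrite ler_norml; have := survival_ge0 t (y + x); have := survival_ge0 t y.
    by have := survival_le1 t (y + x); have := survival_le1 t y => *; apply/andP; split; lra.
  have -> : survival t (y + x) - (survival t y + h1 t y * x + h2 t y / 2 * x ^+ 2) =
     (survival t (y + x) - survival t y) - h1 t y * x - h2 t y / 2 * x ^+ 2 by ring.
  apply: le_trans (ler_normB _ _) _; apply: le_trans (lerD (ler_normB _ _) (lexx _)) _.
  have -> : `|h1 t y * x| = `|h1 t y| * `|x| by rewrite normrM.
  have -> : `|h2 t y / 2 * x ^+ 2| = `|h2 t y| * 2^-1 * `|x| ^+ 2.
    by rewrite !normrM (@ger0_norm _ 2^-1)// normrX.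
  have k1 : `|h1 t y| * `|x| <= M * (e^-1) ^+ 2 * `|x| ^+ 3.
    have -> : M * (e^-1) ^+ 2 * `|x| ^+ 3 = M * `|x| * (e^-1 * `|x|) ^+ 2 by ring.
    apply: le_trans (ler_wpM2r nx0 m1) _.
    by rewrite ler_peMr// mulr_ge0.
  have k2 : `|h2 t y| * 2^-1 * `|x| ^+ 2 <= M * e^-1 * `|x| ^+ 3.
    have -> : M * e^-1 * `|x| ^+ 3 = M * `|x| ^+ 2 * (e^-1 * `|x|) by ring.
    apply: (@le_trans _ _ (M * `|x| ^+ 2)); last by rewrite ler_peMr// mulr_ge0// exprn_ge0.
    rewrite ler_wpM2r ?exprn_ge0//; have := normr_ge0 (h2 t y); lra.
  have k3 : 1 <= e^-1 ^+ 3 * `|x| ^+ 3 by rewrite -exprMn.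
  have k4 : 0 <= M * `|x| ^+ 3 by rewrite mulr_ge0// exprn_ge0.
  rewrite /M1 !mulrDl; lra.
have nx (w : R) : `|b * dl + w| ^+ 3 <= 4 * (B ^+ 3 * dl ^+ 3 + `|w| ^+ 3).
  have h : `|b * dl + w| <= B * dl + `|w|.
    apply: le_trans (ler_normD _ _) _; rewrite lerD2r normrM ler_pM// ger0_norm// ltW//.
  apply: (@le_trans _ _ ((B * dl + `|w|) ^+ 3)); first by rewrite lerXn2r// nnegrE// (le_trans _ h).
  have p0 : 0 <= B * dl by rewrite mulr_ge0// ltW.
  rewrite -exprMn; move: (B * dl) (`|w|) p0 (normr_ge0 w) => p q p0 q0.
  rewrite -subr_ge0 (_ : _ - _ = 3 * (p + q) * (p - q) ^+ 2); last by ring.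
  by rewrite mulr_ge0 ?sqr_ge0// mulr_ge0// addr_ge0.
have mg : measurable_fun setT (fun w => survival t (y + b * dl + w)).
  by apply: (measurableT_comp (measurable_survival t)); exact: measurable_funD.
pose c0 := survival t y + h1 t y * (b * dl) + h2 t y / 2 * (b * dl) ^+ 2.
pose c1 := h1 t y + h2 t y * (b * dl).
have gx := @gauss_expansion R sg sg0 _ c0 c1 (h2 t y / 2) (4 * M1) (4 * M1 * (B ^+ 3 * dl ^+ 3)) mg.
have M14 : 0 <= 4 * M1 by rewrite mulr_ge0.
have ww w : `|survival t (y + b * dl + w) - (c0 + c1 * w + h2 t y / 2 * w ^+ 2)| <= 4 * M1 * `|w| ^+ 3 + 4 * M1 * (B ^+ 3 * dl ^+ 3).
  have := tay (b * dl + w); rewrite addrA.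
  rewrite (_ : survival t y + _ + _ = c0 + c1 * w + h2 t y / 2 * w ^+ 2); last first.
    by rewrite /c0 /c1; field.
  move=> /le_trans; apply; apply: le_trans (ler_wpM2l M10 (nx w)) _.
  by rewrite le_eqVlt; apply/orP; left; apply/eqP; ring.
have {gx} := gx ww M14; rewrite -/dl => gx.
have tt := @taylor1 R eta (survival ^~ y) (ht ^~ y) (htt ^~ y) t (t + dl) M.
have {}tt : `|survival (t + dl) y - survival t y - ht t y * dl| <= M * dl ^+ 2.
  move: tt; rewrite (_ : t + dl - t = dl); last by ring.
  rewrite (ger0_norm (ltW sg20)); apply => //.
  - by move=> z ez; apply: der_survival_t => //; exact: lt_le_trans ez.
  - by move=> z ez; apply: der_ht => //; exact: lt_le_trans ez.
  - move=> z ez; rewrite ler_norml => /andP[_ zt].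
    have zT : z <= Th by apply: le_trans tT; rewrite -lerBlDl.
    by have [] := hM z y ez zT ey'.
  - by rewrite (le_trans et)// lerDl ltW.
rewrite pde// -/b in tt.
have d2 : dl ^+ 2 <= sg ^+ 3.
  by rewrite /dl -exprM (_ : (2 * 2 = 3 + 1)%N)// exprD expr1 ler_piMr// exprn_ge0// (ltW sg0).
have d3 : dl ^+ 3 <= sg ^+ 3.
  by rewrite lerXn2r ?nnegrE ?(ltW sg0) ?(ltW sg20)// /dl expr2 ler_piMr// ltW.
rewrite -/b -/dl.
have dl0 : 0 < dl by [].
clearbody b dl.
have hb : `|h2 t y / 2 * (b * dl) ^+ 2| <= M * B ^+ 2 * dl ^+ 2.
  have -> : `|h2 t y / 2 * (b * dl) ^+ 2| = `|h2 t y| * 2^-1 * (`|b| ^+ 2 * dl ^+ 2).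
    by rewrite 2!normrM (ger0_norm (sqr_ge0 (b * dl))) exprMn -[b ^+ 2]real_normK ?num_real// (@ger0_norm _ 2^-1).
  rewrite mulrA ler_wpM2r ?sqr_ge0//.
  apply: ler_pM; rewrite ?mulr_ge0 ?exprn_ge0 ?lerXn2r ?nnegrE//.
  by apply: le_trans m2; rewrite ler_piMr// invf_le1 ?ler1n.
set I := Rintegral _ _ _ in gx *; set S1 := survival (t + dl) y in tt *.
have -> : I - S1 = (I - (c0 + h2 t y / 2 * dl)) +
   (h2 t y / 2 * (b * dl) ^+ 2 - (S1 - survival t y - (b * h1 t y + h2 t y / 2) * dl)).
  by rewrite /c0; ring.
apply: le_trans (ler_normD _ _) _.
have := ler_normB (h2 t y / 2 * (b * dl) ^+ 2) (S1 - survival t y - (b * h1 t y + h2 t y / 2) * dl).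
have e1 : 4 * M1 * (B ^+ 3 * dl ^+ 3) <= 4 * M1 * B ^+ 3 * sg ^+ 3.
  by rewrite mulrA ler_wpM2l// mulr_ge0// exprn_ge0.
have e2 : M * B ^+ 2 * dl ^+ 2 <= M * B ^+ 2 * sg ^+ 3.
  by rewrite ler_wpM2l// mulr_ge0// exprn_ge0.
have e3 : M * dl ^+ 2 <= M * sg ^+ 3 by rewrite ler_wpM2l.
move: gx tt hb e1 e2 e3; clear.
move: (`|_|) (`|_|) (`|_|) (`|_|) => x1 x2 x3 x4 *; lra.
Qed.

End bounds.

End hitting_law.

(** * The Euler scheme along one path *)

(** The Euler scheme with step [dl] of [dY = (1 - 2 s) / (2 Y) dt + dB], driven
    by the increments [inc] and stopped once it is at most [eps]. *)
Definition euler (R : realType) (s y0 eps dl : R) (inc : nat -> R) : nat -> R :=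
  fix z k := if k is k'.+1 then
    if eps < z k' then z k' + (1 - 2 * s) / (2 * z k') * dl + inc k' else z k'
  else y0.

Section path.
Context {R : realType}.
Notation mu := (@lebesgue_measure R).
Variables (s y0 : R) (Y beta : R -> R).
Hypothesis cY : continuous Y.
Hypothesis Y0 : Y 0 = y0.
Hypothesis sde : forall T : R, 0 <= T -> (forall t, 0 <= t <= T -> 0 < Y t) ->
  Y T = y0 + \int[mu]_(r in `[0, T]) ((1 - 2 * s) / (2 * Y r)) + beta T.

(** Heine's theorem, where only one of the two points is confined to the segment. *)
Lemma unif_cont (T e : R) : 0 < e -> exists2 d : R, 0 < d &
  forall u v : R, 0 <= u <= T -> `|u - v| <= d -> `|Y u - Y v| <= e.
Proof.
move=> e0.
have /compact_near_coveringP cpt := @segment_compact R 0 T.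
have := cpt R (0^'+) (fun d u => forall v, `|u - v| <= d -> `|Y u - Y v| <= e) _.
have h x : `[0, T]%classic x -> \forall x' \near x & i \near 0^'+,
    forall v : R, `|x' - v| <= i -> `|Y x' - Y v| <= e.
  move=> _; have e20 : 0 < e / 2 by rewrite divr_gt0.
  have /cvgrPdist_le/(_ _ e20)/nbhs_ballP[d /= d0 hd] := @cY x.
  exists (ball x (d / 2), [set i | i < d / 2]) => /=.
    split; first by apply: nbhsx_ballx; rewrite divr_gt0.
    by apply: nbhs_right_lt; rewrite divr_gt0.
  move=> [x' i] /= [xx' id2] v vi.
  have b1 : ball x d x'.
    by apply: le_ball xx'; rewrite ler_pdivrMr// ler_peMr// ?ler1n// ltW.
  have b2 : ball x d v.
    rewrite -ball_normE /=/ball_ in xx' *.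
    rewrite (_ : x - v = (x - x') + (x' - v)); last by ring.
    by apply: le_lt_trans (ler_normD _ _) _; rewrite (splitr d) ltrD// (le_lt_trans vi).
  rewrite (_ : Y x' - Y v = (Y x - Y v) - (Y x - Y x')); last by ring.
  by apply: le_trans (ler_normB _ _) _; rewrite (splitr e) lerD// hd.
move=> /(_ _ h) hn.
have : \forall d \near 0^'+, 0 < d /\ `[0, T]%classic `<=` (fun u => forall v : R, `|u - v| <= d -> `|Y u - Y v| <= e).
  by near=> d; split; near: d => //; exact: nbhs_right_gt.
move=> /filter_ex[d [d0 hd]]; exists d => // u v uT; apply: hd.
by rewrite /= in_itv.
Unshelve. all: by end_near. Qed.

Let b (x : R) := (1 - 2 * s) / (2 * x).

Lemma sde_increment (u v : R) : 0 <= u -> u <= v -> (forall t, 0 <= t <= v -> 0 < Y t) ->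
  Y v - Y u = \int[mu]_(r in `]u, v]) b (Y r) + (beta v - beta u).
Proof.
move=> u0 uv Yp.
have v0 : 0 <= v by exact: le_trans uv.
rewrite !sde//; last first.
  by move=> t /andP[t0 tu]; apply: Yp; rewrite t0 (le_trans tu).
rewrite -(@Rintegral_itvB _ (b \o Y) (BLeft 0) (BRight v) u)//.
- by rewrite /b/=; ring.
- apply: continuous_compact_integrable; first exact: segment_compact.
  apply: continuous_in_subspaceT => x; rewrite inE/= in_itv/= => /Yp Yx.
  apply: cvgM; first exact: cvg_cst.
  apply: cvgV; first by rewrite mulf_neq0// gt_eqF.
  by apply: cvgMr; exact: cY.
Qed.

Let bLip (m x y : R) : 0 < s < 1 -> 0 < m -> m <= x -> m <= y ->
  `|b x - b y| <= (m^-1) ^+ 2 * `|x - y|.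
Proof.
move=> /andP[s0 s1] m0 mx my; have x0 : 0 < x by exact: lt_le_trans mx.
have y'0 : 0 < y by exact: lt_le_trans my.
have -> : b x - b y = ((1 - 2 * s) / 2) * (x^-1 * y^-1 * - (x - y)).
  by rewrite /b; field; rewrite !gt_eqF.
have c1 : `|(1 - 2 * s) / 2| <= 1 by rewrite ler_norml; apply/andP; split; lra.
have i1 : `|x^-1| <= m^-1 by rewrite gtr0_norm ?invr_gt0// lef_pV2.
have i2 : `|y^-1| <= m^-1 by rewrite gtr0_norm ?invr_gt0// lef_pV2.
rewrite normrM [X in _ * X]normrM normrN [X in _ * (X * _)]normrM.
rewrite -[leRHS]mul1r; apply: ler_pM; rewrite ?mulr_ge0 ?normr_ge0//.
by rewrite ler_wpM2r// expr2 ler_pM.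
Qed.

Section track.
Variable eps dl : R.
Hypotheses (eps0 : 0 < eps) (dl0 : 0 < dl) (s01 : 0 < s < 1).

Let z := euler s y0 eps dl (fun k => beta (k.+1%:R * dl) - beta (k%:R * dl)).

Lemma euler_stopped (inc : nat -> R) j k : (j <= k)%N ->
  eps < euler s y0 eps dl inc k -> eps < euler s y0 eps dl inc j.
Proof.
move=> /subnK <-; elim: (k - j)%N => [//|i IH]; rewrite addSn /=.
by case: ifPn => [/IH//|] /negP.
Qed.

(** Discrete Gronwall: with [e] the modulus of continuity of the path at [dl]
    and [K] the Lipschitz constant of the drift above [m], the error [x_k]
    satisfies [x_(k+1) <= x_k + K dl (x_k + e)]. *)
Lemma euler_track (T m e : R) : 0 < m -> m <= eps -> 0 <= e ->
  (forall t, 0 <= t <= T -> m <= Y t) ->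
  (forall u v, 0 <= u <= T -> `|u - v| <= dl -> `|Y u - Y v| <= e) ->
  forall k, k%:R * dl <= T -> (forall j, (j < k)%N -> eps < z j) ->
  `|z k - Y (k%:R * dl)| <= e * expR ((m^-1) ^+ 2 * T).
Proof.
move=> m0 me e0 mY osc.
set K := (m^-1) ^+ 2; have K0 : 0 <= K by rewrite exprn_ge0// invr_ge0 ltW.
have step k : k%:R * dl <= T -> (forall j, (j < k)%N -> eps < z j) ->
   `|z k - Y (k%:R * dl)| <= e * ((1 + K * dl) ^+ k - 1).
  elim: k => [|k IH] kT zk.
    by rewrite mul0r Y0 /z/= subrr normr0 expr0 subrr mulr0.
  have kT' : k%:R * dl <= T by rewrite (le_trans _ kT)// ler_wpM2r ?ler_nat// ltW.
  have {}IH := IH kT' (fun j jk => zk j (ltnW jk)).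
  have zke := zk k (ltnSn k).
  have k0 : 0 <= k%:R * dl by rewrite mulr_ge0// ltW.
  have kk : k%:R * dl <= k.+1%:R * dl by rewrite ler_wpM2r ?ler_nat// ltW.
  have inc := @sde_increment (k%:R * dl) (k.+1%:R * dl) k0 kk _.
  have Ypos t : 0 <= t <= k.+1%:R * dl -> m <= Y t.
    by move=> /andP[t0 tk]; apply: mY; rewrite t0 (le_trans tk).
  have {}inc := inc (fun t h => lt_le_trans m0 (Ypos t h)).
  have zE : z k.+1 = z k + b (z k) * dl + (beta (k.+1%:R * dl) - beta (k%:R * dl)).
    by rewrite /z /= -/(z k) zke.
  have dlE : k.+1%:R * dl - k%:R * dl = dl by rewrite -mulrBl -natrB// subSnn mul1r.
  set u := k%:R * dl in inc zE dlE IH k0 kk kT' *; set v := k.+1%:R * dl in inc zE dlE kk kT Ypos *.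
  have muE : mu `]u, v]%classic = dl%:E.
    by rewrite lebesgue_measure_itv/= lte_fin -subr_gt0 dlE dl0 -EFinB dlE.
  have muI : fine (mu `]u, v]%classic) = dl by rewrite muE.
  have ic (r : R) : mu.-integrable `]u, v] (EFin \o cst r).
    apply: measurable_bounded_integrable => //.
    - by rewrite /= muE ltry.
    - by exists `|r|; split; [exact: num_real|move=> M rM x _ /=; exact: ltW].
  have iY : mu.-integrable `]u, v] (EFin \o (b \o Y)).
    apply: (@integrableS _ _ _ mu `[0, v]) => //.
      by move=> x /=; rewrite !in_itv/= => /andP[ux ->]; rewrite (le_trans k0)// ltW.
    apply: continuous_compact_integrable; first exact: segment_compact.
    apply: continuous_in_subspaceT => x; rewrite inE/= in_itv/= => /Ypos Yx.
    apply: cvgM; first exact: cvg_cst.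
    apply: cvgV; first by rewrite mulf_neq0// gt_eqF// (lt_le_trans m0).
    by apply: cvgMr; exact: cY.
  have cI (r : R) : \int[mu]_(x in `]u, v]) r = r * dl by rewrite Rintegral_cst// muI.
  have -> : z k.+1 - Y v = (z k - Y u) + \int[mu]_(r in `]u, v]) (b (z k) - b (Y r)).
    rewrite RintegralB//; last exact: ic.
    rewrite cI zE -[Y v](subrK (Y u)) inc; ring.
  set x := `|z k - Y u| in IH *.
  have intle : `|\int[mu]_(r in `]u, v]) (b (z k) - b (Y r))| <= K * (x + e) * dl.
    apply: le_trans (le_normr_Rintegral _ _) _ => //.
      exact: (integrableB _ (ic (b (z k))) iY).
    rewrite -cI; apply: le_Rintegral => //.
    - exact: (integrable_norm (integrableB _ (ic (b (z k))) iY)).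
    - exact: ic.
    - move=> r /=; rewrite in_itv/= => /andP[ur rv].
      have rr : 0 <= r <= v by rewrite rv (le_trans k0)// ltW.
      apply: le_trans (bLip s01 m0 _ (Ypos r rr)) _.
        by rewrite (le_trans me)// ltW.
      rewrite ler_wpM2l// (_ : z k - Y r = (z k - Y u) + (Y u - Y r)); last by ring.
      apply: le_trans (ler_normD _ _) _; rewrite lerD2l osc//.
        by rewrite k0 kT'.
      rewrite distrC ger0_norm ?subr_ge0 ?(ltW ur)//.
      by rewrite -dlE lerD2r.
  apply: le_trans (ler_normD _ _) _; apply: le_trans (lerD (lexx _) intle) _.
  have -> : x + K * (x + e) * dl = x * (1 + K * dl) + e * (K * dl) by ring.
  have -> : e * ((1 + K * dl) ^+ k.+1 - 1) = e * ((1 + K * dl) ^+ k - 1) * (1 + K * dl) + e * (K * dl).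
    by rewrite exprS; ring.
  by rewrite lerD2r ler_wpM2r// addr_ge0// mulr_ge0// ltW.
move=> k kT zk; apply: le_trans (step k kT zk) _.
rewrite ler_wpM2l// lerBlDr ler_wpDr//.
apply: le_trans (_ : expR (K * dl) ^+ k <= _).
  have K1 : 0 <= 1 + K * dl by rewrite addr_ge0// mulr_ge0// ltW.
  by rewrite lerXn2r ?nnegrE ?expR_ge0 ?expR_ge1Dx.
by rewrite -expRM_natl ler_expR mulrCA ler_wpM2l.
Qed.

Lemma truncn_grid (h t : R) : 0 < h -> 0 <= t ->
  (Num.truncn (t / h))%:R * h <= t < (Num.truncn (t / h)).+1%:R * h.
Proof.
move=> h0 t0; have := truncn_itv (divr_ge0 t0 (ltW h0)).
by rewrite ler_pdivlMr// ltr_pdivrMr.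
Qed.

End track.

Definition grid_increments (T : R) (N k : nat) : R :=
  beta (k.+1%:R * (T / N%:R)) - beta (k%:R * (T / N%:R)).

Section consequences.
Variables T eps : R.
Hypotheses (T0 : 0 < T) (eps0 : 0 < eps) (s01 : 0 < s < 1).

Let z N := euler s y0 eps (T / N%:R) (grid_increments T N).

Let mesh (d : R) (N : nat) : 0 < d -> ((Num.truncn (T / d)).+1 <= N)%N ->
  0 < T / N%:R /\ T / N%:R <= d.
Proof.
move=> d0 hN; have N0 : (0 : R) < N%:R by rewrite ltr0n (leq_trans _ hN).
split; first by rewrite divr_gt0.
rewrite ler_pdivrMr// mulrC -ler_pdivrMr//; apply: ltW.
by apply: lt_le_trans (truncnS_gt _) _; rewrite ler_nat.
Qed.

(** As long as the scheme is alive it follows the path within [eps / 2], hence it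
    stays above [3 / 2 eps]. *)
Lemma euler_survives : (forall t, 0 <= t <= T -> 2 * eps <= Y t) ->
  exists N0, forall N, (N0 <= N)%N -> eps < z N N.
Proof.
move=> Yeps; have eps0' := eps0; have T0' := T0.
set K := (eps^-1) ^+ 2.
pose e := eps / 2 / expR (K * T).
have e0 : 0 < e by rewrite !divr_gt0// expR_gt0.
have [d d0 hd] := unif_cont T e0.
exists (Num.truncn (T / d)).+1 => N hN.
have [dl0 dld] := mesh d0 hN.
have N0 : (0 : R) < N%:R by rewrite ltr0n (leq_trans _ hN).
have NT : N%:R * (T / N%:R) = T by rewrite mulrC divfK// gt_eqF.
suff H k : (k <= N)%N -> forall j, (j <= k)%N -> eps < z N j by exact: (H N).
elim: k => [_ j|k IH kN j].
  rewrite leqn0 => /eqP ->; rewrite /z/= -Y0.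
  by have := Yeps 0; rewrite lexx ltW// => /(_ isT); lra.
rewrite leq_eqVlt => /predU1P[->|]; last by rewrite ltnS; apply: IH; exact: ltnW.
have kT : k.+1%:R * (T / N%:R) <= T.
  by rewrite -[leRHS]NT ler_wpM2r ?ler_nat// ltW.
have Ye t : 0 <= t <= T -> eps <= Y t by move=> /Yeps; lra.
have := @euler_track eps (T / N%:R) dl0 s01 T eps e eps0 (lexx _) (ltW e0) Ye
  (fun u v uT uv => hd u v uT (le_trans uv dld)) k.+1 kT (fun j jk => IH (ltnW kN) j jk).
rewrite -/(z N k.+1) -/K /e divfK ?gt_eqF ?expR_gt0// ler_norml => /andP[+ _].
have := Yeps (k.+1%:R * (T / N%:R)); rewrite kT mulr_ge0 ?(ltW dl0)// => /(_ isT); lra.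
Qed.

(** Let [T'] be the first time of a fine grid where the path is below [3 / 4 eps].
    Up to [T'] the path is at least [eps / 2], so that the scheme, if it were still
    alive, would follow the path and be below [eps] near [T']. *)
Lemma euler_dies tz : 0 <= tz <= T -> Y tz <= 0 -> eps < y0 ->
  exists N0, forall N, (N0 <= N)%N -> z N N <= eps.
Proof.
move=> /andP[tz0 tzT] Ytz epsy; have eps0' := eps0; have T0' := T0.
have {tz0} tz0 : 0 < tz.
  rewrite lt_neqAle tz0 andbT; apply/eqP => tzE; move: Ytz; rewrite -tzE Y0; lra.
have e1 : 0 < eps / 8 by lra.
have [d d0 hd] := unif_cont T e1.
pose M := (Num.truncn (tz / d)).+1; pose h := tz / M%:R.
have h0 : 0 < h by rewrite divr_gt0.
have hled : h <= d.
  by rewrite /h ler_pdivrMr// mulrC -ler_pdivrMr// ltW// truncnS_gt.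
have Mh : M%:R * h = tz by rewrite /h mulrC divfK// gt_eqF.
(* a grid instead of a first hitting time: minima over [nat] exist *)
have exj : exists j, Y (j%:R * h) < 3 / 4 * eps.
  by exists M; rewrite Mh; lra.
have [j Yj jmin] := ex_minnP exj.
have jM : (j <= M)%N by apply: jmin; rewrite Mh; lra.
have j0 : (0 < j)%N.
  rewrite lt0n; apply/eqP => jE; move: Yj; rewrite jE mul0r Y0; lra.
pose T' := j%:R * h.
have T'tz : T' <= tz by rewrite -Mh ler_wpM2r ?ler_nat// ltW.
have T'0 : 0 <= T' by rewrite mulr_ge0// ltW.
have Yhalf t : 0 <= t <= T' -> eps / 2 <= Y t.
  move=> /andP[t0 tT'].
  have [i ij it] : exists2 i, (i < j)%N & `|i%:R * h - t| <= h.
    have /andP[it ti] := truncn_grid h0 t0.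
    set i := Num.truncn _ in it ti.
    have [ij|ji] := ltnP i j.
      exists i => //; rewrite distrC ger0_norm ?subr_ge0// lerBlDl.
      by rewrite (le_trans (ltW ti))// -[i.+1]addn1 natrD mulrDl mul1r.
    exists j.-1; first by rewrite prednK.
    have -> : t = T'.
      by apply/eqP; rewrite eq_le tT' /= (le_trans _ it)// ler_wpM2r ?ler_nat// ltW.
    rewrite /T' distrC -mulrBl -[in j%:R](prednK j0) -[j.-1.+1]addn1 natrD [_ + 1]addrC addrK mul1r.
    by rewrite ger0_norm// ltW.
  have ihT : 0 <= i%:R * h <= T.
    rewrite mulr_ge0 ?(ltW h0)//= (le_trans _ tzT)// (le_trans _ T'tz)//.
    by rewrite ler_wpM2r ?ler_nat ?(ltnW ij)// ltW.
  have := hd _ _ ihT (le_trans it hled); rewrite ler_norml => /andP[_].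
  have : 3 / 4 * eps <= Y (i%:R * h).
    by rewrite leNgt; apply/negP => /jmin; rewrite leqNgt ij.
  lra.
set K := ((eps / 2)^-1) ^+ 2.
pose e := eps / 16 / expR (K * T').
have e0 : 0 < e by rewrite !divr_gt0// expR_gt0.
have [d' d'0 hd'] := unif_cont T e0.
have dd0 : 0 < Num.min d d' by rewrite lt_min d0.
exists (Num.truncn (T / Num.min d d')).+1 => N hN.
have [dl0] := mesh dd0 hN; rewrite le_min => /andP[dld dld'].
have N0 : (0 : R) < N%:R by rewrite ltr0n (leq_trans _ hN).
have NT : N%:R * (T / N%:R) = T by rewrite mulrC divfK// gt_eqF.
rewrite leNgt; apply/negP => zN.
have zj k : (k <= N)%N -> eps < z N k by move=> kN; exact: euler_stopped kN zN.
have /andP[kT' T'k] := truncn_grid dl0 T'0.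
set k := Num.truncn _ in kT' T'k.
have kN : (k <= N)%N.
  rewrite -(ler_nat R) -(ler_pM2r dl0) NT (le_trans kT')// (le_trans T'tz)//.
have m0 : 0 < eps / 2 by lra.
have me : eps / 2 <= eps by lra.
have uT u : 0 <= u <= T' -> 0 <= u <= T.
  by move=> /andP[-> uT']; rewrite (le_trans uT')// (le_trans T'tz).
have := @euler_track eps (T / N%:R) dl0 s01 T' (eps / 2) e m0 me (ltW e0) Yhalf
  (fun u v uT' uv => hd' u v (uT _ uT') (le_trans uv dld')) k kT'
  (fun j jk => zj j (leq_trans (ltnW jk) kN)).
rewrite -/(z N k) -/K /e divfK ?gt_eqF ?expR_gt0// ler_norml => /andP[_].
have kdl0 : 0 <= k%:R * (T / N%:R) by rewrite mulr_ge0// ltW.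
have kT : 0 <= k%:R * (T / N%:R) <= T by apply: uT; rewrite kdl0.
have := hd (k%:R * (T / N%:R)) T' kT.
rewrite distrC ger0_norm ?subr_ge0// => /(_ _).
have T'k' : T' - k%:R * (T / N%:R) <= d.
  apply: le_trans dld.
  by rewrite lerBlDl (le_trans (ltW T'k))// -[k.+1]addn1 natrD mulrDl mul1r.
move=> /(_ T'k'); rewrite ler_norml => /andP[_].
have := zj k kN; move: Yj; rewrite -/T'; lra.
Qed.

End consequences.
End path.

(** * Independence along the Euler scheme *)

Section independence.
Local Open Scope ereal_scope.
Context (R : realType) (d : measure_display) (T : measurableType d).
Variable P : probability T R.
Variables (V W : T -> R).
Hypotheses (mV : measurable_fun setT V) (mW : measurable_fun setT W).

Let VW t := (V t, W t).

Let mVW : measurable_fun setT VW.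
Proof. exact: measurable_fun_pair. Qed.

(** Rectangles generate the sigma-algebra of the plane. *)
Lemma indep_pair_event (E : set T) : measurable E ->
  (forall A A', measurable A -> measurable A' ->
    P (V @^-1` A `&` W @^-1` A' `&` E) = P (V @^-1` A `&` W @^-1` A') * P E) ->
  forall D : set (R * R), measurable D -> P (VW @^-1` D `&` E) = P (VW @^-1` D) * P E.
Proof.
move=> mE ind D mD.
have PE0 : (0 <= fine (P E))%R by rewrite fine_ge0.
pose c := NngNum PE0.
have PEE : P E = (c%:num)%:E by rewrite /= fineK// fin_num_measure.
pose m1 : {measure set (R * R)%type -> \bar R} :=
  measure_function_pushforward__canonical__measure_function_Measure (mrestr P mE) mVW.
pose m2 : {measure set (R * R)%type -> \bar R} :=
  mscale c (measure_function_pushforward__canonical__measure_function_Measure P mVW).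
have m1E X : m1 X = P (VW @^-1` X `&` E) by [].
have m2E X : m2 X = (c%:num)%:E * P (VW @^-1` X) by [].
have <- : m1 D = P (VW @^-1` D `&` E) by [].
rewrite PEE muleC -[RHS]m2E.
apply: (@measure_unique _ _ _ [set A `*` B | A in measurable & B in measurable] (fun=> setT)) => //.
- exact: measurable_prod_measurableType.
- move=> _ _ [A mA [B mB <-]] [C mC [D' mD' <-]]; rewrite -setXI.
  by exists (A `&` C); [exact: measurableI|exists (B `&` D') => //; exact: measurableI].
- by move=> i; exists setT => //; exists setT => //; rewrite setXTT.
- by rewrite bigcup_const.
- move=> _ [A mA [B mB <-]]; rewrite m1E m2E -PEE muleC.
  have -> : VW @^-1` (A `*` B) = V @^-1` A `&` W @^-1` B by [].
  exact: ind.
- move=> k; rewrite m1E; apply: le_lt_trans (probability_le1 _ _) _; last by rewrite ltry.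
  by apply: measurableI => //; rewrite -[X in measurable X]setTI; exact: mVW.
Qed.

End independence.

Section independence_mean.
Local Open Scope ereal_scope.
Context (R : realType) (d : measure_display) (T : measurableType d).
Variable P : probability T R.
Context (d1 d2 : measure_display) (T1 : measurableType d1) (T2 : measurableType d2).
Variables (V : T -> T1) (W : T -> T2).
Hypotheses (mV : measurable_fun setT V) (mW : measurable_fun setT W).

(** The law of the pair is the product of the laws, so Tonelli's theorem applies. *)
Lemma indep_pair_mean (N : probability T2 R) :
  (forall A, measurable A -> P (W @^-1` A) = N A) ->
  (forall A A', measurable A -> measurable A' ->
    P (V @^-1` A `&` W @^-1` A') = P (V @^-1` A) * P (W @^-1` A')) ->
  forall h : T1 * T2 -> \bar R, measurable_fun setT h -> (forall x, 0 <= h x) ->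
  \int[P]_t h (V t, W t) = \int[P]_t \int[N]_w h (V t, w).
Proof.
have mVW : measurable_fun setT (fun t => (V t, W t)) by exact: measurable_fun_pair.
move=> WN ind h mh h0.
pose m' : {measure set (T1 * T2)%type -> \bar R} :=
  measure_function_pushforward__canonical__measure_function_Measure P mVW.
pose Vm := isMeasurableFun.Build _ _ _ _ V mV.
pose V' : {mfun T >-> T1} := HB.pack V Vm.
pose m1 : probability T1 R := distribution P V'.
transitivity (\int[m']_z h z).
  by rewrite ge0_integral_pushforward.
transitivity (\int[m1 \x N]_z h z).
  apply: eq_measure_integral => D mD _; apply/esym.
  apply: product_measure_unique => // A B mA mB.
  by rewrite /m' /= /pushforward -WN// -ind.
rewrite fubini_tonelli1// /fubini_F.
rewrite ge0_integral_distribution//=.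
- have := @measurable_fun_fubini_tonelli_F _ _ _ _ R N h mh h0; exact.
- by move=> x; exact: integral_ge0.
Qed.
End independence_mean.

Section chain.
Context (R : realType) (d : measure_display) (T : measurableType d).
Variable P : probability T R.

Lemma bounded_integrable (f : T -> R) (M : R) : measurable_fun setT f ->
  (forall t, `|f t| <= M) -> P.-integrable setT (EFin \o f).
Proof.
move=> mf fM; apply: measurable_bounded_integrable => //.
  by apply: le_lt_trans (probability_le1 P _) _; rewrite ?ltry.
by exists M; split; [exact: num_real|move=> x Mx t _ /=; exact: le_trans (fM t) (ltW Mx)].
Qed.

Variables (s : R) (W : nat -> T -> R) (N : nat) (y0 eps dl : R).
Hypothesis eps0 : 0 <= eps.
Hypothesis mW : forall i, measurable_fun setT (W i).

Let V (k : nat) (t : T) := euler s y0 eps dl (W ^~ t) k.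

Let Phi (x w : R) := if eps < x then x + (1 - 2 * s) / (2 * x) * dl + w else x.

Let VS k t : V k.+1 t = Phi (V k t) (W k t).
Proof. by []. Qed.

Let mPhi : measurable_fun setT (fun p : R * R => Phi p.1 p.2).
Proof.
have -> : (fun p : R * R => Phi p.1 p.2) = (fun p => if eps < p.1 then
    p.1 + (1 - 2 * s) * (2 * p.1) `^ (-1) * dl + p.2 else p.1).
  apply/funext => -[x w]; rewrite /Phi/=; case: ifPn => // ex.
  by rewrite powR_inv1// mulr_ge0// (le_trans eps0)// ltW.
have m1 : measurable_fun setT (fun p : R * R => p.1) by exact: measurable_fst.
have m2 : measurable_fun setT (fun p : R * R => p.2) by exact: measurable_snd.
apply: measurable_fun_ifT => //.
  exact: measurable_fun_ltr.
apply: measurable_funD => //; apply: measurable_funD => //.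
apply: measurable_funM => //; apply: measurable_funM => //.
have m3 : measurable_fun setT (fun p : R * R => 2 * p.1) by exact: measurable_funM.
have mp : measurable_fun setT (fun x : R => x `^ (-1)) by exact: measurable_powR.
by have := measurableT_comp mp m3.
Qed.

Lemma measurable_euler k : measurable_fun setT (V k).
Proof.
elim: k => [|k IH]; first exact: measurable_cst.
rewrite (_ : V k.+1 = (fun p : R * R => Phi p.1 p.2) \o (fun t => (V k t, W k t))).
  exact: (measurableT_comp mPhi (measurable_fun_pair IH (mW k))).
by apply/funext => t; rewrite VS.
Qed.

Let tail (A : nat -> set R) (j : nat) : set T :=
  \bigcap_(i in [set i | (j <= i < N)%N]) (W i @^-1` A i).

Hypothesis indW : forall A : nat -> set R, (forall i, measurable (A i)) ->
  forall j, (j < N)%N -> P (tail A j) = (P (W j @^-1` A j) * P (tail A j.+1))%E.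

Let mpre (X : T -> R) (A : set R) : measurable_fun setT X -> measurable A -> measurable (X @^-1` A).
Proof. by move=> mX mA; rewrite -[X in measurable X]setTI; exact: mX. Qed.

Let mtail A j : (forall i, measurable (A i)) -> measurable (tail A j).
Proof.
by move=> mA; apply: bigcap_measurableType => i _; apply: mpre.
Qed.

Let tailS A j : (j < N)%N -> tail A j = W j @^-1` A j `&` tail A j.+1.
Proof.
move=> jN; apply/seteqP; split => [t tA|t [tj tA] i /= /andP[]].
  split; first by apply: tA; rewrite /= leqnn.
  by move=> i /= /andP[ji iN]; apply: tA; rewrite /= iN ltnW.
rewrite leq_eqVlt => /predU1P[<- //|ji iN]; apply: tA; rewrite /=.
by rewrite ji.
Qed.

(** The chain at time [j] is a function of the first [j] increments. The induction
    carries all the later increments at once, because the chain at time [j + 1] is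
    a function of the chain at time [j] and of the increment [j]. *)
Let chain_indep j (A : nat -> set R) : (forall i, measurable (A i)) ->
  (j <= N)%N -> forall A', measurable A' ->
  P (V j @^-1` A' `&` tail A j) = (P (V j @^-1` A') * P (tail A j))%E.
Proof.
elim: j A => [|j IH] A mA jN A' mA'.
  have -> : V 0%N @^-1` A' = if y0 \in A' then setT else set0.
    by apply/seteqP; split => t /=; case: ifPn; rewrite ?inE ?notin_setE.
  case: ifPn => _; first by rewrite setTI probability_setT mul1e.
  by rewrite set0I measure0 mul0e.
have jN' := ltnW jN.
have mV := measurable_euler j.
have IHW A1 A2 : measurable A1 -> measurable A2 ->
    P (V j @^-1` A1 `&` W j @^-1` A2 `&` tail A j.+1) =
    (P (V j @^-1` A1) * (P (W j @^-1` A2) * P (tail A j.+1)))%E.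
  move=> mA1 mA2; pose A2' i := if i == j then A2 else A i.
  have mA2' i : measurable (A2' i) by rewrite /A2'; case: ifP.
  have tE : tail A2' j.+1 = tail A j.+1.
    by apply: eq_bigcapr => i /= /andP[ji _]; rewrite /A2' gtn_eqF.
  have := IH A2' mA2' jN' A1 mA1.
  by rewrite indW// tailS// setIA tE /A2' eqxx.
have IHV A1 A2 : measurable A1 -> measurable A2 ->
    P (V j @^-1` A1 `&` W j @^-1` A2) = (P (V j @^-1` A1) * P (W j @^-1` A2))%E.
  move=> mA1 mA2; pose A2' i := if i == j then A2 else setT.
  have mA2' i : measurable (A2' i) by rewrite /A2'; case: ifP.
  have tE : tail A2' j.+1 = setT.
    apply/seteqP; split => // t _ i /= /andP[ji _].
    by rewrite /A2' gtn_eqF.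
  have := IH A2' mA2' jN' A1 mA1.
  by rewrite indW// tailS// tE setIT /A2' eqxx probability_setT mule1.
have mD : measurable [set p : R * R | A' (Phi p.1 p.2)].
  by rewrite -[X in measurable X]setTI; exact: mPhi.
have := @indep_pair_event _ _ _ P (V j) (W j) mV (mW j) (tail A j.+1) (mtail j.+1 mA) _ _ mD.
apply => A1 A2 mA1 mA2.
by rewrite IHW// IHV// muleA.
Qed.

Lemma euler_indep k (A A' : set R) : (k < N)%N -> measurable A -> measurable A' ->
  P (V k @^-1` A `&` W k @^-1` A') = (P (V k @^-1` A) * P (W k @^-1` A'))%E.
Proof.
move=> kN mA mA'; pose A2' i := if i == k then A' else setT.
have mA2' i : measurable (A2' i) by rewrite /A2'; case: ifP.
have tE : tail A2' k.+1 = setT.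
  apply/seteqP; split => // t _ i /= /andP[ki _].
  by rewrite /A2' gtn_eqF.
have := chain_indep mA2' (ltnW kN) mA.
by rewrite indW// tailS// tE setIT /A2' eqxx probability_setT mule1.
Qed.

End chain.

(** * Survival of the Euler scheme *)

Section martingale.
Context (R : realType) (d : measure_display) (T : measurableType d).
Variable P : probability T R.

Lemma mean_cst (c : R) : \int[P]_t c = c.
Proof.
rewrite Rintegral_cst//; have := @probability_setT _ _ _ P.
by move=> /= ->; rewrite mulr1.
Qed.

Lemma mean_le (f g : T -> R) (a b c : R) :
  measurable_fun setT f -> measurable_fun setT g ->
  (forall t, `|f t| <= a) -> (forall t, `|g t| <= b) ->
  (forall t, f t <= g t + c) -> \int[P]_t f t <= \int[P]_t g t + c.
Proof.
move=> mf mg fa gb fg.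
have fi := bounded_integrable P mf fa; have gi := bounded_integrable P mg gb.
have ci : P.-integrable setT (EFin \o cst c) by exact: finite_measure_integrable_cst.
have -> : \int[P]_t g t + c = \int[P]_t (g t + c).
  by rewrite RintegralD//= mean_cst.
by apply: le_Rintegral => //; exact: (integrableD _ gi ci).
Qed.

Variables (s : R) (W : nat -> T -> R) (N : nat) (y0 eps eta sg C : R).
Hypotheses (s0 : 0 < s) (eps0 : 0 < eps) (sg0 : 0 < sg) (C0 : 0 <= C).
Hypothesis mW : forall i, measurable_fun setT (W i).
Hypothesis lawW : forall i A, (i < N)%N -> measurable A -> P (W i @^-1` A) = normal_prob 0 sg A.
Hypothesis eta0 : 0 < eta.

Let dl := sg ^+ 2.
Let V (k : nat) (t : T) := euler s y0 eps dl (W ^~ t) k.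

Hypothesis indVW : forall k (A A' : set R), (k < N)%N -> measurable A -> measurable A' ->
  P (V k @^-1` A `&` W k @^-1` A') = (P (V k @^-1` A) * P (W k @^-1` A'))%E.

Let theta (k : nat) := eta + (N - k)%:R * dl.

Hypothesis step : forall k x, (k < N)%N -> eps < x ->
  `|\int[normal_prob 0 sg]_w survival s (theta k.+1) (x + (1 - 2 * s) / (2 * x) * dl + w)
    - survival s (theta k) x| <= C * sg ^+ 3.

Let mV k : measurable_fun setT (V k) := @measurable_euler R d T s W y0 eps dl (ltW eps0) mW k.

Let alive k t := eps < V k t.

(** [E k] is the mean of the approximate martingale: [survival] at the position of
    the chain, with the time left [theta k], cut off once the chain is stopped.
    [Mid k] is its value after the step [k] but before the stopping is looked at. *)
Let E k := \int[P]_t (if alive k t then survival s (theta k) (V k t) else 0).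
Let p k := \int[P]_t (alive k t)%:R.
Let Mid k := \int[P]_t (if alive k t then survival s (theta k.+1) (V k.+1 t) else 0).

Let malive k : measurable_fun setT (alive k).
Proof. exact: measurable_fun_ltr. Qed.

Let mS k j l : measurable_fun setT (fun t => if alive k t then survival s (theta j) (V l t) else 0).
Proof.
apply: measurable_fun_ifT => //; exact: (measurableT_comp (measurable_survival s0 _) (mV l)).
Qed.

Let bS k j l t : `|if alive k t then survival s (theta j) (V l t) else 0| <= 1.
Proof.
case: ifP => _; last by rewrite normr0.
by rewrite ger0_norm ?survival_ge0// survival_le1.
Qed.

Let malive' k : measurable_fun setT (fun t => (alive k t)%:R : R).
Proof.
rewrite (_ : (fun t => _) = (fun t => if alive k t then 1 else 0 : R)); last first.
  by apply/funext => t; case: (alive k t).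
exact: measurable_fun_ifT.
Qed.

Let balive k t : `|(alive k t)%:R : R| <= 1.
Proof. by case: (alive k t); rewrite ?normr1 ?normr0. Qed.

Let drift (x w : R) := x + (1 - 2 * s) / (2 * x) * dl + w.

(** Conditionally on [V k], the step [k] integrates [hr] against the normal law,
    which gives [kk]. *)
Let hr (j : nat) (x w : R) := if eps < x then survival s (theta j) (drift x w) else 0.

Let hr_ge0 j x w : 0 <= hr j x w.
Proof. by rewrite /hr; case: ifP => // _; exact: survival_ge0. Qed.

Let hr_le1 j x w : hr j x w <= 1.
Proof. by rewrite /hr; case: ifP => // _; exact: survival_le1. Qed.

Let mhr j : measurable_fun setT (fun q : R * measurableTypeR R => hr j q.1 q.2).
Proof.
have m1 : measurable_fun setT (fun p : R * measurableTypeR R => p.1) by exact: measurable_fst.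
have m2 : measurable_fun setT (fun p : R * measurableTypeR R => p.2) by exact: measurable_snd.
have -> : (fun q : R * measurableTypeR R => hr j q.1 q.2) = (fun q => if eps < q.1 then
    survival s (theta j) (q.1 + (1 - 2 * s) * (2 * q.1) `^ (-1) * dl + q.2) else 0).
  apply/funext => -[x w]; rewrite /hr/=; case: ifPn => // ex.
  by rewrite /drift powR_inv1// mulr_ge0// (le_trans (ltW eps0))// ltW.
apply: measurable_fun_ifT => //; first exact: measurable_fun_ltr.
have m3 : measurable_fun setT (fun p : R * measurableTypeR R => 2 * p.1) by exact: measurable_funM.
have mp : measurable_fun setT (fun x : R => x `^ (-1)) by exact: measurable_powR.
have m4 := measurableT_comp mp m3.
have m5 : measurable_fun setT (fun q : R * measurableTypeR R => q.1 + (1 - 2 * s) * (2 * q.1) `^ (-1) * dl + q.2).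
  apply: measurable_funD => //; apply: measurable_funD => //.
  by apply: measurable_funM => //; exact: measurable_funM.
by have := measurableT_comp (measurable_survival s0 (theta j)) m5.
Qed.

Notation N_ := (normal_prob 0 sg).

Let kk j (x : R) := \int[N_]_w hr j x w.

Let integrable_hr j x : N_.-integrable setT (EFin \o hr j x).
Proof.
apply: measurable_bounded_integrable => //.
- by apply: le_lt_trans (probability_le1 N_ _) _; rewrite ?ltry.
- have m2 : measurable_fun setT (fun w : measurableTypeR R => (x, w)) by exact: measurable_fun_pair.
  by have := measurableT_comp (mhr j) m2.
- exists 1; split; [exact: num_real|move=> y y1 t _ /=].
  by rewrite ger0_norm// (le_trans (hr_le1 _ _ _))// ltW.
Qed.

Let kkE j x : ((kk j x)%:E = \int[N_]_w (hr j x w)%:E)%E.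
Proof. by rewrite /kk /Rintegral fineK//; apply: integrable_fin_num (integrable_hr j x). Qed.

Let kk01 j x : 0 <= kk j x <= 1.
Proof.
apply/andP; split; first by apply: Rintegral_ge0 => w _.
have -> : 1 = \int[N_]_w (1 : R).
  rewrite Rintegral_cst//; have := @probability_setT _ _ _ N_.
  by move=> /= ->; rewrite mulr1.
rewrite /kk; apply: le_Rintegral => //.
exact: finite_measure_integrable_cst.
Qed.

Let mkk j : measurable_fun setT (kk j).
Proof.
have mh : measurable_fun setT (fun q : R * measurableTypeR R => (hr j q.1 q.2)%:E) by exact/measurable_EFinP.
have := @measurable_fun_fubini_tonelli_F _ _ R (measurableTypeR R) R [the probability _ _ of N_] _ mh (fun q => hr_ge0 j q.1 q.2).
move=> m; apply/measurable_EFinP; move: m; congr (measurable_fun _ _).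
by apply/funext => x; rewrite /fubini_F /= -kkE.
Qed.

Let MidE k : (k < N)%N -> Mid k = \int[P]_t kk k.+1 (V k t).
Proof.
move=> kN; rewrite /Mid /Rintegral; congr fine.
have mh : measurable_fun setT (fun q : R * measurableTypeR R => (hr k.+1 q.1 q.2)%:E) by exact/measurable_EFinP.
have := @indep_pair_mean R d T P _ _ R (measurableTypeR R) (V k) (W k) (mV k) (mW k) [the probability _ _ of N_]
  (fun A mA => lawW kN mA) (fun A A' mA mA' => indVW kN mA mA') _ mh (fun q => hr_ge0 k.+1 q.1 q.2).
move=> h; transitivity (\int[P]_t (hr k.+1 (V k t) (W k t))%:E)%E.
  apply: eq_integral => t _; rewrite /hr /alive /V/= -/(V k t).
  by case: ifPn => // ->.
by rewrite h; apply: eq_integral => t _; rewrite kkE.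
Qed.

Let mid_dist k x : (k < N)%N ->
  `|kk k.+1 x - (if eps < x then survival s (theta k) x else 0)| <= C * sg ^+ 3.
Proof.
move=> kN; rewrite /kk /hr; case: ifPn => ex; first exact: step.
have -> : \int[N_]_w 0 = 0 :> R by rewrite Rintegral_cst// mul0r.
by rewrite subrr normr0 mulr_ge0// exprn_ge0// ltW.
Qed.

Let bkk j t k : `|kk j (V k t)| <= 1.
Proof. by have /andP[h1 h2] := kk01 j (V k t); rewrite ger0_norm. Qed.

Let MidE_dist k : (k < N)%N -> Mid k <= E k + C * sg ^+ 3 /\ E k <= Mid k + C * sg ^+ 3.
Proof.
move=> kN; have mk := measurableT_comp (mkk k.+1) (mV k).
rewrite MidE//; split.
  apply: (mean_le mk (mS k k k) (bkk k.+1 ^~ k) (bS k k k)) => t.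
  by have := mid_dist (V k t) kN; rewrite ler_norml => /andP[_]; rewrite lerBlDl addrC.
apply: (mean_le (mS k k k) mk (bS k k k) (bkk k.+1 ^~ k)) => t.
have := mid_dist (V k t) kN; rewrite ler_norml => /andP[+ _].
by rewrite lerNl opprB lerBlDl addrC.
Qed.

Let alive_dec k t : alive k.+1 t -> alive k t.
Proof. by rewrite /alive /V; apply: euler_stopped. Qed.

Let Fe := survival s eta eps.

(** A chain that has just been stopped is below [eps], where [survival] is at most
    [Fe], and the probability of being stopped at step [k] is [p k - p k.+1]. *)
Let Edec k : (k < N)%N -> E k.+1 <= Mid k /\ Mid k <= E k.+1 + Fe * (p k - p k.+1).
Proof.
move=> kN; split.
  rewrite -[leRHS]addr0; apply: (mean_le (mS _ _ _) (mS _ _ _) (bS _ _ _) (bS _ _ _)) => t.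
  rewrite addr0; case: ifP => [/alive_dec -> //|_].
  by case: ifP => // _; exact: survival_ge0.
have mg := mS k.+1 k.+1 k.+1.
have ai := bounded_integrable P (malive' k) (balive k).
have aSi := bounded_integrable P (malive' k.+1) (balive k.+1).
have gi := bounded_integrable P mg (bS k.+1 k.+1 k.+1).
have di := integrableB measurableT ai aSi.
have fi := integrableZl measurableT Fe di.
have -> : E k.+1 + Fe * (p k - p k.+1) = \int[P]_t
    ((if alive k.+1 t then survival s (theta k.+1) (V k.+1 t) else 0) +
     Fe * ((alive k t)%:R - (alive k.+1 t)%:R)).
  by rewrite RintegralD//= RintegralZl//= RintegralB.
apply: le_Rintegral => //.
- exact: (bounded_integrable P (mS k k.+1 k.+1) (bS k k.+1 k.+1)).
- exact: (integrableD _ gi fi).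
move=> t _; case: (boolP (alive k.+1 t)) => [/alive_dec ->|].
  by rewrite subrr mulr0 addr0.
rewrite /alive -leNgt => Vle; case: ifPn => _; last by rewrite subrr mulr0 addr0.
by rewrite subr0 mulr1 add0r survival_homo// /theta lerDl mulr_ge0// exprn_ge0// (ltW sg0).
Qed.

Let arith1 (x1 x2 x3 x4 x5 x6 x7 x8 : R) : x2 <= x3 + x5 -> x3 <= x2 + x5 + x7 ->
  x1 <= x4 -> x4 <= x1 + x8 -> x4 <= x2 + x6 -> x2 <= x4 + x6 ->
  x1 <= x3 + (x5 + x6) /\ x3 <= x1 + (x5 + x6) + (x7 + x8).
Proof. by move=> *; split; lra. Qed.

Let arith2 (x1 x2 x3 x4 x5 x6 : R) : x1 <= x2 + x3 -> x2 <= x1 + x3 + x4 ->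
  x5 <= x1 -> x1 <= x6 -> x5 <= x2 + x3 /\ x2 <= x6 + x3 + x4.
Proof. by move=> *; split; lra. Qed.

Lemma euler_mean : E N <= E 0%N + N%:R * (C * sg ^+ 3) /\
  E 0%N <= E N + N%:R * (C * sg ^+ 3) + Fe.
Proof.
have H k : (k <= N)%N -> E k <= E 0%N + k%:R * (C * sg ^+ 3) /\
  E 0%N <= E k + k%:R * (C * sg ^+ 3) + Fe * (p 0%N - p k).
  elim: k => [_|k IH kN]; first by rewrite mul0r subrr mulr0 !addr0.
  have [i1 i2] := IH (ltnW kN); have [e1 e2] := Edec kN; have [d1 d2] := MidE_dist kN.
  rewrite -[k.+1]addn1 natrD !mulrDl mul1r addn1.
  have -> : Fe * (p 0%N - p k.+1) = Fe * (p 0%N - p k) + Fe * (p k - p k.+1) by ring.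
  exact: (arith1 i1 i2 e1 e2 d1 d2).
have [h1 h2] := H N (leqnn N); split => //; apply: le_trans h2 _.
rewrite lerD2l ler_piMr ?survival_ge0//.
have p0 : p 0%N <= 1.
  rewrite -(mean_cst 1); apply: le_Rintegral => //.
  - exact: (bounded_integrable P (malive' 0%N) (balive 0%N)).
  - exact: finite_measure_integrable_cst.
  - by move=> t _; case: (alive _ _).
have pN : 0 <= p N by apply: Rintegral_ge0 => t _.
by rewrite lerBlDr (le_trans p0)// lerDl.
Qed.

(** At the end the time left is [eta]: [survival s eta] is at least [Fe] on the
    chains that are alive, and at most 1. *)
Lemma euler_alive_prob : eps < y0 ->
  Fe * p N <= survival s (theta 0) y0 + N%:R * (C * sg ^+ 3) /\
  survival s (theta 0) y0 <= p N + N%:R * (C * sg ^+ 3) + Fe.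
Proof.
move=> ey0; have [h1 h2] := euler_mean.
have E0 : E 0%N = survival s (theta 0) y0.
  by rewrite /E /alive /V /= ey0 mean_cst.
have pi := bounded_integrable P (malive' N) (balive N).
have Si := bounded_integrable P (mS N N N) (bS N N N).
have i1 : Fe * p N <= E N.
  rewrite -RintegralZl//; apply: le_Rintegral => //.
    exact: (integrableZl _ _ pi).
  move=> t _; case: ifPn => al; last by rewrite mulr0.
  by rewrite mulr1 survival_homo// ?(ltW al)// /theta subnn mul0r addr0.
have i2 : E N <= p N.
  by apply: le_Rintegral => // t _; case: ifPn => al //; exact: survival_le1.
rewrite -E0; exact: (arith2 h1 h2 i1 i2).
Qed.

End martingale.

(** * From the Euler scheme to the Bessel process *)

Section brownian_grid.
Context (R : realType) (d : measure_display) (T : measurableType d).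
Variable P : probability T R.
Variables (B : R -> T -> R) (b0 : R) (h : R) (N : nat).
Hypotheses (HB : brownian P b0 B) (h0 : 0 < h).

Let W (k : nat) (w : T) := B (k.+1%:R * h) w - B (k%:R * h) w.

Lemma measurable_increment k : measurable_fun setT (W k).
Proof.
by apply: measurable_funB; apply: (brownian_measurable HB); rewrite mulr_ge0// ltW.
Qed.

Lemma increment_law k A : measurable A -> P (W k @^-1` A) = normal_prob 0 (Num.sqrt h) A.
Proof.
move=> mA; have e : k.+1%:R * h - k%:R * h = h by rewrite -mulrBl -natrB// subSnn mul1r.
rewrite -[X in Num.sqrt X]e; apply: (brownian_normal HB) => //.
  by rewrite mulr_ge0// ltW.
by rewrite -subr_gt0 e.
Qed.

Lemma increments_indep (A : nat -> set R) : (forall i, measurable (A i)) ->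
  forall j, (j < N)%N ->
  P (\bigcap_(i in [set i | (j <= i < N)%N]) (W i @^-1` A i)) =
  (P (W j @^-1` A j) * P (\bigcap_(i in [set i | (j.+1 <= i < N)%N]) (W i @^-1` A i)))%E.
Proof.
move=> mA j jN.
have t0 : 0 <= 0%:R * h by rewrite mul0r.
have tle i : i%:R * h <= i.+1%:R * h by rewrite ler_wpM2r ?ler_nat// ltW.
have ind := @brownian_increments _ _ _ _ _ _ HB N (fun i => i%:R * h) t0 tle.
have key l : P (\bigcap_(i in [set i | (l <= i < N)%N]) (W i @^-1` A i)) =
    (\prod_(i < N | (l <= i)%N) P (W i @^-1` A i))%E.
  have := ind [set i : 'I_N | (l <= i)%N]%SET (fun i => W i @^-1` A i) _.
  have h1 i : i \in [set i : 'I_N | (l <= i)%N]%SET ->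
    preimage_set_system [set: T] (fun w : T => B (i.+1%:R * h) w - B (i%:R * h) w) measurable (W i @^-1` A i).
    by move=> _; exists (A i) => //; rewrite setTI.
  move=> /(_ h1) => e; rewrite -[LHS]/(P _); transitivity (P (\bigcap_(i in [set` [set i : 'I_N | (l <= i)%N]%SET]) (W i @^-1` A i))).
    congr (P _); apply/seteqP; split => w Hw i /=.
      by rewrite inE => li; apply: Hw; rewrite /= li ltn_ord.
    move=> /andP[li iN]; apply: (Hw (Ordinal iN)); by rewrite /= inE.
  by rewrite e; apply: eq_bigl => i; rewrite inE.
rewrite !key (bigD1 (Ordinal jN))//=; congr (_ * _)%E.
by apply: eq_bigl => i; rewrite ltn_neqAle andbC eq_sym.
Qed.

End brownian_grid.

Section half_line_path.
Context {R : realType}.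

(** Extends a path to negative times by its initial value, so that continuity on
    the half line becomes continuity. *)
Definition extend (V : Type) (y : R -> V) (t : R) : V := y (Num.max t 0).

Lemma extendE (V : Type) (y : R -> V) t : 0 <= t -> extend y t = y t.
Proof. by move=> t0; rewrite /extend max_l. Qed.

Lemma continuous_extend (V : topologicalType) (y : R -> V) :
  {within `[0, +oo[, continuous y} -> continuous (extend y).
Proof.
move=> /subspace_continuousP cy x.
have x0 : `[0, +oo[%classic (Num.max x 0) by rewrite /= in_itv/= andbT le_max lexx orbT.
apply: (@cvg_comp _ _ _ (fun t => Num.max t 0) y _ _ _ _ (cy _ x0)) => U /= HU.
have cm : {for x, continuous (fun t : R => Num.max t 0)}.
  by apply: (@continuous_max _ _ (fun t : R => t) (fun=> 0)) => //; exact: cvg_cst.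
have : nbhs x (fun t => `[0, +oo[%classic (Num.max t 0) -> U (Num.max t 0)) := cm _ HU.
by apply: filterS => t; apply; rewrite /= in_itv/= andbT le_max lexx orbT.
Qed.

Variable y : R -> R.
Hypothesis cy : {within `[0, +oo[, continuous y}.

(** Rational times approaching [r] from below, so that they do not exceed [t]. *)
Lemma rational_times (c t : R) :
  (forall i j : nat, i%:R / j.+1%:R <= t -> c <= y (i%:R / j.+1%:R)) ->
  forall r, 0 <= r <= t -> c <= y r.
Proof.
move=> H r /andP[r0 rt]; rewrite leNgt; apply/negP => yc.
have := @continuous_extend _ y cy r => /cvgrPdist_lt/(_ (c - y r)).
rewrite subr_gt0 => /(_ yc) /nbhs_ballP[d /= d0 hd].
pose j := Num.truncn d^-1; pose i := Num.truncn (r * j.+1%:R).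
have j0 : (0 : R) < j.+1%:R by rewrite ltr0n.
have jd : j.+1%:R^-1 < d by rewrite invf_plt ?posrE// truncnS_gt.
have /andP[i1 i2] : i%:R <= r * j.+1%:R < i.+1%:R by apply: truncn_itv; rewrite mulr_ge0// ltW.
have i3 : i%:R / j.+1%:R <= r by rewrite ler_pdivrMr.
have i4 : r - i%:R / j.+1%:R < d.
  apply: le_lt_trans jd; rewrite lerBlDl -[X in _ + X]mul1r -mulrDl ler_pdivlMr//.
  by rewrite natr1 ltW.
have /hd /= : ball r d (i%:R / j.+1%:R).
  by rewrite /ball/= ger0_norm ?subr_ge0.
rewrite !extendE ?divr_ge0//.
have := H i j (le_trans i3 rt) => h; rewrite ltr_norml opprB => /andP[]; lra.
Qed.

Lemma alive_lower t : 0 <= t -> (forall r, 0 <= r <= t -> 0 < y r) ->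
  exists m : nat, forall r, 0 <= r <= t -> m.+1%:R^-1 <= y r.
Proof.
move=> t0 H.
have cc : {within `[0, t], continuous (extend y)}.
  by apply: continuous_subspaceT; exact: continuous_extend.
have [c /[!in_itv]/= ct hc] := EVT_min t0 cc.
have c0 : 0 <= c by case/andP: ct.
have yc := H c ct; exists (Num.truncn (y c)^-1) => r rt.
have := hc r; rewrite in_itv/= => /(_ rt); rewrite !extendE//; last by case/andP: rt.
apply: le_trans; rewrite invf_ple ?posrE ?ltr0n//.
by rewrite ltW// truncnS_gt.
Qed.

Lemma hitting_time_gt (A : set R) t : A `<=` [set x | x <= 0] -> 0 <= t ->
  (forall r, 0 <= r <= t -> 0 < y r) -> (t%:E < hitting_time A y)%E.
Proof.
move=> A0 t0 H.
have yt : 0 < y t by apply: H; rewrite t0 lexx.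
have := @continuous_extend _ y cy t => /cvgrPdist_lt/(_ (y t) yt) /nbhs_ballP[d /= d0 hd].
apply: (@lt_le_trans _ _ (t + d)%:E); first by rewrite lte_fin ltrDl.
apply: le_ereal_inf_tmp => _ [r [r0 Ar] <-]; rewrite lee_fin leNgt; apply/negP => rd.
have yr : y r <= 0 := A0 _ Ar.
have [rt|tr] := leP r t; first by have := H r; rewrite (ltW r0) rt => /(_ isT); lra.
have /hd /= : ball t d r by rewrite /ball/= ltr0_norm ?subr_lt0//; lra.
rewrite !extendE ?(ltW r0)// => /ltr_normlW; lra.
Qed.

Lemma lt_hitting_time (A : set R) t : [set x | x <= 0] `<=` A -> 0 < y 0 ->
  (t%:E < hitting_time A y)%E -> forall r, 0 <= r <= t -> 0 < y r.
Proof.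
move=> A0 y0 tH r /andP[]; rewrite le_eqVlt => /predU1P[<-//|r0 rt].
rewrite ltNge; apply/negP => yr.
have : (hitting_time A y <= r%:E)%E by apply: ereal_inf_lbound; exists r => //; split => //; exact: A0.
by move=> /(lt_le_trans tH); rewrite lte_fin ltNge rt.
Qed.

End half_line_path.

Section bounded_limits.
Context (R : realType) (d : measure_display) (T : measurableType d).
Variable P : probability T R.

Lemma bounded_cvg_mean (f_ : nat -> T -> R) (f : T -> R) (M : R) :
  (forall n, measurable_fun setT (f_ n)) -> measurable_fun setT f ->
  (forall n t, `|f_ n t| <= M) ->
  {ae P, forall t, f_ n t @[n --> \oo] --> f t} ->
  \int[P]_t f_ n t @[n --> \oo] --> \int[P]_t f t.
Proof.
move=> mf_ mf fM ff.
have [] := @dominated_convergence _ _ _ P setT measurableT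
  (fun n t => (f_ n t)%:E) (fun t => (f t)%:E) (cst M%:E).
- by move=> n; exact/measurable_EFinP.
- exact/measurable_EFinP.
- by apply: filterS ff => t ft _; apply: cvg_EFin; [exact: nearW|exact: ft].
- exact: finite_measure_integrable_cst.
- by apply: aeW => t n _ /=; rewrite lee_fin.
move=> fi _ h; apply: fine_cvg; rewrite fineK//.
exact: integrable_fin_num.
Qed.

Lemma mean_indic (A : set T) : measurable A -> \int[P]_t (\1_A t : R) = fine (P A).
Proof. by move=> mA; rewrite /Rintegral integral_indic// setIT. Qed.

End bounded_limits.

Lemma gamma_cdf_cvg0 (R : realType) (a : R) (a0 : 0 < a) (v : nat -> R) :
  (forall m, 0 < v m) -> v m @[m --> \oo] --> 0 ->
  gamma_cdf a (v m) @[m --> \oo] --> 0.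
Proof.
move=> v0 cv; have cp : v m `^ a @[m --> \oo] --> (0 : R).
  by have /cvg_at_rightP := powR_cvg0 a0; apply.
apply: (squeeze_cvgr _ (cvg_cst 0) (_ : v m `^ a / a / Gamma a @[m --> \oo] --> 0)).
  by apply: nearW => m; rewrite gamma_cdf_ge0//= gamma_cdf_le.
rewrite -[X in _ --> X](mul0r (a^-1 / Gamma a)); under eq_fun do rewrite -mulrA.
exact: cvgMr_tmp.
Qed.

Lemma survival_cvg_time (R : realType) (s y tau : R) (h : nat -> R) :
  0 < s -> 0 < y -> 0 < tau -> h m @[m --> \oo] --> 0 ->
  survival s (h m + tau) y @[m --> \oo] --> survival s tau y.
Proof.
move=> s0 y0 tau0 h0; under eq_fun do rewrite survival_pos//; rewrite survival_pos//.
have v0 : 0 < y ^+ 2 / (2 * tau) by rewrite divr_gt0 ?exprn_gt0 ?mulr_gt0.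
apply: (continuous_cvg _ (der_cts (der_gamma_cdf s0 v0))).
apply: cvgMl_tmp; apply: cvgV; first by rewrite gt_eqF ?mulr_gt0.
apply: cvgMl_tmp; rewrite -[X in _ --> X]add0r; apply: cvgD => //; exact: cvg_cst.
Qed.

Section generated_events.
Context (R : realType) (d : measure_display) (T : measurableType d).
Context (d' : measure_display) (S : measurableType d').
Variable X : R -> T -> S.

Lemma sigma_process_measurable : (forall t, 0 <= t -> measurable_fun setT (X t)) ->
  sigma_process X `<=` measurable.
Proof.
move=> mX; apply: smallest_sub; first exact: sigma_algebra_measurable.
by move=> A [t t0 [B mB <-]]; exact: mX.
Qed.

Lemma sigma_process_preimage t A : 0 <= t -> measurable A -> sigma_process X (X t @^-1` A).
Proof.
by move=> t0 mA; apply: sub_sigma_algebra; exists t => //; exists A => //; rewrite setTI.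
Qed.

Lemma sigma_process_bigcap (F : nat -> set T) : (forall i, sigma_process X (F i)) ->
  sigma_process X (\bigcap_i F i).
Proof.
move=> sF; rewrite -(setCK (\bigcap_i _)) setC_bigcap; apply: sigma_algebraC.
by apply: sigma_algebra_bigcup => i; apply: sigma_algebraC; exact: sF.
Qed.

End generated_events.

Section bessel_law.
Context (R : realType) (d : measure_display) (Om : measurableType d).
Variable P : probability Om R.
Variables (s y0 : R) (B Y : R -> Om -> R).
Hypotheses (s0 : 0 < s) (s1 : s < 1) (y0_gt0 : 0 < y0).
Hypothesis HY : bessel P s y0 B Y.

(** Rational times make this an event generated by [Y]; by continuity it says that
    the path is at least [c] on the whole segment. *)
Definition above (c t : R) : set Om :=
  \bigcap_i \bigcap_j [set w | i%:R / j.+1%:R <= t -> c <= Y (i%:R / j.+1%:R) w].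

(** Up to a null set, the path has not reached 0 at time [t] (see [alive_atP]): a
    positive continuous function on a segment is bounded away from 0. *)
Definition alive_at (t : R) : set Om := \bigcup_m above m.+1%:R^-1 t.

Lemma sigma_above c t : sigma_process Y (above c t).
Proof.
apply: sigma_process_bigcap => i; apply: sigma_process_bigcap => j.
have [ij|_] := leP (i%:R / j.+1%:R) t; last first.
  rewrite [X in sigma_process _ X](_ : _ = setT); last by apply/seteqP; split.
  by rewrite -setC0; apply: sigma_algebraC; exact: sigma_algebra0.
rewrite [X in sigma_process _ X](_ : _ = Y (i%:R / j.+1%:R) @^-1` `[c, +oo[).
  by apply: sigma_process_preimage => //; rewrite divr_ge0.
by apply/seteqP; split => w /=; rewrite in_itv/= andbT; [apply|].
Qed.

Lemma sigma_alive_at t : sigma_process Y (alive_at t).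
Proof. by apply: sigma_algebra_bigcup => m; exact: sigma_above. Qed.

Let sub_meas := sigma_process_measurable (bessel_measurable HY).

Lemma measurable_above c t : measurable (above c t).
Proof. by apply: sub_meas; exact: sigma_above. Qed.

Lemma measurable_alive_at t : measurable (alive_at t).
Proof. by apply: sub_meas; exact: sigma_alive_at. Qed.

Definition good_path (w : Om) : Prop :=
  [/\ Y 0 w = y0, {within `[0, +oo[, continuous (Y ^~ w)} &
   forall t : R, 0 <= t ->
    (t%:E < hitting_time [set 0%R] (Y ^~ w))%E ->
    Y t w = (y0 + \int[lebesgue_measure]_(r in `[0, t])
                    ((1 - 2 * s) / (2 * Y r w)) + B t w)%R].

Lemma ae_good_path : {ae P, forall w, good_path w}.
Proof.
by apply: filterS3 (bessel_start HY) (bessel_continuous HY) (bessel_sde HY) => w.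
Qed.

Lemma above_path w c t : good_path w -> above c t w ->
  forall r, 0 <= r <= t -> c <= Y r w.
Proof.
by move=> [_ cY _] A; apply: (rational_times cY) => i j; exact: A.
Qed.

Lemma alive_atP w t : good_path w -> 0 <= t ->
  alive_at t w <-> (forall r, 0 <= r <= t -> 0 < Y r w).
Proof.
move=> Gw t0; have [_ cY _] := Gw; split.
  move=> [m _ Am] r rt; apply: lt_le_trans (above_path Gw Am rt).
  by rewrite invr_gt0.
move=> /(alive_lower cY t0)[m hm]; exists m => // i _ j _ /= ij.
by apply: hm; rewrite ij andbT divr_ge0.
Qed.

Lemma good_path_sde w : good_path w ->
  forall t, 0 <= t -> (forall r, 0 <= r <= t -> 0 < extend (Y ^~ w) r) ->
  extend (Y ^~ w) t = y0 + \int[lebesgue_measure]_(r in `[0, t])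
    ((1 - 2 * s) / (2 * extend (Y ^~ w) r)) + B t w.
Proof.
move=> [_ cY sde] t t0 pos; rewrite extendE// sde//.
  congr (_ + _ + _); apply: eq_Rintegral => r; rewrite inE/= in_itv/= => /andP[r0 _].
  by rewrite extendE.
apply: hitting_time_gt => //; first by move=> x /= ->; rewrite lexx.
by move=> r /[dup] /andP[r0 _] /pos; rewrite extendE.
Qed.

Section grid.
Variables (tau eps eta : R).
Hypotheses (tau0 : 0 < tau) (eps0 : 0 < eps) (eta0 : 0 < eta) (epsy : eps < y0).

Let W (N k : nat) (w : Om) := grid_increments (B ^~ w) tau N.+1 k.
Let alv (N : nat) (w : Om) : bool :=
  eps < euler s y0 eps (tau / N.+1%:R) (W N ^~ w) N.+1.
Let alive (N : nat) (w : Om) : R := (alv N w)%:R.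
Let Fe := survival s eta eps.
Let S := survival s (eta + tau) y0.

Let h0 N : 0 < tau / N.+1%:R. Proof. by rewrite divr_gt0. Qed.

Let mW N k : measurable_fun setT (W N k).
Proof. exact: (measurable_increment (bessel_driver HY) (h0 N) k). Qed.

Let malive N : measurable_fun setT (alive N).
Proof.
have mV := measurable_euler s y0 (tau / N.+1%:R) (ltW eps0) (mW N) N.+1.
have mb : measurable_fun setT (alv N) by apply: measurable_fun_ltr.
by rewrite /alive; apply: (measurableT_comp (f := fun b : bool => b%:R : R)).
Qed.

Let alive01 N w : 0 <= alive N w <= 1.
Proof. by rewrite /alive; case: (alv N w); rewrite /= ?lexx ?ler01. Qed.

(** The total error of the [N + 1] steps is [C * tau * sg], where [sg] is the
    square root of the step. *)
Let grid_bound : exists2 C, 0 <= C & forall N, (Num.truncn tau < N)%N ->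
  let r := C * Num.sqrt (tau / N.+1%:R) in
  Fe * \int[P]_w alive N w <= S + r /\ S <= \int[P]_w alive N w + r + Fe.
Proof.
have e20 : 0 < eps / 2 by rewrite divr_gt0.
have [C C0 hC] := @survival_step _ s s0 s1 (eps / 2) eta (eta + tau) e20 eta0 ltac:(by rewrite lerDl ltW).
exists (C * tau); first by rewrite mulr_ge0// ltW.
move=> N tN r.
set sg := Num.sqrt (tau / N.+1%:R).
have sg2 : sg ^+ 2 = tau / N.+1%:R by rewrite sqr_sqrtr// ltW.
have sg0 : 0 < sg by rewrite sqrtr_gt0.
have sg1 : sg <= 1.
  rewrite -sqrtr1 ler_wsqrtr// ler_pdivrMr// mul1r.
  apply: ltW; apply: lt_le_trans (truncnS_gt _) _.
  by rewrite ler_nat; apply: leq_trans tN _.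
have NT : N.+1%:R * (tau / N.+1%:R) = tau by rewrite mulrC divfK.
have lawW i A : (i < N.+1)%N -> measurable A -> P (W N i @^-1` A) = normal_prob 0 sg A.
  by move=> _ mA; exact: (increment_law (bessel_driver HY) (h0 N) i mA).
have indW A : (forall i, measurable (A i)) -> forall j, (j < N.+1)%N ->
    P (\bigcap_(i in [set i | (j <= i < N.+1)%N]) (W N i @^-1` A i)) =
    (P (W N j @^-1` A j) * P (\bigcap_(i in [set i | (j.+1 <= i < N.+1)%N]) (W N i @^-1` A i)))%E.
  by move=> mA j jN; exact: (increments_indep (bessel_driver HY) (h0 N) mA jN).
have st k x : (k < N.+1)%N -> eps < x ->
   `|\int[normal_prob 0 sg]_w survival s (eta + (N.+1 - k.+1)%:R * sg ^+ 2)
        (x + (1 - 2 * s) / (2 * x) * sg ^+ 2 + w)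
    - survival s (eta + (N.+1 - k)%:R * sg ^+ 2) x| <= C * sg ^+ 3.
  move=> kN ex; have thE : (N.+1 - k)%:R * sg ^+ 2 = (N.+1 - k.+1)%:R * sg ^+ 2 + sg ^+ 2.
    by rewrite -[in LHS](subnSK kN) -natr1 mulrDl mul1r.
  rewrite thE addrA; apply: hC => //.
  - by rewrite lerDl mulr_ge0// exprn_ge0// ltW.
  - rewrite -addrA -thE lerD2l -[leRHS]NT -sg2.
    by rewrite ler_wpM2r ?ler_nat ?leq_subr// exprn_ge0// ltW.
  - by rewrite mulrC divfK// ltW.
have indV := euler_indep s y0 (sg ^+ 2) (ltW eps0) (mW N) indW.
have := euler_alive_prob s0 eps0 sg0 C0 (mW N) lawW eta0 indV st epsy.
rewrite subn0 sg2 NT.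
have -> : N.+1%:R * (C * sg ^+ 3) = r.
  by rewrite /r -/sg exprS sg2 mulrCA (mulrCA N.+1%:R) NT; ring.
exact.
Qed.

Let mesh0 (C : R) : C * Num.sqrt (tau / N.+1%:R) @[N --> \oo] --> (0 : R).
Proof.
rewrite -[X in _ --> X](mulr0 C); apply: cvgMl_tmp.
rewrite -[X in _ --> X](sqrtr0 R).
apply: (cvg_comp (fun N : nat => tau / N.+1%:R) Num.sqrt); last exact: sqrt_continuous.
have := @cvgMl_tmp _ _ _ _ harmonic tau 0 cvg_harmonic; rewrite mulr0; exact.
Qed.


Let survives w : good_path w -> above (2 * eps) tau w ->
  exists N0, forall N, (N0 <= N)%N -> alive N w = 1.
Proof.
move=> Gw Aw; have [Y0w cY _] := Gw.
have Y0e : extend (Y ^~ w) 0 = y0 by rewrite extendE.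
have Yeps t : 0 <= t <= tau -> 2 * eps <= extend (Y ^~ w) t.
  by move=> tt; rewrite extendE; [exact: (above_path Gw Aw tt)|case/andP: tt].
have s01 : 0 < s < 1 by rewrite s0 s1.
have [N0 hN0] := euler_survives (continuous_extend cY) Y0e (good_path_sde Gw) tau0 eps0 s01 Yeps.
exists N0 => N hN; rewrite /alive /alv hN0//; exact: leqW.
Qed.

Let dies w : good_path w -> ~ alive_at tau w ->
  exists N0, forall N, (N0 <= N)%N -> alive N w = 0.
Proof.
move=> Gw; rewrite (alive_atP Gw (ltW tau0)) => /existsNP[r /not_implyP[rt /negP]].
rewrite -leNgt => Yr; have [Y0w cY _] := Gw.
have Y0e : extend (Y ^~ w) 0 = y0 by rewrite extendE.
have Ye : extend (Y ^~ w) r <= 0 by rewrite extendE//; case/andP: rt.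
have s01 : 0 < s < 1 by rewrite s0 s1.
have [N0 hN0] := euler_dies (continuous_extend cY) Y0e (good_path_sde Gw) tau0 eps0 s01 rt Ye epsy.
exists N0 => N hN; rewrite /alive /alv ltNge hN0//; exact: leqW.
Qed.

Let indic01 (A : set Om) w : 0 <= (\1_A w : R) <= 1.
Proof. by rewrite indicE; case: (_ \in _); rewrite /= ?lexx ?ler01. Qed.

Let prod_bound (A : set Om) N w : `|(\1_A w : R) * alive N w| <= 1.
Proof.
have /andP[a0 a1] := alive01 N w; have /andP[b0 b1] := indic01 A w.
by rewrite ger0_norm ?mulr_ge0// mulr_ile1.
Qed.

Let mprod (A : set Om) N : measurable A -> measurable_fun setT (fun w => (\1_A w : R) * alive N w).
Proof. by move=> mA; apply: measurable_funM. Qed.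

(** On [above (2 * eps) tau] the scheme is eventually alive. *)
Lemma above_prob : Fe * fine (P (above (2 * eps) tau)) <= S.
Proof.
set A := above _ _; have mA : measurable A by exact: measurable_above.
have [C C0 hC] := grid_bound.
have cA : \int[P]_w ((\1_A w : R) * alive N w) @[N --> \oo] --> fine (P A).
  rewrite -mean_indic//; apply: (@bounded_cvg_mean _ _ _ P _ _ 1) => //.
  - by move=> N; exact: mprod.
  apply: filterS ae_good_path => w Gw; have [Aw|Aw] := pselect (A w); last first.
    by rewrite !indicE memNset//=; under eq_fun do rewrite mul0r; exact: cvg_cst.
  have [N0 hN0] := survives Gw Aw.
  apply: cvg_near_cst; exists N0 => // N /= hN; rewrite hN0// mulr1//.
have cL : Fe * \int[P]_w ((\1_A w : R) * alive N w) - C * Num.sqrt (tau / N.+1%:R)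
    @[N --> \oo] --> Fe * fine (P A).
  rewrite -[X in _ --> X]subr0; apply: cvgB => //; exact: cvgMl_tmp.
apply: ler_cvg_to cL (cvg_cst _) _.
exists (Num.truncn tau).+1 => // N /= hN; have [+ _] := hC N hN => /=.
rewrite lerBlDr; apply: le_trans; rewrite ler_wpM2l ?survival_ge0//.
apply: le_Rintegral => //.
- exact: (bounded_integrable P (mprod N mA) (prod_bound A N)).
- apply: (bounded_integrable P (malive N) (M := 1)) => w.
  by have /andP[a0 a1] := alive01 N w; rewrite ger0_norm.
move=> w _; have /andP[a0 a1] := alive01 N w; have /andP[b0 b1] := indic01 A w.
by rewrite ler_piMl.
Qed.

Let arith (a x y z f r : R) : a <= x + r + f -> x <= y + z -> a <= y + r + (z + f).
Proof. lra. Qed.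

(** Off [alive_at tau] the scheme is eventually stopped. *)
Lemma alive_prob : S <= fine (P (alive_at tau)) + Fe.
Proof.
set D := alive_at tau; have mD : measurable D by exact: measurable_alive_at.
have mDc : measurable (~` D) by exact: measurableC.
have [C C0 hC] := grid_bound.
have cA : \int[P]_w ((\1_(~` D) w : R) * alive N w) @[N --> \oo] --> (0 : R).
  rewrite -(mean_cst P 0); apply: (@bounded_cvg_mean _ _ _ P _ _ 1) => //.
  - by move=> N; exact: mprod.
  apply: filterS ae_good_path => w Gw; have [Dw|Dw] := pselect (D w).
    have -> : \1_(~` D) w = 0 :> R by rewrite indicE in_setC mem_set.
    by under eq_fun do rewrite mul0r; exact: cvg_cst.
  have [N0 hN0] := dies Gw Dw.
  by apply: cvg_near_cst; exists N0 => // N /= hN; rewrite hN0// mulr0.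
have cL : \int[P]_w ((\1_(~` D) w : R) * alive N w) + C * Num.sqrt (tau / N.+1%:R)
    + (fine (P D) + Fe) @[N --> \oo] --> fine (P D) + Fe.
  rewrite -[X in _ --> X]add0r; apply: cvgD; last exact: cvg_cst.
  by rewrite -[X in _ --> X]add0r; exact: cvgD.
apply: ler_cvg_to (cvg_cst _) cL _.
exists (Num.truncn tau).+1 => // N /= hN; have [_ +] := hC N hN => /=.
set r := C * _ => h.
have i1 := bounded_integrable P (mprod N mDc) (prod_bound _ N).
have i2 : P.-integrable setT (EFin \o (\1_D : Om -> R)).
  apply: (bounded_integrable P (M := 1)) => // w.
  by have /andP[a0 a1] := indic01 D w; rewrite ger0_norm.
have : \int[P]_w alive N w <= \int[P]_w ((\1_(~` D) w : R) * alive N w) + fine (P D).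
  rewrite -(mean_indic P mD) -RintegralD//; apply: le_Rintegral => //.
  - apply: (bounded_integrable P (malive N) (M := 1)) => w.
    by have /andP[a0 a1] := alive01 N w; rewrite ger0_norm.
  - exact: (integrableD _ i1 i2).
  move=> w _; rewrite !indicE in_setC; have /andP[a0 a1] := alive01 N w.
  by case: (w \in D) => /=; rewrite ?mul0r ?mul1r ?add0r ?addr0.
move=> h'; exact: (arith h h').
Qed.

End grid.

(** [survival s eta eps] must be negligible in [alive_prob] and close to 1 in
    [above_prob]: this dictates how [eta] compares to [eps ^ 2], the natural time
    scale at the level [eps]. *)
Lemma alive_at_prob tau : 0 < tau -> P (alive_at tau) = (survival s tau y0)%:E.
Proof.
move=> tau0; have fP A : measurable A -> P A = (fine (P A))%:E.
  by move=> mA; rewrite fineK// fin_num_measure.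
rewrite fP; last exact: measurable_alive_at.
congr EFin; apply/eqP; rewrite eq_le; apply/andP; split; last first.
  (* [eta = eps = 1 / (m + 1)], so that [eps ^ 2 / (2 eta)] tends to 0 *)
  have hm (m : nat) : (0 : R) < m.+1%:R^-1 by rewrite invr_gt0 ltr0n.
  have h0 : m.+1%:R^-1 @[m --> \oo] --> (0 : R) := cvg_harmonic.
  have h2 : m.+1%:R^-1 / 2 @[m --> \oo] --> (0 : R).
    by rewrite -[X in _ --> X](mul0r 2^-1); exact: cvgMr_tmp.
  have F0 := @gamma_cdf_cvg0 _ s s0 (fun m => m.+1%:R^-1 / 2) (fun m => divr_gt0 (hm m) (ltr0Sn _ 1)) h2.
  have cR : fine (P (alive_at tau)) + gamma_cdf s (m.+1%:R^-1 / 2) @[m --> \oo] -->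
      fine (P (alive_at tau)).
    by rewrite -[X in _ --> X]addr0; apply: cvgD => //; exact: cvg_cst.
  apply: ler_cvg_to (survival_cvg_time s0 y0_gt0 tau0 h0) cR _.
  near=> m; have e0 := hm m.
  have := @alive_prob tau m.+1%:R^-1 m.+1%:R^-1 tau0 e0 e0.
  rewrite [survival _ _ m.+1%:R^-1]survival_pos//.
  have -> : m.+1%:R^-1 ^+ 2 / (2 * m.+1%:R^-1) = m.+1%:R^-1 / 2 :> R by field.
  apply; near: m; move/cvgrPdist_lt : h0 => /(_ y0 y0_gt0); apply: filterS => m /=.
  by rewrite sub0r normrN ger0_norm// invr_ge0.
have cA : fine (P (above m.+1%:R^-1 tau)) @[m --> \oo] --> fine (P (alive_at tau)).
  apply: fine_cvg; rewrite -fP; last exact: measurable_alive_at.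
  apply: (@nondecreasing_cvg_mu _ _ _ P (fun m => above m.+1%:R^-1 tau)).
  - by move=> i; exact: measurable_above.
  - exact: measurable_alive_at.
  - move=> m m' mm'; rewrite subsetEset => w h i _ j _ /= ij.
    apply: le_trans (h i I j I ij); rewrite lef_pV2 ?posrE ?ltr0n//.
    by rewrite ler_nat.
have g1 : gamma_cdf s m.+1%:R @[m --> \oo] --> (1 : R).
  have := gamma_cdf_cvg1 s0; rewrite -(@cvg_shiftS _ (fun k => gamma_cdf s k%:R)); exact.
have cL : gamma_cdf s m.+1%:R * fine (P (above m.+1%:R^-1 tau)) @[m --> \oo] -->
    fine (P (alive_at tau)).
  by rewrite -[X in _ --> X]mul1r; exact: cvgM.
apply: ler_cvg_to cL (cvg_cst _) _; near=> m.
(* [eta = eps ^ 3], so that [eps ^ 2 / (2 eta) = m + 1] tends to infinity *)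
have epsy : m.+1%:R^-1 / 2 < y0.
  near: m; have h0 : m.+1%:R^-1 @[m --> \oo] --> (0 : R) := cvg_harmonic.
  move/cvgrPdist_lt : h0 => /(_ y0 y0_gt0); apply: filterS => m /=.
  rewrite sub0r normrN ger0_norm ?invr_ge0//; apply: le_lt_trans.
  by rewrite ler_pdivrMr// ler_peMr// ler1n.
pose eps : R := m.+1%:R^-1 / 2.
have e0 : 0 < eps by rewrite divr_gt0// invr_gt0.
have eta0 : 0 < eps ^+ 3 by rewrite exprn_gt0.
have := @above_prob tau eps (eps ^+ 3) tau0 e0 eta0 epsy.
rewrite survival_pos//.
have -> : eps ^+ 2 / (2 * eps ^+ 3) = m.+1%:R by rewrite /eps; field.
have -> : 2 * eps = m.+1%:R^-1 by rewrite /eps mulrC divfK.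
move=> /le_trans; apply; apply: survival_homo => //.
by rewrite lerDr ltW.
Unshelve. all: by end_near. Qed.

End bessel_law.

(** * Gaussian laws on row vectors *)

Section affine_change.
Context {R : realType}.
Notation mu := (@lebesgue_measure R).
Local Open Scope ereal_scope.

(** Lebesgue measure is characterised by its values on intervals. *)
Lemma ge0_integral_affine (a b : R) (f : R -> \bar R) : (0 < a)%R ->
  measurable_fun setT f -> (forall x, 0 <= f x) ->
  \int[mu]_x f x = a%:E * \int[mu]_x f (a * x + b)%R.
Proof.
move=> a0 mf f0; pose phi (x : measurableTypeR R) : measurableTypeR R := (a * x + b)%R.
have mphi : measurable_fun setT phi.
  by apply: measurable_funD => //; exact: measurable_funM.
pose aN := NngNum (ltW a0).
pose nu : {measure set (measurableTypeR R) -> \bar R} :=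
  mscale aN (measure_function_pushforward__canonical__measure_function_Measure mu mphi).
have E A : measurable A -> mu A = nu A.
  apply: lebesgue_measure_unique => _ [[p q] _ <-] /=.
  rewrite /nu/= /mscale/= /pushforward.
  have -> : phi @^-1` `]p, q]%classic = `]((p - b) / a)%R, ((q - b) / a)%R]%classic.
    apply/seteqP; split => x /=; rewrite !in_itv/= /phi ltr_pdivrMr// ler_pdivlMr//;
      by rewrite ltrBlDr lerBrDr (mulrC x).
  rewrite !lebesgue_measure_itv/= !lte_fin ltr_pM2r ?invr_gt0// ltrD2r.
  case: ifP => _; last by rewrite mule0.
  by rewrite -!EFinB -EFinM; congr EFin; field; rewrite gt_eqF.
transitivity (\int[nu]_x f x).
  by apply: eq_measure_integral => A mA _; exact: E.
by rewrite ge0_integral_mscale//= ge0_integral_pushforward.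
Qed.

End affine_change.

Section product_integral.
Context {R : realType}.
Local Open Scope ereal_scope.

(** Tonelli's theorem, one coordinate at a time. *)
Lemma ge0_integral_prod n (f : 'I_n -> R -> R) :
  (forall i, measurable_fun setT (f i)) -> (forall i x, (0 <= f i x)%R) ->
  \int[lebesgue_rV R n]_x (\prod_(i < n) f i (x ord0 i))%:E =
  \prod_(i < n) \int[lebesgue_measure]_x (f i x)%:E.
Proof.
elim: n f => [|n IH] f mf f0.
  rewrite big_ord0 /=; under eq_integral do rewrite big_ord0.
  by rewrite integral_cst// mul1e/= diracT.
pose F (x : 'rV[R]_n.+1) := (\prod_(i < n.+1) f i (x ord0 i))%:E.
have mF : measurable_fun setT F.
  apply/measurable_EFinP; apply: measurable_prod => i _.
  exact: measurableT_comp (mf i) (measurable_rV_coor i).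
have F0 x : 0 <= F x by rewrite lee_fin prodr_ge0.
pose mm : {measure set (measurableTypeR R * 'rV[R]_n)%type -> \bar R} :=
  product_measure1 (@lebesgue_measure R) (lebesgue_rV R n).
have mc : measurable_fun [set: measurableTypeR R * 'rV[R]_n] (@rV_cons R n) := @measurable_rV_cons R n.
rewrite -[LHS]/(\int[pushforward mm (@rV_cons R n)]_x F x).
rewrite ge0_integral_pushforward//= preimage_setT.
have mFc : measurable_fun [set: measurableTypeR R * 'rV[R]_n] (F \o @rV_cons R n).
  exact: measurableT_comp mF mc.
rewrite fubini_tonelli1//.
have FE x v : F (rV_cons (x, v)) =
    (f ord0 x)%:E * (\prod_(i < n) f (lift ord0 i) (v ord0 i))%:E.
  rewrite /F /= -EFinM big_ord_recl; congr (_ * _)%:E; first by rewrite mxE unlift_none.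
  by apply: eq_bigr => i _; rewrite mxE liftK.
have mg : measurable_fun setT (fun v : 'rV[R]_n => (\prod_(i < n) f (lift ord0 i) (v ord0 i))%:E).
  apply/measurable_EFinP; apply: measurable_prod => i _.
  exact: measurableT_comp (mf _) (measurable_rV_coor i).
have g0 (v : 'rV[R]_n) : 0 <= (\prod_(i < n) f (lift ord0 i) (v ord0 i))%:E.
  by rewrite lee_fin prodr_ge0.
rewrite /fubini_F; under eq_integral => x _.
  under eq_integral do rewrite FE.
  rewrite ge0_integralZl//; last by rewrite lee_fin.
  rewrite (IH (fun i => f (lift ord0 i)))//.
  over.
rewrite ge0_integralZr//.
- by rewrite big_ord_recl.
- have mfE : measurable_fun [set: R] (fun x => (f ord0 x)%:E) by exact/measurable_EFinP.
  exact: mfE.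
- by move=> x _; rewrite lee_fin.
- by apply: prode_ge0 => i _; apply: integral_ge0 => x _; rewrite lee_fin.
Qed.

End product_integral.

Section continuous_measurable.
Context {R : realType}.

Lemma cvg_rV n (I : Type) (F : set_system I) (FF : Filter F) (f : I -> 'rV[R]_n) (l : 'rV[R]_n) :
  (forall i, f x ord0 i @[x --> F] --> l ord0 i) -> f @ F --> l.
Proof.
move=> fl; apply/cvg_ballP => e e0.
have H i : \forall x \near F, ball (l ord0 i) e (f x ord0 i).
  by have /cvg_ballP/(_ e e0) := fl i.
have {}H : \forall x \near F, forall i : 'I_n, ball (l ord0 i) e (f x ord0 i) by exact: filter_forall.
apply: filterS H => x Hx; split=> // i j; rewrite ord1; exact: Hx.
Qed.

(** The sigma-algebra is generated by the coordinates and is not defined as the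
    Borel one: [u] is the limit of the functions [u (p k (q k v))], where [q k] rounds
    the coordinates down to multiples of [1 / (k + 1)] and takes countably many
    values. *)
Lemma continuous_measurable_rV n (u : 'rV[R]_n -> R) : continuous u -> measurable_fun setT u.
Proof.
move=> cu.
pose q (k : nat) (v : 'rV[R]_n) : 'rV[int]_n := \row_i Num.floor (v ord0 i * k.+1%:R).
pose p (k : nat) (z : 'rV[int]_n) : 'rV[R]_n := \row_i ((z ord0 i)%:~R / k.+1%:R).
apply: (@measurable_fun_cvg _ _ _ setT (fun k v => u (p k (q k v)))); last first.
  move=> v _; apply: (continuous_cvg _ (cu v)); apply: cvg_rV => i.
  under eq_fun do rewrite !mxE.
  apply: (@squeeze_cvgr _ _ _ _ (fun k : nat => v ord0 i - k.+1%:R^-1) (fun=> v ord0 i)).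
  - apply: nearW => k; have k0 : (0 : R) < k.+1%:R by rewrite ltr0n.
    rewrite ler_pdivlMr// ler_pdivrMr// mulrBl mulVf ?gt_eqF//.
    by rewrite floor_le andbT lerBlDr ltW// -[1]/(1%:~R) -intrD floorD1_gt.
  - rewrite -[X in _ --> X]subr0; apply: cvgB; first exact: cvg_cst.
    exact: cvg_harmonic.
  - exact: cvg_cst.
move=> k _ A mA; rewrite setTI.
have -> : (fun v => u (p k (q k v))) @^-1` A =
    \bigcup_z (if u (p k z) \in A then [set v | q k v = z] else set0).
  apply/seteqP; split => [v /= Av|v [z _]].
    by exists (q k v) => //; rewrite mem_set.
  by case: ifPn => // /set_mem Az /= ->.
apply: countable_bigcupT_measurable; first exact: countableP.
move=> z; case: ifP => // _.
have -> : [set v | q k v = z] = \big[setI/setT]_(i < n)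
    ((fun v : 'rV[R]_n => v ord0 i) @^-1` [set x | Num.floor (x * k.+1%:R) = z ord0 i]).
  rewrite -bigcap_seq; apply/seteqP; split => v /=.
    by move=> <- i _ /=; rewrite mxE.
  by move=> H; apply/rowP => i; rewrite mxE; apply: H; rewrite /= mem_index_enum.
apply: bigsetI_measurable => i _; rewrite -[X in measurable X]setTI.
apply: measurable_rV_coor => //.
have k0 : (0 : R) < k.+1%:R by rewrite ltr0n.
rewrite (_ : [set x | _] = `[(z ord0 i)%:~R / k.+1%:R, (z ord0 i + 1)%:~R / k.+1%:R[%classic).
  exact: measurable_itv.
apply/seteqP; split => x /=; rewrite in_itv/= ler_pdivrMr// ltr_pdivlMr//.
  by move=> <-; rewrite floor_le floorD1_gt.
by move=> h; apply: floor_def.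
Qed.

End continuous_measurable.

Section density_measure.
Context (d : measure_display) (T : measurableType d) (R : realType).
Variables (mu : {measure set T -> \bar R}) (f : T -> R).
Hypotheses (mf : measurable_fun [set: T] f) (f0 : forall x, 0 <= f x).

(** The two proofs are arguments, so that the measure structure can be inferred. *)
Definition density_measure (_ : measurable_fun [set: T] f) (_ : forall x, 0 <= f x)
  (A : set T) : \bar R := (\int[mu]_(x in A) (f x)%:E)%E.

Let nu := density_measure mf f0.

Let nu0 : nu set0 = 0%E. Proof. exact: integral_set0. Qed.

Let nu_ge0 A : (0 <= nu A)%E.
Proof. by apply: integral_ge0 => x _; rewrite lee_fin. Qed.

Let nu_sigma_additive : semi_sigma_additive nu.
Proof.
move=> A mA tA mUA; rewrite /nu /density_measure ge0_integral_bigcup//.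
- by apply: is_cvg_ereal_nneg_natsum_cond => n _ _; exact: nu_ge0.
- by apply/measurable_EFinP; exact: measurable_funTS.
- by move=> x _; rewrite lee_fin.
Qed.

HB.instance Definition _ := isMeasure.Build _ _ _ nu nu0 nu_ge0 nu_sigma_additive.

End density_measure.

Section gauss_law.
Context {R : realType}.

Lemma normal_prob_shift (m sg : R) (A : set R) : measurable A -> sg != 0 ->
  normal_prob 0 sg ((fun x => x + m) @^-1` A) = normal_prob m sg A.
Proof.
move=> mA sg0; rewrite /normal_prob.
have mh : measurable_fun [set: R] (fun x : R => x + m) by apply: measurable_funD.
rewrite integral_mkcond [RHS]integral_mkcond.
rewrite [RHS](@ge0_integral_affine _ 1 m)//; last 2 first.
- apply/(measurable_restrictT _ _).1 => //.
  by apply/measurable_EFinP; apply: measurable_funTS; exact: measurable_normal_pdf.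
- by move=> x; rewrite /patch; case: ifP => // _; rewrite lee_fin normal_pdf_ge0.
rewrite mul1e; apply: eq_integral => x _; rewrite mul1r /patch /=.
rewrite /in_mem/= /in_set/=.
by case: ifP => // _; rewrite !normal_pdfE// (normal_fun_center m)/= addrK.
Qed.

Definition gauss_rV n (m : 'rV[R]_n) (sg : R) (x : 'rV[R]_n) : R :=
  \prod_(i < n) normal_pdf (m ord0 i) sg (x ord0 i).

Lemma measurable_gauss_rV n (m : 'rV[R]_n) sg : measurable_fun setT (gauss_rV m sg).
Proof.
apply: measurable_prod => i _.
exact: measurableT_comp (measurable_normal_pdf _ _) (measurable_rV_coor i).
Qed.

Lemma gauss_rV_ge0 n (m : 'rV[R]_n) sg x : 0 <= gauss_rV m sg x.
Proof. by apply: prodr_ge0 => i _; exact: normal_pdf_ge0. Qed.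

Definition box n (A : 'I_n -> set R) : set 'rV[R]_n := [set v | forall i, A i (v ord0 i)].

Definition boxes n : set (set 'rV[R]_n) :=
  [set B | exists2 A : 'I_n -> set R, (forall i, measurable (A i)) & B = box A].

Lemma boxE n (A : 'I_n -> set R) :
  box A = \big[setI/setT]_(i < n) ((fun v : 'rV[R]_n => v ord0 i) @^-1` A i).
Proof.
rewrite -bigcap_seq; apply/seteqP; split => v /=; first by move=> Av i _; exact: Av.
by move=> Av i; apply: Av; rewrite /= mem_index_enum.
Qed.

Lemma measurable_box n (A : 'I_n -> set R) : (forall i, measurable (A i)) -> measurable (box A).
Proof.
move=> mA; rewrite boxE; apply: bigsetI_measurable => i _; rewrite -[X in measurable X]setTI.
exact: measurable_rV_coor.
Qed.

Lemma measurable_boxes n : @measurable _ 'rV[R]_n = <<s @boxes n >>.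
Proof.
apply/seteqP; split; apply: smallest_sub.
- exact: smallest_sigma_algebra.
- rewrite -bigcup_seq => _ [i _ [B mB <-]]; apply: sub_sigma_algebra.
  exists (fun j => if j == i then B else setT); first by move=> j; case: ifP.
  rewrite setTI; apply/seteqP; split => v /=; last by move=> /(_ i); rewrite eqxx.
  by move=> Bv j; case: eqP => // ->.
- exact: sigma_algebra_measurable.
- by move=> _ [A mA ->]; exact: measurable_box.
Qed.

Lemma gauss_rV_box n (m : 'rV[R]_n) sg (A : 'I_n -> set R) : (forall i, measurable (A i)) ->
  (\int[lebesgue_rV R n]_(x in box A) (gauss_rV m sg x)%:E =
   \prod_(i < n) normal_prob (m ord0 i) sg (A i))%E.
Proof.
move=> mA; pose f i x := normal_pdf (m ord0 i) sg x * \1_(A i) x.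
have mf i : measurable_fun setT (f i).
  by apply: measurable_funM; [exact: measurable_normal_pdf|exact: measurable_indic].
have f0 i x : 0 <= f i x by rewrite mulr_ge0// normal_pdf_ge0.
rewrite integral_mkcond; transitivity (\int[lebesgue_rV R n]_x (\prod_(i < n) f i (x ord0 i))%:E)%E.
  apply: eq_integral => x _; rewrite /patch; case: ifPn => [/set_mem Ax|Ax].
    by congr EFin; apply: eq_bigr => i _; rewrite /f indicE mem_set ?mulr1//; exact: Ax.
  have [i Ai] : exists i, ~ A i (x ord0 i).
    by apply/existsNP => H; move/negP: Ax; apply; exact/mem_set.
  by rewrite (bigD1 i)//= /f indicE memNset// mulr0 mul0r.
rewrite ge0_integral_prod//; apply: eq_bigr => i _.
rewrite /normal_prob [RHS]integral_mkcond; apply: eq_integral => x _.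
by rewrite /patch /f indicE; case: ifP; rewrite ?mulr1 ?mulr0.
Qed.

Variables (d : measure_display) (T : measurableType d) (P : probability T R).
Variables (n : nat) (m : 'rV[R]_n) (sg : R) (Z : T -> 'rV[R]_n).
Hypothesis mZ : measurable_fun setT Z.
Hypothesis lawZ : forall A : 'I_n -> set R, (forall i, measurable (A i)) ->
  P (Z @^-1` box A) = (\prod_(i < n) normal_prob (m ord0 i) sg (A i))%E.

(** Boxes are stable under intersection and generate the sigma-algebra. *)
Lemma gauss_law A : measurable A ->
  P (Z @^-1` A) = (\int[lebesgue_rV R n]_(x in A) (gauss_rV m sg x)%:E)%E.
Proof.
move=> mA.
pose nu := density_measure (lebesgue_rV R n) (measurable_gauss_rV m sg) (gauss_rV_ge0 m sg).
pose pZ : {measure set 'rV[R]_n -> \bar R} :=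
  measure_function_pushforward__canonical__measure_function_Measure P mZ.
apply: (@measure_unique _ R 'rV[R]_n (@boxes n) (fun=> setT) _ _ _ _ pZ nu) => //.
- exact: measurable_boxes.
- move=> _ _ [A1 mA1 ->] [A2 mA2 ->]; exists (fun i => A1 i `&` A2 i).
    by move=> i; exact: measurableI.
  by apply/seteqP; split => [v [h1 h2] i|v h]; [split|split => i; have [] := h i].
- by move=> _; exists (fun=> setT) => //; apply/seteqP; split.
- by rewrite bigcup_const//; exists 0%N.
- by move=> _ [A1 mA1 ->]; rewrite /pZ/= /pushforward lawZ// -gauss_rV_box.
- by move=> _; rewrite /pZ /= /pushforward preimage_setT; have := @probability_setT _ _ _ P => /= ->; rewrite ltry.
Qed.

Lemma gauss_mean_rV (g : 'rV[R]_n -> \bar R) : measurable_fun setT g ->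
  P.-integrable setT (g \o Z) ->
  (\int[P]_w g (Z w) = \int[lebesgue_rV R n]_x (g x * (gauss_rV m sg x)%:E))%E.
Proof.
move=> mg gi.
pose pZ : {measure set 'rV[R]_n -> \bar R} :=
  measure_function_pushforward__canonical__measure_function_Measure P mZ.
rewrite -(@integral_density _ _ _ (lebesgue_rV R n) pZ _ (measurable_gauss_rV m sg) (gauss_rV_ge0 m sg) gauss_law)//.
by rewrite /pZ/= integral_pushforward.
Qed.

End gauss_law.

(** * Discretisation of the exit time *)

Section time_grid.
Context {R : realType}.

Definition grid (m k : nat) : R := k%:R / m.+1%:R.

(** The value of [phi] at the first point of the grid of mesh [1 / (m + 1)] that
    is not before [r], truncated so that the sum is finite. *)
Definition grid_value (m : nat) (phi : R -> R) (r : R) : R :=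
  \sum_(1 <= k < (m.+1 ^ 2)%N | grid m k < r <= grid m k.+1) phi (grid m k.+1).

Lemma grid_ge0 m k : 0 <= grid m k.
Proof. by rewrite divr_ge0. Qed.

Lemma grid_gt0 m k : 0 < grid m k.+1.
Proof. by rewrite divr_gt0. Qed.

Lemma grid_lt m j k : (grid m j < grid m k) = (j < k)%N.
Proof. by rewrite ltr_pM2r ?invr_gt0// ltr_nat. Qed.

(** The cells of the grid are disjoint. *)
Lemma grid_cell m j r : grid m j < r <= grid m j.+1 ->
  forall k, (grid m k < r <= grid m k.+1) = (k == j).
Proof.
move=> /[dup] jr /andP[j1 j2] k; apply/idP/eqP => [/andP[k1 k2]|->//].
have := lt_le_trans j1 k2; have := lt_le_trans k1 j2.
by rewrite !grid_lt !ltnS => kj jk; apply/eqP; rewrite eqn_leq kj jk.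
Qed.

Lemma grid_valueE m phi j r : (1 <= j < m.+1 ^ 2)%N -> grid m j < r <= grid m j.+1 ->
  grid_value m phi r = phi (grid m j.+1).
Proof.
move=> jN jr; rewrite /grid_value (eq_bigl _ _ (grid_cell jr)).
by rewrite big_nat1_eq jN.
Qed.

Lemma grid_cell_ex m r : 0 < r -> exists j, grid m j < r <= grid m j.+1.
Proof.
move=> r0; have m0 : (0 : R) < m.+1%:R by rewrite ltr0n.
have ex : exists j, r <= grid m j.+1.
  exists (Num.truncn (r * m.+1%:R)).
  by rewrite /grid ler_pdivlMr// ltW// truncnS_gt.
case: (ex_minnP ex) => -[|j] rj hj; [exists 0%N|exists j.+1]; rewrite rj andbT.
  by rewrite /grid mul0r.
by rewrite ltNge; apply/negP => /hj; rewrite ltnn.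
Qed.

Lemma grid_value_bound m phi r M : (forall t, 0 < t -> `|phi t| <= M) -> 0 <= M ->
  `|grid_value m phi r| <= M.
Proof.
move=> phiM M0; have [[j jr]|no] := pselect (exists j, grid m j < r <= grid m j.+1).
  rewrite /grid_value (eq_bigl _ _ (grid_cell jr)) big_nat1_eq.
  by case: ifP => _; rewrite ?normr0// phiM// grid_gt0.
rewrite /grid_value big_pred0 ?normr0// => k; apply/negP => kr.
by apply: no; exists k.
Qed.

(** The truncation does not matter once [1 / (m + 1) < r <= m + 1]. *)
Lemma grid_value_cvg (phi : R -> R) (r : R) : 0 < r ->
  (forall v : nat -> R, (forall m, 0 < v m) -> v m @[m --> \oo] --> r ->
     phi (v m) @[m --> \oo] --> phi r) ->
  grid_value m phi r @[m --> \oo] --> phi r.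
Proof.
move=> r0 cphi; have /choice[K HK] := fun m => grid_cell_ex m r0.
have h0 : m.+1%:R^-1 @[m --> \oo] --> (0 : R) := cvg_harmonic.
have KS m : grid m (K m).+1 = grid m (K m) + m.+1%:R^-1.
  by rewrite /grid -natr1 mulrDl mul1r.
have cv : grid m (K m).+1 @[m --> \oo] --> r.
  apply: (@squeeze_cvgr _ _ _ _ (fun=> r) (fun m => r + m.+1%:R^-1)).
  - apply: nearW => m; have /andP[k1 k2] := HK m.
    by rewrite k2 KS lerD2r ltW.
  - exact: cvg_cst.
  - by rewrite -[X in _ --> X]addr0; apply: cvgD => //; exact: cvg_cst.
have e : \forall m \near \oo, phi (grid m (K m).+1) = grid_value m phi r.
  near=> m; have /andP[k1 k2] := HK m; apply/esym/grid_valueE => //.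
  have m0 : (0 : R) < m.+1%:R by rewrite ltr0n.
  apply/andP; split.
    have : m.+1%:R^-1 < r.
      near: m; move/cvgrPdist_lt : h0 => /(_ r r0); apply: filterS => m /=.
      by rewrite sub0r normrN ger0_norm// invr_ge0.
    rewrite lt0n; apply: contraTN => /eqP K0.
    by rewrite -leNgt; move: k2; rewrite K0 /grid mul1r.
  have rm : r <= m.+1%:R.
    near: m; exists (Num.truncn r) => // m /= hm.
    apply: ltW; apply: lt_le_trans (truncnS_gt _) _.
    by rewrite ler_nat.
  have : grid m (K m) < m.+1%:R := lt_le_trans k1 rm.
  by rewrite /grid ltr_pdivrMr// -natrM ltr_nat mulnn.
apply: cvg_trans (near_eq_cvg e) _.
by apply: cphi => // m; exact: grid_gt0.
Unshelve. all: by end_near. Qed.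

End time_grid.

Section event_mean.
Context (R : realType) (d : measure_display) (T : measurableType d).
Variable P : probability T R.

Lemma ae_probability (A A' : set T) : measurable A -> measurable A' ->
  {ae P, forall w, A w <-> A' w} -> P A = P A'.
Proof.
move=> mA mA' e; rewrite -[A]setIT -[A']setIT -!integral_indic//.
apply: ae_eq_integral => //; try by apply/measurable_EFinP.
apply: filterS e => w e _; congr EFin; rewrite !indicE; congr (nat_of_bool _)%:R.
by apply/idP/idP; rewrite !inE => /e.
Qed.

(** The image by [W] of the restriction of [P] to [E] is proportional to the law of
    [W]; the constant [M] makes the integrands nonnegative. *)
Lemma indep_event_mean (E : set T) (W : T -> R) (M : R) : measurable E ->
  measurable_fun setT W -> (forall t, `|W t| <= M) ->
  (forall A, measurable A -> P (E `&` W @^-1` A) = (P E * P (W @^-1` A))%E) ->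
  \int[P]_t (\1_E t * W t) = fine (P E) * \int[P]_t W t.
Proof.
move=> mE mW WM ind.
have PE0 : 0 <= fine (P E) by rewrite fine_ge0.
pose c := NngNum PE0.
have PEE : P E = (c%:num)%:E by rewrite /= fineK// fin_num_measure.
pose nu1 : {measure set R -> \bar R} :=
  measure_function_pushforward__canonical__measure_function_Measure (mrestr P mE) mW.
pose nu2 : {measure set R -> \bar R} := mscale c
  (measure_function_pushforward__canonical__measure_function_Measure P mW).
have nuE A : measurable A -> nu1 A = nu2 A.
  by move=> mA; rewrite /nu1 /nu2 /= /mscale /= /pushforward /mrestr setIC ind// PEE.
have W0 t : 0 <= W t + M by rewrite -lerBlDr sub0r; have /ler_normlP[] := WM t; rewrite lerNl.
pose g (y : R) : \bar R := (`|y + M|)%:E.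
have mg : measurable_fun setT g.
  by apply/measurable_EFinP; apply: measurableT_comp => //; exact: measurable_funD.
have g0 y : (0 <= g y)%E by rewrite lee_fin.
have mi : measurable_fun setT (\1_E : T -> R) by exact: measurable_indic.
have e1 : (\int[P]_t (\1_E t * (W t + M))%:E = (fine (P E))%:E * \int[P]_t (W t + M)%:E)%E.
  transitivity (\int[nu1]_y g y)%E.
    rewrite /nu1 /= ge0_integral_pushforward//=.
    rewrite (@ge0_integral_density _ _ _ P (mrestr P mE) (\1_E : T -> R))//.
    - by apply: eq_integral => t _; rewrite /g /= ger0_norm// -EFinM mulrC.
    - by move=> A mA; rewrite integral_indic// setIC.
    - exact: measurableT_comp mg mW.
  rewrite (eq_measure_integral nu2); last by move=> A mA _; exact: nuE.
  rewrite ge0_integral_mscale//= ge0_integral_pushforward//=.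
  by congr (_ * _)%E; apply: eq_integral => t _; rewrite /g /= ger0_norm.
have Wi := bounded_integrable P mW WM.
have Mi : P.-integrable setT (EFin \o cst M) by exact: finite_measure_integrable_cst.
have i1 (t : T) : 0 <= (\1_E t : R) <= 1 by rewrite indicE; case: (t \in E); rewrite /= ?lexx ?ler01.
have Ei : P.-integrable setT (EFin \o (fun t => (\1_E t : R) * W t)).
  apply: (bounded_integrable P (M := M)); first exact: measurable_funM.
  move=> t; have /andP[a0 a1] := i1 t; rewrite normrM ger0_norm//.
  by apply: le_trans (WM t); rewrite ler_piMl.
have EMi : P.-integrable setT (EFin \o (fun t => (\1_E t : R) * M)).
  apply: (bounded_integrable P (M := `|M|)); first exact: measurable_funM.
  by move=> t; have /andP[a0 a1] := i1 t; rewrite normrM ger0_norm// ler_piMl.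
have {e1} : \int[P]_t (\1_E t * (W t + M)) = fine (P E) * \int[P]_t (W t + M).
  rewrite /Rintegral e1 fineM//.
  exact: (integrable_fin_num measurableT (integrableD measurableT Wi Mi)).
under eq_Rintegral do rewrite mulrDr.
rewrite !RintegralD// mean_cst mulrDr.
have -> : \int[P]_t (\1_E t * M) = fine (P E) * M.
  rewrite -(mean_indic P mE) RintegralZr//.
  apply: (bounded_integrable P (M := 1)) => // t.
  by have /andP[a0 a1] := i1 t; rewrite ger0_norm.
by move/addIr.
Qed.

End event_mean.

Section brownian_rV_law.
Context (R : realType) (d : measure_display) (T : measurableType d).
Variable P : probability T R.
Variables (n : nat) (x0 : 'rV[R]_n) (X : R -> T -> 'rV[R]_n).
Hypothesis HX : brownian_rV P x0 X.

Lemma measurable_brownian_rV t : 0 <= t -> measurable_fun setT (X t).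
Proof. by move=> t0; apply: measurable_rVP => i; exact: brownian_measurable (HX.1 i) _ t0. Qed.

Lemma brownian_coor_law t i A : 0 < t -> measurable A ->
  P ((fun w => X t w ord0 i) @^-1` A) = normal_prob (x0 ord0 i) (Num.sqrt t) A.
Proof.
move=> t0 mA; have Hi := HX.1 i.
have m0 := brownian_measurable Hi (lexx 0); have mt := brownian_measurable Hi (ltW t0).
have mA' : measurable ((fun x => x + x0 ord0 i) @^-1` A).
  by rewrite -[X in measurable X]setTI; apply: (measurable_funD (f := id)).
have mpre (f : T -> R) B : measurable_fun setT f -> measurable B -> measurable (f @^-1` B).
  by move=> mf mB; rewrite -[X in measurable X]setTI; exact: mf.
rewrite -normal_prob_shift//; last by rewrite gt_eqF// sqrtr_gt0.
have := brownian_normal Hi (lexx 0) t0 mA'; rewrite subr0 => <-.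
apply: ae_probability.
- exact: mpre mt mA.
- by apply: mpre mA'; apply: measurable_funB.
apply: filterS (brownian_start Hi) => w /= ->.
by rewrite subrK.
Qed.

Lemma brownian_rV_box t (A : 'I_n -> set R) : 0 < t -> (forall i, measurable (A i)) ->
  P (X t @^-1` box A) = (\prod_(i < n) normal_prob (x0 ord0 i) (Num.sqrt t) (A i))%E.
Proof.
move=> t0 mA.
have := HX.2 [set: 'I_n]%SET (fun i => (fun w => X t w ord0 i) @^-1` A i) _.
have h i : i \in [set: 'I_n]%SET ->
    sigma_process (fun t w => X t w ord0 i) ((fun w => X t w ord0 i) @^-1` A i).
  by move=> _; apply: sigma_process_preimage => //; exact: ltW.
move=> /(_ h) e; transitivity (P (\bigcap_(i in [set` [set: 'I_n]%SET])
    ((fun w => X t w ord0 i) @^-1` A i))).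
  congr (P _); apply/seteqP; split => w /= Hw i; first by move=> _; exact: Hw.
  by apply: Hw; rewrite /= inE.
rewrite e big_mkcond; apply: eq_bigr => i _; rewrite inE.
exact: brownian_coor_law.
Qed.

Lemma brownian_rV_mean t (g : 'rV[R]_n -> R) M : 0 < t -> measurable_fun setT g ->
  (forall x, `|g x| <= M) ->
  (\int[P]_w (g (X t w))%:E =
   \int[lebesgue_rV R n]_x (g x * gauss_rV x0 (Num.sqrt t) x)%:E)%E.
Proof.
move=> t0 mg gM; have mX := measurable_brownian_rV (ltW t0).
apply: (gauss_mean_rV mX (fun A mA => brownian_rV_box t0 mA) (g := EFin \o g)).
  exact/measurable_EFinP.
apply: (bounded_integrable P (M := M)) => //; exact: measurableT_comp mg mX.
Qed.

Lemma ae_brownian_rV_continuous :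
  {ae P, forall w, continuous (extend (X ^~ w))}.
Proof.
have H : {ae P, forall w, forall i, {within `[0, +oo[, continuous (fun t => X t w ord0 i)}}.
  by apply: filter_forall => i; exact: brownian_continuous (HX.1 i).
apply: filterS H => w cw t; apply: cvg_rV => i.
exact: (@continuous_extend _ _ (fun t => X t w ord0 i) (cw i) t).
Qed.

Variables (u : 'rV[R]_n -> R) (M : R).
Hypotheses (cu : continuous u) (uM : forall x, `|u x| <= M).

Let mu_ := continuous_measurable_rV cu.

Let muX t : 0 <= t -> measurable_fun setT (fun w => u (X t w)).
Proof. by move=> t0; exact: measurableT_comp mu_ (measurable_brownian_rV t0). Qed.

Lemma path_cvg w (v : nat -> R) (r : R) : continuous (extend (X ^~ w)) -> 0 < r ->
  (forall m, 0 < v m) -> v m @[m --> \oo] --> r -> u (X (v m) w) @[m --> \oo] --> u (X r w).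
Proof.
move=> cw r0 v0 vr.
have cX : X (v m) w @[m --> \oo] --> X r w.
  have := cvg_comp v (extend (X ^~ w)) vr (cw r); rewrite /comp (extendE _ (ltW r0)).
  by under eq_fun do rewrite /= (extendE _ (ltW (v0 _))).
exact: (cvg_comp (fun m => X (v m) w) u cX (@cu (X r w))).
Qed.

Lemma mean_path_cvg (v : nat -> R) (r : R) : 0 < r ->
  (forall m, 0 < v m) -> v m @[m --> \oo] --> r ->
  \int[P]_w u (X (v m) w) @[m --> \oo] --> \int[P]_w u (X r w).
Proof.
move=> r0 v0 vr; apply: (@bounded_cvg_mean _ _ _ P _ _ M).
- by move=> m; apply: muX; exact: ltW.
- by apply: muX; exact: ltW.
- by [].
by apply: filterS ae_brownian_rV_continuous => w cw; exact: path_cvg.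
Qed.

End brownian_rV_law.

(** * The mean at the exit time *)

Section gamma_probability.
Context {R : realType}.
Notation mu := (@lebesgue_measure R).
Variable a : R.

Definition gamma_pdf (v : measurableTypeR R) : R :=
  if 0 < v then gamma_fun a v / Gamma a else 0.

Lemma measurable_gamma_pdf : measurable_fun setT gamma_pdf.
Proof.
apply: measurable_fun_ifT => //.
  by apply: measurable_fun_ltr => //; exact: measurable_cst.
by apply: measurable_funM => //; exact: measurable_gamma_fun.
Qed.

Lemma gamma_pdf_ge0 v : 0 <= gamma_pdf v.
Proof.
rewrite /gamma_pdf; case: ifP => // _; rewrite mulr_ge0 ?gamma_fun_ge0// invr_ge0.
by apply: Rintegral_ge0 => t _; exact: gamma_fun_ge0.
Qed.

(** A measure for every [a], but a probability only for [a > 0]: the proof is an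
    argument so that this structure can be inferred. *)
Definition gamma_prob of 0 < a : set (measurableTypeR R) -> \bar R :=
  density_measure mu measurable_gamma_pdf gamma_pdf_ge0.

Hypothesis a0 : 0 < a.

HB.instance Definition _ := Measure.copy (gamma_prob a0)
  (density_measure mu measurable_gamma_pdf gamma_pdf_ge0).

Lemma integral_gamma_pdf (D : set (measurableTypeR R)) : measurable D ->
  D `<=` (`]0%R, +oo[%classic : set R) ->
  (\int[mu]_(v in D) (gamma_pdf v)%:E = \int[mu]_(v in D) (gamma_fun a v / Gamma a)%:E)%E.
Proof.
move=> mD D0; apply: eq_integral => v; rewrite inE => /D0/=.
by rewrite in_itv/= andbT /gamma_pdf => ->.
Qed.

Let gamma_setT : gamma_prob a0 [set: _] = 1%E.
Proof.
rewrite /gamma_prob /density_measure.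
transitivity (\int[mu]_(v in `]0%R, +oo[) (gamma_fun a v / Gamma a)%:E)%E.
  rewrite [RHS]integral_mkcond; apply: eq_integral => v _.
  rewrite /gamma_pdf /patch; case: ifPn => v0; first by rewrite mem_set//= in_itv/= v0.
  by rewrite memNset//= in_itv/= andbT; exact/negP.
under eq_integral do rewrite EFinM.
rewrite ge0_integralZr//.
- by rewrite Gamma_EFin// -EFinM divff// gt_eqF// Gamma_gt0.
- exact: measurable_EFin_gamma_fun.
- by move=> v _; rewrite lee_fin gamma_fun_ge0.
- by rewrite lee_fin invr_ge0 ltW// Gamma_gt0.
Qed.

HB.instance Definition _ :=
  @Measure_isProbability.Build _ _ R (gamma_prob a0) gamma_setT.

Lemma gamma_prob_itv p q : 0 < p -> p <= q ->
  gamma_prob a0 `[p, q[%classic = (gamma_cdf a q - gamma_cdf a p)%:E.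
Proof.
move=> p0 pq; rewrite gamma_cdf_diff// ?(ltW p0)//.
rewrite /gamma_prob /density_measure integral_gamma_pdf//; last first.
  by move=> x /=; rewrite !in_itv/= andbT => /andP[px _]; exact: lt_le_trans px.
have mg D : measurable_fun D (fun v : R => (gamma_fun a v / Gamma a)%:E).
  apply/measurable_EFinP; apply: measurable_funTS.
  by apply: measurable_funM => //; exact: measurable_gamma_fun.
rewrite integral_itv_bndo_bndc//.
by rewrite integral_itv_obnd_cbnd.
Qed.

End gamma_probability.

Section null_sets.
Context (R : realType) (d : measure_display) (T : measurableType d).
Variable P : {measure set T -> \bar R}.
Local Open Scope ereal_scope.
Import HBNNSimple.

Lemma ge0_le_integral_off_null (N : set T) (f g : T -> \bar R) :
  measurable N -> P N = 0 -> (forall x, 0 <= f x) -> (forall x, 0 <= g x) ->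
  (forall x, ~ N x -> f x <= g x) -> \int[P]_x f x <= \int[P]_x g x.
Proof.
move=> mN N0 f0 g0 fg; rewrite !ge0_integralTE//; apply: ge_ereal_sup => _ [h hf <-].
have mNC : measurable (~` N) by exact: measurableC.
apply: ereal_sup_ubound; exists (proj_nnsfun h mNC).
  move=> x /=; rewrite mindicE in_setC; have [xN|xN] := boolP (x \in N).
    by rewrite mulr0.
  rewrite mulr1; apply: le_trans (hf x) (fg x _).
  by move=> Nx; move/negP: xN; apply; exact/mem_set.
rewrite -!integralT_nnsfun; apply: ae_eq_integral => //; try exact/measurable_EFinP.
exists N; split => // x /= H; apply: contrapT => xN; apply: H => _.
by rewrite mindicE in_setC memNset//= mulr1.
Qed.

(** Altering a function on a null set does not change its integral, even when it
    is not measurable: a simple function below [f] may be set to 0 there. *)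
Lemma integral_off_null (N : set T) (f g : T -> \bar R) :
  measurable N -> P N = 0 -> (forall x, ~ N x -> f x = g x) ->
  \int[P]_x f x = \int[P]_x g x.
Proof.
move=> mN N0 fg; rewrite [LHS]integralE [RHS]integralE.
have e (f1 g1 : T -> \bar R) : (forall x, 0 <= f1 x) -> (forall x, 0 <= g1 x) ->
    (forall x, ~ N x -> f1 x = g1 x) -> \int[P]_x f1 x = \int[P]_x g1 x.
  move=> f0 g0 fg1; apply/eqP; rewrite eq_le; apply/andP; split;
    by apply: (ge0_le_integral_off_null mN) => // x Nx; rewrite fg1.
by congr (_ - _); apply: e => // x Nx; rewrite ?funeposE ?funenegE fg.
Qed.

End null_sets.

Section limit_mean.
Context (R : realType) (d : measure_display) (T : measurableType d).
Variable P : probability T R.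

(** The limit [f] need not be measurable, but it agrees with a measurable function
    off a null set. *)
Lemma ae_limit_mean (f_ : nat -> T -> R) (f : T -> R) (M L : R) :
  (forall n, measurable_fun setT (f_ n)) -> (forall n t, `|f_ n t| <= M) ->
  {ae P, forall t, f_ n t @[n --> \oo] --> f t} ->
  \int[P]_t f_ n t @[n --> \oo] --> L -> (\int[P]_t (f t)%:E = L%:E)%E.
Proof.
move=> mf fM [N [mN N0 ff]] cL.
have mNC : measurable (~` N) by exact: measurableC.
pose g n t := f_ n t * \1_(~` N) t; pose h t := f t * \1_(~` N) t.
have gh t : g n t @[n --> \oo] --> h t.
  rewrite /g /h; have [Nt|Nt] := pselect (N t).
    rewrite indicE in_setC mem_set//= mulr0; under eq_fun do rewrite mulr0.
    exact: cvg_cst.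
  by apply: cvgMr_tmp; apply: contrapT => H; apply: Nt; exact: ff.
have mg n : measurable_fun setT (g n) by apply: measurable_funM.
have mh : measurable_fun setT h by apply: (measurable_fun_cvg mg) => t _; exact: gh.
have i1 (t : T) : 0 <= (\1_(~` N) t : R) <= 1.
  by rewrite indicE; case: (t \in _); rewrite /= ?lexx ?ler01.
have gM n t : `|g n t| <= M.
  have /andP[a0 a1] := i1 t; rewrite normrM [`|\1__ _|]ger0_norm//.
  by apply: le_trans (fM n t); rewrite ler_piMr.
have hM t : `|h t| <= M.
  by apply: (ler_cvg_to (cvg_norm (gh t)) (cvg_cst M)); apply: nearW => n; exact: gM.
have cg : \int[P]_t g n t @[n --> \oo] --> \int[P]_t h t.
  by apply: (bounded_cvg_mean mg mh gM); exact: aeW.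
have e n : \int[P]_t g n t = \int[P]_t f_ n t.
  congr fine; apply: (integral_off_null mN) => // t Nt.
  by rewrite /g indicE mem_set//= mulr1.
have -> : L = \int[P]_t h t.
  by move: cg; under eq_fun do rewrite e; move=> cg; exact: cvg_unique cL cg.
rewrite fineK; last exact: (integrable_fin_num measurableT (bounded_integrable P mh hM)).
by apply: (integral_off_null mN) => // t Nt; rewrite /h indicE mem_set//= mulr1.
Qed.

End limit_mean.

Section sums.
Context (R : realType) (d : measure_display) (T : measurableType d).
Variable P : probability T R.

Lemma mean_sum (r : seq nat) (f : nat -> T -> R) :
  (forall k, P.-integrable setT (EFin \o f k)) ->
  \int[P]_t (\sum_(k <- r) f k t) = \sum_(k <- r) \int[P]_t f k t.
Proof.
move=> fi; rewrite /Rintegral; under eq_integral do rewrite -sumEFin.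
rewrite (@integral_sum _ _ _ P _ measurableT _ (fun k t => (f k t)%:E))//.
rewrite sum_fine// => k _; exact: (integrable_fin_num measurableT (fi k)).
Qed.

Lemma indic_bound (A : set T) (x M : R) t : `|x| <= M -> `|\1_A t * x| <= M.
Proof.
move=> xM; rewrite indicE; case: (t \in A); rewrite /= ?mul1r// mul0r normr0.
exact: le_trans xM.
Qed.

Lemma indic_integrable (A : set T) (f : T -> R) (M : R) : measurable A ->
  measurable_fun setT f -> (forall t, `|f t| <= M) ->
  P.-integrable setT (EFin \o (fun t => (\1_A t : R) * f t)).
Proof.
move=> mA mf fM; apply: (bounded_integrable P (M := M)); first exact: measurable_funM.
by move=> t; exact: indic_bound.
Qed.

End sums.

Lemma inv_cell (R : realType) (c t t' v : R) : 0 < c -> 0 < t -> 0 < t' ->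
  (c / t' <= v < c / t) = (t < c / v <= t').
Proof.
move=> c0 t0 t0'; have [v0|v0] := ltP 0 v.
  by rewrite ler_pdivrMr// !ltr_pdivlMr// ler_pdivrMr// andbC mulrC (mulrC v).
rewrite leNgt (le_lt_trans v0) ?divr_gt0//= ltNge (le_trans _ (ltW t0))//.
by rewrite mulr_ge0_le0 ?(ltW c0)// invr_le0.
Qed.

Section exit_mean.
Context (R : realType) (n : nat) (s : R) (u : 'rV[R]_n -> R) (x0 : 'rV[R]_n) (y0 : R).
Context (d : measure_display) (T : measurableType d) (P : probability T R).
Variables (X : R -> T -> 'rV[R]_n) (Y B : R -> T -> R) (M : R).
Hypotheses (s0 : 0 < s) (s1 : s < 1) (cu : continuous u) (uM : forall x, `|u x| <= M).
Hypotheses (y0_gt0 : 0 < y0) (HX : brownian_rV P x0 X) (HY : bessel P s y0 B Y).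
Hypothesis XY_indep : independent2 P (sigma_process X) (sigma_process Y).

Let c := y0 ^+ 2 / 2.
Let c0 : 0 < c. Proof. by rewrite divr_gt0 ?exprn_gt0. Qed.
Let M0 : 0 <= M. Proof. exact: le_trans (uM 0). Qed.
Let D t := alive_at Y t.
Let mD t : measurable (D t) := measurable_alive_at HY t.
Let cell m k : set T := D (grid m k) `\` D (grid m k.+1).
Let mcell m k : measurable (cell m k). Proof. exact: measurableD. Qed.
Let V (r : R) := \int[P]_w u (X r w).
Let tau w := hitting_time (~` [set x : R | 0 < x]) (Y ^~ w).

Let muX t : 0 <= t -> measurable_fun setT (fun w => u (X t w)).
Proof.
by move=> t0; exact: measurableT_comp (continuous_measurable_rV cu) (measurable_brownian_rV HX t0).
Qed.

Let D_anti t t' : t <= t' -> D t' `<=` D t.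
Proof.
move=> tt w [m _ A]; exists m => // i _ j _ /= ij.
exact: (A i I j I (le_trans ij tt)).
Qed.

Let grid_le m k : grid m k <= grid m k.+1 :> R.
Proof. by rewrite ltW// grid_lt. Qed.

Let indic_cell m k w : \1_(cell m k) w = \1_(D (grid m k)) w - \1_(D (grid m k.+1)) w :> R.
Proof.
rewrite !indicE in_setD; have := @D_anti _ _ (grid_le m k) w.
have [w1|w1] := boolP (w \in D (grid m k.+1)); rewrite /= ?andbF ?andbT ?subr0//.
by move=> /(_ (set_mem w1)) Dw; rewrite (mem_set Dw) subrr.
Qed.

Let indic01 (A : set T) w : 0 <= (\1_A w : R) <= 1.
Proof. by rewrite indicE; case: (w \in A); rewrite /= ?lexx ?ler01. Qed.

(** [y0 ^ 2 / (2 v)] lies in the cell when [v] lies in this interval. *)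
Let cell_prob m k : (1 <= k)%N ->
  fine (P (cell m k)) = fine (gamma_prob s0 `[c / grid m k.+1, c / grid m k[%classic).
Proof.
case: k => // k _.
rewrite gamma_prob_itv; last 2 first.
- by rewrite divr_gt0// grid_gt0.
- by rewrite ler_wpM2l ?(ltW c0)// lef_pV2 ?posrE ?grid_gt0.
have SE j : survival s (grid m j.+1) y0 = gamma_cdf s (c / grid m j.+1).
  rewrite survival_pos//; congr gamma_cdf; rewrite /c; field.
  by rewrite gt_eqF// grid_gt0.
rewrite /cell measureD//; last by rewrite ltey_eq fin_num_measure.
rewrite setIidr; last exact: D_anti.
have pr j := alive_at_prob s0 s1 y0_gt0 HY (@grid_gt0 R m j).
rewrite [X in (X - _)%E]pr [X in (_ - X)%E]pr.
by rewrite !SE.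
Qed.

(** The value of [u] along [X] at the first grid point after the exit time, written
    so that independence applies to each term. *)
Let G m w := \sum_(1 <= k < (m.+1 ^ 2)%N) (\1_(cell m k) w * u (X (grid m k.+1) w)).

Let mG m : measurable_fun setT (G m).
Proof.
apply: measurable_sum => k; apply: measurable_funM; first exact: measurable_indic.
by apply: muX; exact: grid_ge0.
Qed.

(** The events [D (grid m k)] decrease with [k], so the sum of the indicators of
    the cells telescopes. *)
Let GM m w : `|G m w| <= M.
Proof.
have N1 : (1 <= m.+1 ^ 2)%N by rewrite expn_gt0.
apply: (@le_trans _ _ (\sum_(1 <= k < (m.+1 ^ 2)%N) (\1_(cell m k) w * M))).
  apply: le_trans (ler_norm_sum _ _ _) _; apply: ler_sum => k _.
  have /andP[a0 a1] := indic01 (cell m k) w.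
  by rewrite normrM ger0_norm// ler_wpM2l.
rewrite -big_distrl/= ler_piMl//.
under eq_bigr do rewrite indic_cell -opprB.
rewrite sumrN telescope_sumr// opprB.
Qed.

Let VM r : 0 <= r -> `|V r| <= M.
Proof.
move=> r0; have ui := bounded_integrable P (muX r0) (fun w => uM (X r w)).
apply: le_trans (le_normr_Rintegral _ ui) _ => //.
rewrite -(mean_cst P M); apply: le_Rintegral => //.
- exact: integrable_abse ui.
- exact: finite_measure_integrable_cst.
Qed.

Let itv_cell m k v : (1 <= k)%N -> (\1_`[c / grid m k.+1, c / grid m k[%classic v : R) =
  if grid m k < c / v <= grid m k.+1 then 1 else 0.
Proof.
case: k => // k _; have t1 := @grid_gt0 R m k; have t2 := @grid_gt0 R m k.+1.
suff e : (v \in `[c / grid m k.+2, c / grid m k.+1[%classic) =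
    (grid m k.+1 < c / v <= grid m k.+2).
  by rewrite indicE e; case: (_ < _ <= _).
by rewrite mem_setE in_itv/= inv_cell.
Qed.

Let sigma_cell m k : sigma_process Y (cell m k).
Proof.
have -> : cell m k = \bigcap_i (if i == 0%N then D (grid m k) else ~` D (grid m k.+1)).
  apply/seteqP; split => [w [w1 w2] [|i] _//|w H].
  by split; [exact: (H 0%N)|exact: (H 1%N)].
by apply: sigma_process_bigcap => -[|i] /=; [|apply: sigma_algebraC]; exact: sigma_alive_at.
Qed.

Let G_mean m : \int[P]_w G m w = \int[gamma_prob s0]_v grid_value m V (c / v).
Proof.
have mV k : measurable_fun setT (fun _ : measurableTypeR R => V (grid m k.+1)) by [].
rewrite /G mean_sum; last first.
  by move=> k; apply: indic_integrable => //; apply: muX; exact: grid_ge0.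
transitivity (\int[gamma_prob s0]_v \sum_(1 <= k < (m.+1 ^ 2)%N)
    (\1_`[c / grid m k.+1, c / grid m k[%classic v * V (grid m k.+1))); last first.
  apply: eq_Rintegral => v _; rewrite /grid_value [RHS]big_mkcond [LHS]big_nat [RHS]big_nat.
  by apply: eq_bigr => k /andP[k1 _]; rewrite itv_cell//; case: ifP; rewrite ?mul1r ?mul0r.
rewrite mean_sum; last first.
  move=> k; apply: (@indic_integrable _ _ _ _ _ _ M) => //.
  by move=> _; apply: VM; exact: grid_ge0.
rewrite big_nat [RHS]big_nat; apply: eq_bigr => k /andP[k1 _].
rewrite (@indep_event_mean _ _ _ P _ _ M)//.
- rewrite cell_prob// RintegralZr//; last first.
    apply: (bounded_integrable (gamma_prob s0) (M := 1)) => // v.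
    by rewrite indicE; case: (_ \in _); rewrite /= ?normr1 ?normr0.
  by rewrite mean_indic.
- by apply: muX; exact: grid_ge0.
- move=> A mA; rewrite setIC muleC; apply: XY_indep; last exact: sigma_cell.
  apply: (sigma_process_preimage (grid_ge0 _ _) (A := u @^-1` A)).
  by rewrite -[X in measurable X]setTI; exact: continuous_measurable_rV cu _ _ mA.
Qed.

Let good w := good_path s y0 B Y w /\ continuous (extend (X ^~ w)).

Let ae_good : {ae P, forall w, good w}.
Proof. by apply: filterS2 (ae_good_path HY) (ae_brownian_rV_continuous HX) => w; split. Qed.

Let tauP w t : good_path s y0 B Y w -> 0 <= t -> D t w <-> (t%:E < tau w)%E.
Proof.
move=> Gw t0; have [Y0w cY _] := Gw; rewrite /D (alive_atP Gw t0); split.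
  by apply: hitting_time_gt => // x /=; rewrite leNgt => /negP.
by apply: lt_hitting_time => [x /=|]; [rewrite leNgt => /negP|rewrite Y0w].
Qed.

(** [survival s t y0] tends to 0 as [t] tends to infinity. *)
Let tau_finite : {ae P, forall w, exists2 r, 0 < r & tau w = r%:E}.
Proof.
have Dn0 : P (\bigcap_(m in [set: nat]) D m.+1%:R) = 0.
  have v0 m : 0 < y0 ^+ 2 / (2 * m.+1%:R) by rewrite divr_gt0 ?exprn_gt0 ?mulr_gt0.
  have cv : y0 ^+ 2 / (2 * m.+1%:R) @[m --> \oo] --> (0 : R).
    rewrite [X in X @ _](_ : _ = (fun m => y0 ^+ 2 / 2 * m.+1%:R^-1)); last first.
      by apply/funext => m; rewrite invfM mulrA.
    by rewrite -[X in _ --> X](mulr0 (y0 ^+ 2 / 2)); apply: cvgMl_tmp; exact: cvg_harmonic.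
  have mDn : measurable (\bigcap_(m in [set: nat]) D m.+1%:R) by exact: bigcapT_measurable.
  apply/eqP; rewrite eq_le measure_ge0 andbT -(fineK (fin_num_measure P _ mDn)) lee_fin.
  apply: ler_cvg_to (cvg_cst _) (gamma_cdf_cvg0 s0 v0 cv) _; apply: nearW => m.
  rewrite -survival_pos// -lee_fin fineK ?fin_num_measure//.
  rewrite -(alive_at_prob s0 s1 y0_gt0 HY (ltr0Sn R m)).
  by apply: le_measure; rewrite ?inE//; exact: bigcap_inf.
have : {ae P, forall w, ~ (\bigcap_(m in [set: nat]) D m.+1%:R) w}.
  exists (\bigcap_(m in [set: nat]) D m.+1%:R); split => //.
    by apply: bigcapT_measurable.
  by move=> w /= /contrapT.
apply: filterS2 ae_good => w [Gw _] /existsNP[m /not_implyP[_ /(tauP Gw (ler0n _ _))]].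
have /(tauP Gw (lexx 0)) : D 0 w.
  apply/(alive_atP Gw (lexx 0)) => r; rewrite -eq_le => /eqP <-.
  by have [-> _ _] := Gw.
case: (tau w) => [r| |].
- by rewrite lte_fin => r0 _; exists r.
- by move=> _ /(_ (ltry _)).
- by [].
Qed.

(** [F] stands for [u] at the exit point; it need not be measurable, and its values
    are irrelevant when [tau] is infinite. *)
Lemma exit_mean (F : T -> R) :
  {ae P, forall w, forall r, tau w = r%:E -> F w = u (X r w)} ->
  (\int[P]_w (F w)%:E = (\int[gamma_prob s0]_v (if 0 < v then V (c / v) else 0))%:E)%E.
Proof.
move=> HF.
apply: (@ae_limit_mean _ _ _ P G F M) => //.
  apply: filterS3 ae_good tau_finite HF => w [Gw cX] [r r0 tr] /(_ r tr) ->.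
  have GE m : G m w = grid_value m (fun t => u (X t w)) r.
    rewrite /G /grid_value [RHS]big_mkcond; apply: eq_bigr => k _.
    suff e : (w \in cell m k) = (grid m k < r <= grid m k.+1).
      by rewrite indicE e; case: ifP; rewrite ?mul1r ?mul0r.
    rewrite in_setD leNgt.
    by congr (_ && ~~ _); apply/idP/idP; rewrite -lte_fin -tr inE => /(tauP Gw (grid_ge0 _ _)).
  under eq_fun do rewrite GE.
  by apply: grid_value_cvg => // v v0 vr; exact: (path_cvg cu cX r0 v0 vr).
under eq_fun do rewrite G_mean.
have gv v m : v <= 0 -> grid_value m V (c / v) = 0.
  move=> v0; rewrite /grid_value big_pred0// => k; apply/negP => /andP[k1 _].
  have := le_lt_trans (grid_ge0 _ _) k1; apply/negP; rewrite -leNgt.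
  by rewrite mulr_ge0_le0 ?(ltW c0)// invr_le0.
have cv (v : measurableTypeR R) : grid_value m V (c / v) @[m --> \oo] -->
    (if 0 < v then V (c / v) else 0).
  case: ifPn => v0; last first.
    by under eq_fun do rewrite gv ?leNgt//; exact: cvg_cst.
  apply: grid_value_cvg; first by rewrite divr_gt0.
  by move=> w w0 wr; apply: (mean_path_cvg HX cu uM) => //; rewrite divr_gt0.
have mg m : measurable_fun setT (fun v : measurableTypeR R => grid_value m V (c / v)).
  rewrite (_ : (fun v => _) = fun v => \sum_(1 <= k < (m.+1 ^ 2)%N)
      (\1_`[c / grid m k.+1, c / grid m k[%classic v * V (grid m k.+1))).
    by apply: measurable_sum => k; exact: measurable_funM.
  apply/funext => v; rewrite /grid_value big_mkcond [LHS]big_nat [RHS]big_nat.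
  by apply: eq_bigr => k /andP[k1 _]; rewrite itv_cell//; case: ifP; rewrite ?mul1r ?mul0r.
apply: (@bounded_cvg_mean _ _ _ (gamma_prob s0) _ _ M) => //.
- by apply: (measurable_fun_cvg mg) => v _; exact: cv.
- by move=> m v; apply: grid_value_bound => // t t0; apply: VM; exact: ltW.
- by apply: aeW => v; exact: cv.
Qed.

End exit_mean.

(** * The Poisson kernel as a mixture of Gaussian densities *)

Section heat_kernel_mixture.
Context {R : realType}.
Notation mu := (@lebesgue_measure R).
Variables (n : nat) (s y0 : R).
Hypotheses (s0 : 0 < s) (y0_gt0 : 0 < y0).

Lemma sqnorm2_ge0 (z : 'rV[R]_n) : 0 <= sqnorm2 z.
Proof. by apply: sumr_ge0 => i _; exact: sqr_ge0. Qed.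

(** The centred Gaussian density of variance [y0 ^ 2 / (2 v)] (see [gauss_rV_heat]),
    written so that its dependence on [v] is a power times an exponential. *)
Definition heat (v : R) (z : 'rV[R]_n) : R :=
  (v / (pi * y0 ^+ 2)) `^ (n%:R / 2) * expR (- (v * (sqnorm2 z / y0 ^+ 2))).

Lemma heat_ge0 v z : 0 <= heat v z.
Proof. by rewrite mulr_ge0 ?powR_ge0 ?expR_ge0. Qed.

Lemma gauss_rV_heat (m x : 'rV[R]_n) v : 0 < v ->
  gauss_rV m (Num.sqrt (y0 ^+ 2 / 2 / v)) x = heat v (m - x).
Proof.
move=> v0; have y2 : 0 < y0 ^+ 2 by rewrite exprn_gt0.
have c0 : 0 < y0 ^+ 2 / 2 / v by rewrite !divr_gt0.
have sg0 : Num.sqrt (y0 ^+ 2 / 2 / v) != 0 by rewrite gt_eqF// sqrtr_gt0.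
have vE : Num.sqrt (y0 ^+ 2 / 2 / v) ^+ 2 *+ 2 = y0 ^+ 2 / v.
  by rewrite sqr_sqrtr ?ltW// -mulr_natr; field; rewrite gt_eqF.
have pE : Num.sqrt (y0 ^+ 2 / 2 / v) ^+ 2 * pi *+ 2 = (v / (pi * y0 ^+ 2))^-1.
  rewrite -mulrnAl vE invf_div; field; exact: lt0r_neq0.
rewrite /gauss_rV; under eq_bigr do rewrite normal_pdfE// /normal_peak /normal_fun pE vE.
rewrite big_split/= prodr_const card_ord -expR_sum; congr (_ * expR _).
  have w0 : 0 < v / (pi * y0 ^+ 2) by rewrite divr_gt0// mulr_gt0// pi_gt0.
  rewrite sqrtrV ?ltW// invrK -powR12_sqrt ?ltW//.
  by rewrite -[LHS]powR_mulrn ?powR_ge0// -powRrM (mulrC 2^-1).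
rewrite /sqnorm2 mulr_suml mulr_sumr -sumrN; apply: eq_bigr => i _.
rewrite !mxE -sqrrN opprB; field.
by rewrite !lt0r_neq0.
Qed.

Lemma measurable_heat (x0 : 'rV[R]_n) :
  measurable_fun setT (fun p : measurableTypeR R * 'rV[R]_n => heat p.1 (x0 - p.2)).
Proof.
have m1 : measurable_fun setT (fun p : measurableTypeR R * 'rV[R]_n => p.1 : R) by exact: measurable_fst.
apply: measurable_funM.
  apply: (measurableT_comp (measurable_powR _)); exact: measurable_funM.
apply: measurableT_comp => //; apply: measurableT_comp => //; apply: measurable_funM => //.
apply: measurable_funM => //; apply: measurable_sum => i; apply: measurable_funX.
under eq_fun do rewrite !mxE.
apply: measurable_funB => //.
exact: measurableT_comp (measurable_rV_coor i) measurable_snd.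
Qed.

Let a := s + n%:R / 2.
Let a0 : 0 < a. Proof. by rewrite ltr_pwDl// divr_ge0. Qed.

(** With [a = s + n / 2] and [b = 1 + |z| ^ 2 / y0 ^ 2] the integrand is a constant
    times [v ^ (a - 1) exp (- b v)], whose integral is [Gamma a / b ^ a]. *)
Lemma heat_mixture (z : 'rV[R]_n) :
  (\int[gamma_prob s0]_v (if 0 < v then heat v z else 0)%:E =
   (poisson_kernel s y0 z)%:E)%E.
Proof.
have y2 : 0 < y0 ^+ 2 by rewrite exprn_gt0.
have q0 := sqnorm2_ge0 z.
pose b := 1 + sqnorm2 z / y0 ^+ 2.
have b0 : 0 < b by rewrite ltr_pwDl// divr_ge0// ltW.
pose C := (pi * y0 ^+ 2) `^ (- (n%:R / 2)) / Gamma s * b `^ (1 - a).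
have C0 : 0 <= C by rewrite mulr_ge0 ?powR_ge0// divr_ge0 ?powR_ge0// ltW// Gamma_gt0.
pose f (v : R) : R := if 0 < v then gamma_fun a v else 0.
have f0 v : 0 <= f v by rewrite /f; case: ifP => // _; exact: gamma_fun_ge0.
have mf : measurable_fun setT f.
  by apply: measurable_fun_ifT => //; [exact: measurable_fun_ltr|exact: measurable_gamma_fun].
have fE : (\int[mu]_v (f v)%:E = (Gamma a)%:E)%E.
  rewrite -(Gamma_EFin a0) [RHS]integral_mkcond; apply: eq_integral => v _.
  rewrite /f /patch; case: ifPn => v0; first by rewrite mem_set//= in_itv/= v0.
  by rewrite memNset//= in_itv/= andbT; exact/negP.
have mh : measurable_fun setT (fun v : measurableTypeR R => if 0 < v then heat v z else 0).
  apply: measurable_fun_ifT => //.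
    by apply: measurable_fun_ltr => //; exact: measurable_cst.
  have := measurableT_comp (measurable_heat z) (measurable_pair2 (0 : 'rV[R]_n)).
  by rewrite (_ : _ \o _ = heat ^~ z)//; apply/funext => v; rewrite /= subr0.
rewrite (@ge0_integral_density _ _ _ mu (gamma_prob s0) _ (measurable_gamma_pdf s) (@gamma_pdf_ge0 _ s))//; last 2 first.
- exact/measurable_EFinP.
- by move=> v; rewrite lee_fin; case: ifP => // _; exact: heat_ge0.
transitivity (\int[mu]_v (C%:E * (f (b * v + 0))%:E))%E.
  apply: eq_integral => v _; rewrite -!EFinM; congr EFin.
  rewrite /gamma_pdf /f addr0 pmulr_rgt0//; case: ifPn => v0; last by rewrite !mulr0.
  have piy : 0 < pi * y0 ^+ 2 by rewrite mulr_gt0// pi_gt0.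
  have e1 : (v / (pi * y0 ^+ 2)) `^ (n%:R / 2) = v `^ (n%:R / 2) * (pi * y0 ^+ 2) `^ (- (n%:R / 2)).
    rewrite powRM ?invr_ge0 ?(ltW v0) ?(ltW piy)//; congr (_ * _).
    by rewrite -powR_inv1 ?(ltW piy)// -powRrM mulN1r.
  have e2 : v `^ (a - 1) = v `^ (n%:R / 2) * v `^ (s - 1).
    by rewrite -powRD ?(gt_eqF v0) ?implybT//; congr (_ `^ _); rewrite /a; ring.
  have e3 : expR (- (b * v)) = expR (- (v * (sqnorm2 z / y0 ^+ 2))) * expR (- v).
    by rewrite -expRD; congr expR; rewrite /b; ring.
  have e4 : b `^ (1 - a) * b `^ (a - 1) = 1.
    by rewrite -[1 - a]opprB powRN mulVf// gt_eqF// powR_gt0.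
  rewrite /heat /C /gamma_fun e1 e3 (powRM _ (ltW b0) (ltW v0)) e2.
  rewrite -[LHS]mulr1 -[X in _ * X]e4; ring.
rewrite ge0_integralZl//; last 2 first.
- apply/measurable_EFinP; apply: (measurableT_comp mf); exact: measurable_funD.
- by move=> v _; rewrite lee_fin.
have := @ge0_integral_affine _ b 0 (EFin \o f) b0 _ _.
rewrite /= fE; set I := (\int[_]_x _)%E => H.
have {H} -> : I = (Gamma a / b)%:E.
  have {}H : (Gamma a)%:E = (b%:E * I)%E by apply: H => //; exact/measurable_EFinP.
  by rewrite mulrC EFinM H muleA -EFinM mulVf ?mul1e// gt_eqF.
rewrite -EFinM; congr EFin.
have w0 : 0 < sqnorm2 z + y0 ^+ 2 by rewrite ltr_wpDl.
have e1 : b `^ (1 - a) = b / b `^ a.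
  by rewrite powRB ?powRr1 ?(ltW b0)// (gt_eqF b0) implybT.
have e2 : (sqnorm2 z + y0 ^+ 2) `^ a = b `^ a * (y0 ^+ 2) `^ a.
  rewrite -powRM ?(ltW b0) ?(ltW y2)//; congr (_ `^ _); rewrite /b mulrDl mul1r.
  by rewrite divfK ?gt_eqF// addrC.
have e3 : (y0 ^+ 2) `^ a = y0 `^ (2 * s) * (y0 ^+ 2) `^ (n%:R / 2).
  rewrite powRD ?(gt_eqF y2) ?implybT//; congr (_ * _).
  by rewrite -powR_mulrn ?(ltW y0_gt0)// -powRrM.
have e4 : (pi * y0 ^+ 2) `^ (n%:R / 2) = pi `^ (n%:R / 2) * (y0 ^+ 2) `^ (n%:R / 2).
  by rewrite powRM ?(ltW y2)// pi_ge0.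
rewrite /C /poisson_kernel (addrC (n%:R / 2)) -/a e1 e2 e3 powRN e4.
have G0 := Gamma_gt0 s0; have p1 := powR_gt0 (n%:R / 2) (pi_gt0 R).
have p2 := powR_gt0 (n%:R / 2) y2; have p3 := powR_gt0 a b0.
have p4 := powR_gt0 (2 * s) y0_gt0.
by field; rewrite !lt0r_neq0.
Qed.

End heat_kernel_mixture.

Section heat_integral.
Context (R : realType) (n : nat) (s : R) (u : 'rV[R]_n -> R) (x0 : 'rV[R]_n) (y0 : R).
Context (d : measure_display) (T : measurableType d) (P : probability T R).
Variables (X : R -> T -> 'rV[R]_n) (M : R).
Hypotheses (s0 : 0 < s) (cu : continuous u) (uM : forall x, `|u x| <= M).
Hypotheses (y0_gt0 : 0 < y0) (HX : brownian_rV P x0 X).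

Let mu_ := continuous_measurable_rV cu.
Let K (p : measurableTypeR R * 'rV[R]_n) : R :=
  if 0 < p.1 then u p.2 * heat y0 p.1 (x0 - p.2) else 0.

Let mK : measurable_fun setT K.
Proof.
apply: measurable_fun_ifT => //.
  apply: measurable_fun_ltr; first exact: measurable_cst.
  exact: measurable_fst.
apply: measurable_funM; first exact: measurableT_comp mu_ measurable_snd.
exact: measurable_heat.
Qed.

Let t_gt0 v : 0 < v -> 0 < y0 ^+ 2 / 2 / v.
Proof. by move=> v0; rewrite !divr_gt0 ?exprn_gt0. Qed.

Let heat_mean v (g : 'rV[R]_n -> R) : 0 < v -> measurable_fun setT g -> (forall x, `|g x| <= M) ->
  (\int[lebesgue_rV R n]_x (g x * heat y0 v (x0 - x))%:E =
   \int[P]_w (g (X (y0 ^+ 2 / 2 / v) w))%:E)%E.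
Proof.
move=> v0 mg gM; rewrite (brownian_rV_mean HX (t_gt0 v0) mg gM).
by apply: eq_integral => x _; rewrite (gauss_rV_heat y0_gt0).
Qed.

Let muX t : 0 <= t -> measurable_fun setT (fun w => u (X t w)).
Proof. by move=> t0; exact: measurableT_comp mu_ (measurable_brownian_rV HX t0). Qed.

Let iK : (gamma_prob s0 \x lebesgue_rV R n)%E.-integrable setT (EFin \o K).
Proof.
apply/integrable12ltyP; first exact/measurable_EFinP.
apply: (@le_lt_trans _ _ (\int[gamma_prob s0]_v (M%:E)))%E; last first.
  by rewrite integral_cst//; have := @probability_setT _ _ _ (gamma_prob s0) => /= ->; rewrite mule1 ltry.
apply: ge0_le_integral => //.
- by move=> v _; apply: integral_ge0.
- have mA : measurable_fun setT (abse \o (EFin \o K)).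
    by apply: measurableT_comp => //; exact/measurable_EFinP.
  exact: (@measurable_fun_fubini_tonelli_F _ _ _ _ R (lebesgue_rV R n) _ mA (fun=> abse_ge0 _)).
move=> v _; rewrite /K /=; have [v0|v0] := ltP 0 v; last first.
  by rewrite integral0_eq ?lee_fin ?(le_trans _ (uM 0))// => x _; rewrite normr0.
rewrite (eq_integral (fun x => (`|u x| * heat y0 v (x0 - x))%:E)); last first.
  by move=> x _ /=; rewrite normrM [`|heat _ _ _|]ger0_norm// heat_ge0.
rewrite (heat_mean (g := fun x => `|u x|) v0); last 2 first.
- exact: measurableT_comp.
- by move=> x; rewrite normr_id.
apply: (@le_trans _ _ (\int[P]_w (M%:E)))%E; last first.
  by rewrite integral_cst//; have := @probability_setT _ _ _ P => /= ->; rewrite mule1.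
apply: ge0_le_integral => //.
- apply/measurable_EFinP; apply: measurableT_comp => //.
  by apply: muX; exact/ltW/t_gt0.
- by move=> w _; rewrite lee_fin.
Qed.

(** Fubini's theorem, whose integrability condition holds because [u] is bounded and
    the Gaussian densities have mass 1. *)
Lemma heat_integral :
  ((\int[gamma_prob s0]_v (if 0 < v then \int[P]_w u (X (y0 ^+ 2 / 2 / v) w) else 0))%:E =
   \int[lebesgue_rV R n]_x (poisson_kernel s y0 (x0 - x) * u x)%:E)%E.
Proof.
have KE v : ((if 0 < v then \int[P]_w u (X (y0 ^+ 2 / 2 / v) w) else 0)%:E =
    \int[lebesgue_rV R n]_x (K (v, x))%:E)%E.
  rewrite /K /=; case: ifPn => v0; last by rewrite integral0.
  rewrite heat_mean// /Rintegral fineK//.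
  apply: (integrable_fin_num measurableT (bounded_integrable P (M := M) _ _)) => //.
  by apply: muX; exact/ltW/t_gt0.
rewrite /Rintegral fineK; last first.
  under eq_integral do rewrite KE.
  have := integral12_prod_meas1 iK; rewrite /fubini_F => ->.
  exact: (integrable_fin_num measurableT iK).
under eq_integral do rewrite KE.
rewrite (Fubini iK); apply: eq_integral => x _.
have E v : K (v, x) = u x * (if 0 < v then heat y0 v (x0 - x) else 0).
  by rewrite /K/=; case: ifP => //; rewrite mulr0.
under eq_integral do rewrite /= E EFinM.
rewrite integralZl//; last first.
  apply/integrableP; split.
    apply/measurable_EFinP; apply: measurable_fun_ifT => //.
      by apply: measurable_fun_ltr => //; exact: measurable_cst.
    exact: measurableT_comp (measurable_heat y0 x0) (measurable_pair2 x).
  under eq_integral => v _.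
    rewrite gee0_abs ?lee_fin; last by case: ifP => // _; exact: heat_ge0.
    over.
  by rewrite heat_mixture// ltry.
by rewrite heat_mixture// -EFinM mulrC.
Qed.

End heat_integral.

Theorem mainTheorem2 (R : realType) (n : nat) (s : R) (u : 'rV[R]_n -> R)
    (x0 : 'rV[R]_n) (y0 : R)
    (d : measure_display) (T : measurableType d) (P : probability T R)
    (X : R -> T -> 'rV[R]_n) (Y B : R -> T -> R)
    (n_ge1 : (1 <= n)%N) (s_gt0 : 0 < s) (s_lt1 : s < 1)
    (u_C2 : C2 u) (u_bounded : bounded_fun u) (y0_gt0 : 0 < y0)
    (X_brownian : brownian_rV P x0 X)
    (Y_bessel : bessel P s y0 B Y)
    (XB_indep : independent2 P (sigma_process X) (sigma_process B))
    (XY_indep : independent2 P (sigma_process X) (sigma_process Y)) :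
  let Z w t : 'rV[R]_n * R := (X t w, Y t w) in
  let tau w : \bar R := exit_time (@upper_half_space R n) (Z w) in
  let Ztau w : 'rV[R]_n * R := value_at (tau w) (Z w) in
  ('E_P[fun w => u (Ztau w).1] =
   \int[lebesgue_rV R n]_x (poisson_kernel s y0 (x0 - x) * u x)%:E)%E.
Proof.
move=> Z tau Ztau; have [cu _ _] := u_C2.
have [M uM] : exists M, forall x, `|u x| <= M.
  have [N [_ HN]] := u_bounded; exists (N + 1) => x.
  by apply: HN => //; rewrite ltrDl.
rewrite unlock -(heat_integral s_gt0 cu uM y0_gt0 X_brownian).
have := @exit_mean _ _ _ _ _ _ _ _ _ _ _ _ _ s_gt0 s_lt1 cu uM y0_gt0 X_brownian Y_bessel XY_indep (fun w => u (Ztau w).1).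
apply.
by apply: aeW => w r tr; rewrite /Ztau (_ : tau w = r%:E).
Qed.
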